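(* Let $T$ be an equilateral compact metric tree rooted at $v_0$, with edges of length $\ell>0$ and real-valued potentials $q_j\in L^2(0,\ell)$, let $T_\infty$ be obtained from $T$ by attaching a half-infinite lead $e_0=[0,\infty)$ at $v_0$ with potential $q_0=0$ on $e_0$, and impose standard conditions at all vertices of $T_\infty$. Let $E(\sqrt\lambda)=\phi_N(\lambda)+i\sqrt\lambda\,\phi_D(\lambda)$, $\sqrt\lambda\in\mathbb C$, be the Jost function. Then: 1. All zeros of the function $\sqrt\lambda\mapsto E(\sqrt\lambda)$ are located either in the closed lower half-plane or on a finite interval of the positive imaginary half-axis. 2. The following four numbers are equal: the number of zeros of $\sqrt\lambda\mapsto E(\sqrt\lambda)$ located on the positive imaginary half-axis (counted with multiplicities); the number of negative zeros of the function $\lambda\mapsto\phi_N(\lambda)$ (counted with multiplicities); the number of negative eigenvalues of $L_N$ (counted with multiplicities); the number of negative eigenvalues of $L_\infty$ (counted with multiplicities).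
   Context: Tree. $T$ is a finite metric tree with $p\ge2$ vertices and $g=p-1$ edges $e_1,\dots,e_g$, all of length $\ell>0$, with a chosen vertex $v_0$ as root. $d(v)$ is the degree of $v$ in $T$ (the lead is not counted). Edges are directed away from the root and each is identified with $[0,\ell]$, $x=0$ being its initial vertex; each vertex $v\ne v_0$ has exactly one incoming edge. The edges outgoing from $v_0$ are $e_1,\dots,e_{d(v_0)}$. On $e_j$ consider $-y_j''+q_jy_j=\lambda y_j$, $q_j\in L^2(0,\ell)$ real-valued. Vertex conditions. Standard conditions at $v\neq v_0$ with incoming edge $e_j$: $y_j'(\ell)=0$ if $v$ is pendant; if $v$ is interior, $y_j(\ell)=y_k(0)$ for every edge $e_k$ outgoing from $v$ and $y_j'(\ell)=\sum_k y_k'(0)$, the sum being over edges outgoing from $v$. Standard conditions at $v_0$ in $T$: $y_1(0)=y_k(0)$ for $k=2,\dots,d(v_0)$ and $\sum_{k=1}^{d(v_0)}y_k'(0)=0$. Dirichlet condition at $v_0$: $y_k(0)=0$, $k=1,\dots,d(v_0)$. $L_N$ is the operator $(y_j)\mapsto(-y_j''+q_jy_j)$ in $\bigoplus_{j=1}^gL^2(0,\ell)$ with domain all $(y_j)\in\bigoplus_{j=1}^g H^2(0,\ell)$ satisfying standard conditions at all vertices of $T$. Operator $L_\infty$. In $L^2(T_\infty)=L^2(0,\infty)\oplus\bigoplus_{j=1}^gL^2(0,\ell)$, $L_\infty(y_j)_{j=0}^g=(-y_j''+q_jy_j)_{j=0}^g$ with $q_0=0$, and domain all $(y_j)_{j=0}^g\in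 H^2(0,\infty)\oplus\bigoplus_{j=1}^gH^2(0,\ell)$ satisfying the standard conditions at all $v\ne v_0$ and, at $v_0$, $y_0(0)=y_k(0)$, $k=1,\dots,d(v_0)$, and $\sum_{k=0}^{d(v_0)}y_k'(0)=0$. Characteristic functions. Let $c_j(\sqrt\lambda,x)$, $s_j(\sqrt\lambda,x)$ solve the equation on $e_j$ with $c_j=1,c_j'=0$ and $s_j=0,s_j'=1$ at $x=0$. Writing $y_j=a_jc_j+b_js_j$, the vertex conditions on $T$ become a $2g\times2g$ linear system for $(a_1,\dots,a_g,b_1,\dots,b_g)^\top$ with matrix $\Phi_D(\lambda)$ (Dirichlet at $v_0$) or $\Phi_N(\lambda)$ (standard at $v_0$). The first $d(v_0)$ rows express $a_1=0,\dots,a_{d(v_0)}=0$ for $\Phi_D$, and $a_1-a_2=0,\dots,a_1-a_{d(v_0)}=0$, $b_1+\dots+b_{d(v_0)}=0$ for $\Phi_N$; the remaining rows, identical and in the same order for both, express the conditions $y_j(\ell)-y_k(0)=0$ and $y_j'(\ell)-\sum_ky_k'(0)=0$ at the vertices $v\neq v_0$. Set $\phi_D=\det\Phi_D$, $\phi_N=\det\Phi_N$; these are entire functions of $\lambda$. The Jost function $E$ is regarded as an entire function of the complex variable $\zeta=\sqrt\lambda$, $E(\zeta)=\phi_N(\zeta^2)+i\zeta\phi_D(\zeta^2)$, and multiplicities of its zeros are with respect to $\zeta$. *)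

(* Defs.v *)
From HB Require Import structures.
From mathcomp Require Import all_boot all_order all_algebra all_fingroup.
From mathcomp Require Import complex.
From mathcomp Require Import all_classical all_reals all_analysis.

Set Implicit Arguments.
Unset Strict Implicit.
Unset Printing Implicit Defensive.

Import Order.TTheory GRing.Theory Num.Theory numFieldNormedType.Exports.

Local Open Scope classical_set_scope.
Local Open Scope ring_scope.
Local Open Scope complex_scope.

(* A tree on g + 1 vertices with a root, whose g edges are numbered and
   directed. *)
Record rooted_tree (g : nat) : Type := RootedTree {
  vert : finType ;
  adj : rel vert ;
  root : vert ;
  src : 'I_g -> vert ;
  tgt : 'I_g -> vert ;
  card_vert : #|vert| = g.+1 ;
  adj_sym : symmetric adj ;
  adj_irrefl : irreflexive adj ;
  adj_connected : forall u v, connect adj u v ;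
  (* a cycle in the sense of [ucycle] may be [:: u; v], a single edge walked
     back and forth *)
  adj_acyclic : forall c : seq vert, ucycle adj c -> (size c <= 2)%N ;
  adj_edge : forall j, adj (src j) (tgt j) ;
  edge_unique : forall u v, adj u v ->
    exists! j, (src j, tgt j) = (u, v) \/ (src j, tgt j) = (v, u) ;
  (* directed away from the root: the root reaches the initial vertex of an
     edge without passing through its final vertex *)
  away_from_root : forall j, exists p : seq vert,
    [/\ path adj root p, last root p = src j & tgt j \notin root :: p] ;
  root_edges_first : forall j : 'I_g,
    (src j == root) = (j < #|[set v | adj root v]%SET|)%N
}.

Arguments root {g} r.
Arguments src {g r} j.
Arguments tgt {g r} j.

Definition root_degree (g : nat) (T : rooted_tree g) : nat :=
  #|[set v | @adj g T (root T) v]%SET|.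

Section Functions.
Variable R : realType.
Local Notation C := R[i].
Local Notation mu := (@lebesgue_measure R).

Definition L2 (D : set R) (f : R -> R) : Prop :=
  f \_ D \in Lfun mu 2%:E.

Definition CL2 (D : set R) (f : R -> C) : Prop :=
  L2 D (fun x => complex.Re (f x)) /\ L2 D (fun x => complex.Im (f x)).

(* Meant for an interval D with minimum 0 and f locally integrable on D. *)
Definition primitive (D : set R) (F f : R -> C) : Prop :=
  forall x, D x ->
    F x = F 0 + ((\int[mu]_(t in `[0, x]) complex.Re (f t))%R +i*
                 (\int[mu]_(t in `[0, x]) complex.Im (f t))%R).

(* y is in H^2(D), given by its continuously differentiable representative,
   dy = y' is the absolutely continuous representative of its derivative and
   ddy = y''. On D, y and dy are thus defined at every point, so that their
   values at the end points are the traces. *)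
Definition H2 (D : set R) (y dy ddy : R -> C) : Prop :=
  [/\ CL2 D y, CL2 D dy, CL2 D ddy, primitive D y dy & primitive D dy ddy].

Definition edge (l : R) : set R := `[0, l].
Definition lead : set R := `[0, +oo[.

(* - y'' + q y = lam y on the edge, y(0) = a and y'(0) = b *)
Definition initial_value_problem (l : R) (q : R -> R) (lam a b : C)
    (y dy : R -> C) : Prop :=
  [/\ y 0 = a, dy 0 = b &
    exists2 ddy, H2 (edge l) y dy ddy &
      ae_eq mu (edge l) (fun x => - ddy x + (q x)%:C * y x)
                        (fun x => lam * y x)].

(* The solution and its derivative; they are unique on the edge. *)
Definition solution (l : R) (q : R -> R) (lam a b : C) :
    (R -> C) * (R -> C) :=
  xget (fun=> 0, fun=> 0)
    [set w | initial_value_problem l q lam a b w.1 w.2].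

Definition cos_sol l q lam := (solution l q lam 1 0).1.
Definition cos_sol' l q lam := (solution l q lam 1 0).2.
Definition sin_sol l q lam := (solution l q lam 0 1).1.
Definition sin_sol' l q lam := (solution l q lam 0 1).2.

(* z0 is a zero of order m of the analytic function f (order 0: no zero) *)
Definition zero_order (f : C -> C) (z0 : C) (m : nat) : Prop :=
  exists2 h : C -> C, h z0 != 0 &
    \forall w \near (z0 : C^o),
      derivable (h : C^o -> C^o) w 1 /\ f w = (w - z0) ^+ m * h w.

(* S is finite and its points, each counted with the multiplicity given by
   the (functional) relation mult, are n in number. *)
Definition number_with_mult (S : set C) (mult : C -> nat -> Prop) (n : nat) :
    Prop :=
  exists (s : seq C) (m : C -> nat),
    [/\ uniq s, [set` s] = S, (forall z, z \in s -> mult z (m z)) &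
        n = (\sum_(z <- s) m z)%N].

Definition number_of_zeros (f : C -> C) (A : set C) (n : nat) : Prop :=
  number_with_mult [set z | A z /\ f z = 0] (zero_order f) n.

(* Functions on a family D of intervals, as elements of the direct sum of the
   L^2(D i). *)
Section Networks.
Variables (I : Type) (D : I -> set R).

Definition eqL2 (f f' : I -> R -> C) : Prop :=
  forall i, ae_eq mu (D i) (f i) (f' i).

(* The graph, as a relation between y and f = L y, of the operator
   L : (y_i) |-> (- y_i'' + q_i y_i) with domain all (y_i) in the direct sum of
   the H^2(D i) such that y and its derivative satisfy bc. *)
Definition schrodinger (q : I -> R -> R)
    (bc : (I -> R -> C) -> (I -> R -> C) -> Prop) (y f : I -> R -> C) : Prop :=
  exists dy ddy : I -> R -> C,
    [/\ forall i, H2 (D i) (y i) (dy i) (ddy i), bc y dy &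
        eqL2 f (fun i x => - ddy i x + (q i x)%:C * y i x)].

Variable L : (I -> R -> C) -> (I -> R -> C) -> Prop.

Definition eigenfunction (lam : C) (y : I -> R -> C) : Prop :=
  L y (fun i x => lam * y i x).

Definition eigenvalue_of (lam : C) : Prop :=
  exists2 y, eigenfunction lam y & ~ eqL2 y (fun _ _ => 0).

Definition lincomb (m : nat) (a : 'I_m -> C) (b : 'I_m -> I -> R -> C) :
    I -> R -> C :=
  fun i x => \sum_(k < m) a k * b k i x.

(* The kernel of L - lam has dimension m in L^2. *)
Definition eigenspace_dim (lam : C) (m : nat) : Prop :=
  exists b : 'I_m -> I -> R -> C,
    [/\ forall k, eigenfunction lam (b k),
        forall a : 'I_m -> C,
          eqL2 (lincomb a b) (fun _ _ => 0) -> forall k, a k = 0 &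
        forall y, eigenfunction lam y ->
          exists a : 'I_m -> C, eqL2 y (lincomb a b)].

Definition number_of_eigenvalues (A : set C) (n : nat) : Prop :=
  number_with_mult [set z | A z /\ eigenvalue_of z] eigenspace_dim n.

End Networks.

(* For z : C, z < 0 means that z is real and negative. *)
Definition negative_axis : set C := [set z | z < 0].
Definition positive_imaginary_axis : set C :=
  [set z | exists2 t : R, 0 < t & z = 0 +i* t].

Section Tree.
Variables (g : nat) (T : rooted_tree g) (l : R) (q : 'I_g -> R -> R).

(* Standard conditions at the vertices other than the root, one for each
   incoming edge j. At a pendant vertex there is no outgoing edge, and what is
   left is y_j'(l) = 0. *)
Definition inner_conditions (y dy : 'I_g -> R -> C) : Prop :=
  forall j : 'I_g,
    (forall k : 'I_g, @src g T k = @tgt g T j -> y j l = y k 0) /\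
    dy j l = \sum_(k < g | @src g T k == @tgt g T j) dy k 0.

Definition root_conditions (y dy : 'I_g -> R -> C) : Prop :=
  (forall j k : 'I_g, @src g T j = root T -> @src g T k = root T ->
     y j 0 = y k 0) /\
  \sum_(k < g | @src g T k == root T) dy k 0 = 0.

Definition L_N : ('I_g -> R -> C) -> ('I_g -> R -> C) -> Prop :=
  schrodinger (fun=> edge l) q
    (fun y dy => inner_conditions y dy /\ root_conditions y dy).

(* On the tree with the lead, the lead has index None. *)
Definition lead_domain (o : option 'I_g) : set R :=
  if o is Some _ then edge l else lead.

Definition lead_potential (o : option 'I_g) : R -> R :=
  if o is Some j then q j else fun=> 0.

Definition lead_root_conditions (y dy : option 'I_g -> R -> C) : Prop :=
  (forall k : 'I_g, @src g T k = root T -> y None 0 = y (Some k) 0) /\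
  dy None 0 + \sum_(k < g | @src g T k == root T) dy (Some k) 0 = 0.

Definition L_inf :
    (option 'I_g -> R -> C) -> (option 'I_g -> R -> C) -> Prop :=
  schrodinger lead_domain lead_potential
    (fun y dy => inner_conditions (fun j => y (Some j)) (fun j => dy (Some j))
                 /\ lead_root_conditions y dy).

(* The matrix of the vertex conditions in the unknowns
   (a_1, ..., a_g, b_1, ..., b_g), y_j = a_j c_j + b_j s_j. Row k < g is the
   continuity condition y_j(l) - y_k(0) = 0, j the edge entering src k; if
   src k is the root (that is, for k < d(root)) it is instead row k of the
   root conditions (rootA | rootB). Row g + i is the condition on the
   derivatives at tgt i. *)
Definition vertex_matrix (rootA rootB : 'M[C]_g) (lam : C) : 'M[C]_(g + g) :=
  block_mx
    (\matrix_(k, j) if @src g T k == root T then rootA k j else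
       (@tgt g T j == @src g T k)%:R * cos_sol l (q j) lam l - (j == k)%:R)
    (\matrix_(k, j) if @src g T k == root T then rootB k j else
       (@tgt g T j == @src g T k)%:R * sin_sol l (q j) lam l)
    (\matrix_(i, j) ((j == i)%:R * cos_sol' l (q j) lam l))
    (\matrix_(i, j) ((j == i)%:R * sin_sol' l (q j) lam l
                     - (@src g T j == @tgt g T i)%:R)).

(* Rows a_1, ..., a_d; only the first d = d(root) rows are used. *)
Definition dirichlet_rootA : 'M[C]_g := 1%:M.
Definition dirichlet_rootB : 'M[C]_g := 0.

(* Rows a_1 - a_2, ..., a_1 - a_d, b_1 + ... + b_d, in this order; indices
   below start from 0. *)
Definition standard_rootA : 'M[C]_g :=
  \matrix_(k, j) if (k.+1 < root_degree T)%N
                 then (j == 0%N :> nat)%:R - (j == k.+1 :> nat)%:R else 0.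
Definition standard_rootB : 'M[C]_g :=
  \matrix_(k, j) if (k.+1 < root_degree T)%N
                 then 0 else (j < root_degree T)%N%:R.

(* The order of the rows after the first d(root) ones is the same for both
   matrices but otherwise arbitrary: it is given by a permutation s of the
   rows above, which should fix the first d(root) ones. *)
Variable s : 'S_(g + g).

Definition Phi_D (lam : C) : 'M[C]_(g + g) :=
  row_perm s (vertex_matrix dirichlet_rootA dirichlet_rootB lam).
Definition Phi_N (lam : C) : 'M[C]_(g + g) :=
  row_perm s (vertex_matrix standard_rootA standard_rootB lam).

Definition phi_D (lam : C) : C := \det (Phi_D lam).
Definition phi_N (lam : C) : C := \det (Phi_N lam).

Definition jost (z : C) : C := phi_N (z ^+ 2) + (0 +i* 1) * z * phi_D (z ^+ 2).

End Tree.
End Functions.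

(* Main.v *)
Require Import Defs.
From HB Require Import structures.
From mathcomp Require Import all_boot all_order all_algebra all_fingroup.
From mathcomp Require Import complex.
From mathcomp Require Import all_classical all_reals all_analysis.
From mathcomp Require Import measurable_realfun zify ring lra.

(** The two root conditions are interpolated by one family. Let M(be, al, lam) be
    the vertex matrix whose last root row is
    be * (sum of the derivatives at the root) + al * (value at the root).
    With N = det M(1, 0, .) and D = det M(0, 1, .) the determinant of M(1, al, .) is
    N + al * D, because only one row depends on al. Up to one common sign phi_N is N,
    phi_D is D, and hence E(zeta) is the determinant of M(1, i * zeta, zeta ^ 2).

    _Energy_. A nonzero kernel vector of M(be, al, lam) is a nonzero solution y on
    the tree that satisfies all its vertex conditions, and Green's formula, summed over the edges,
    collapses to F - lam * n = be * al * s, where n is the squared norm of y, s the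
    squared modulus of its value at the root, and F = int |y'|^2 + q |y|^2 is bounded
    below by - c * n ([singular_energy]). With al = i * zeta and lam = zeta ^ 2, the
    imaginary part shows that a zero of E in the open upper half-plane is purely
    imaginary, and the real part that it is bounded: this is the first assertion.
    With al = - N / D, the same identity says that N / D has positive imaginary part
    in the upper half-plane ([herglotz]) and is negative far to the left ([weyl_lt0]).

    _Orders of zeros are dimensions of kernels_. The order at z0 of the determinant
    of an analytic matrix equals the corank of its value at z0 as soon as there is no
    Jordan chain of length two ([det_order_corank]). Green's formula excludes such
    chains, both for lam |-> M(be, al, lam) at real points and for the matrix of E at
    points of the positive imaginary axis ([robin_mx_det_order]). The kernels in
    turn are the eigenspaces: that of M(1, 0, lam) belongs to L_N, and that of
    M(1, - t, - t ^ 2) to L_inf, since a square-integrable solution on the lead is a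
    multiple of exp (- t x) and therefore satisfies y'(0) = - t y(0)
    ([L_N_kernel], [L_inf_kernel]).

    _Counting_. It remains to compare, at negative x, the zeros of N with those
    of N - t * D, t = sqrt (- x), each counted with the corank. Let s be one of
    the functions 0 and x |-> sqrt (max (- x) 0); both are nonincreasing. Near x the
    function N / D + al, al = - s x, is (z - x) ^ d times a function w with w x != 0,
    where d is the order of N + al * D minus that of D, and d is -1, 0 or 1 because
    changing al is a perturbation of rank one. As N / D maps the upper
    half-plane into itself, w x > 0 if d = 1 and w x < 0 if d = -1. Together with the
    monotonicity of s this shows that the indicator of N / D - s > 0 jumps by exactly d
    at x ([sign_jump]). Subtracting these identities for the two choices of s removes
    the order of D: from left to right, the difference of the two counts changes as
    the difference of the two indicators does. Far to the left all are 0, and at 0 the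
    indicators agree because the two choices of s do ([equal_total_orders]).

    The potentials being only square-integrable, the solutions on an edge are
    constructed by Picard iteration, integration by parts is derived from Fubini's
    theorem, and analyticity in lam from Taylor expansions with a uniform remainder. *)

Set Implicit Arguments.
Unset Strict Implicit.
Unset Printing Implicit Defensive.

Import Order.TTheory GRing.Theory Num.Theory numFieldNormedType.Exports.

Local Open Scope classical_set_scope.
Local Open Scope ring_scope.
Local Open Scope complex_scope.

(** * Integration by parts for primitives of integrable functions *)

(** Locked, so that unification never looks inside the Lebesgue integral. *)
HB.lock Definition rint (R : realType) (f : R -> R) (x : R) : R :=
  (\int[@lebesgue_measure R]_(t in `[0%R, x]) f t)%R.

HB.lock Definition intg (R : realType) (l : R) (f : R -> R) : Prop :=
  (@lebesgue_measure R).-integrable `[0, l] (EFin \o f).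

Section RealIntegration.
Variable R : realType.
Local Notation mu := (@lebesgue_measure R).
Implicit Types (f g F G : R -> R) (x l : R).

Lemma intgE l f : intg l f = mu.-integrable `[0, l] (EFin \o f).
Proof. by rewrite unlock. Qed.

Lemma rintE x f : rint f x = (\int[mu]_(t in `[0%R, x]) f t)%R.
Proof. by rewrite unlock. Qed.

Lemma intgP x f : intg x f <-> mu.-integrable setT (EFin \o (f \_ `[0, x])).
Proof.
rewrite -restrict_EFin intgE; split => h.
  by apply/integrable_restrict => //; rewrite setTI.
by move/integrable_restrict : h; rewrite setTI; exact.
Qed.

(** Fubini's theorem for g t * f s on the triangle 0 <= s <= t <= x. The first
    component is there because the product with a primitive is not otherwise known
    to be integrable. *)
Lemma fubini_triangle x f g : intg x f -> intg x g ->
  intg x (fun t => g t * rint f t) /\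
  rint (fun t => g t * rint f t) x =
  (\int[mu]_(s in `[0, x]) (f s * (\int[mu]_(t in `[s, x]) g t)))%R.
Proof.
move=> intf intg0.
pose fE := f \_ `[0, x]; pose gE := g \_ `[0, x].
have ifE : mu.-integrable setT (EFin \o fE) by exact/intgP.
have igE : mu.-integrable setT (EFin \o gE) by exact/intgP.
have mfE : measurable_fun setT fE by apply/measurable_EFinP; exact: measurable_int ifE.
have mgE : measurable_fun setT gE by apply/measurable_EFinP; exact: measurable_int igE.
pose T := [set p : R * R | p.2 <= p.1].
have mT : measurable T.
  rewrite (_ : T = (fun p => p.1 - p.2) @^-1` `[0, +oo[); last first.
    by apply/seteqP; split=> p /=; rewrite in_itv/= andbT subr_ge0.
  rewrite -[_ @^-1` _]setTI.
  apply: measurable_funB => //.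
have TE t s : \1_T (t, s) = (s <= t)%R%:R :> R.
  rewrite indicE; congr (nat_of_bool _)%:R; apply/idP/idP; by rewrite inE.
(* the integrand, extended by 0 to the plane *)
pose h (p : R * R) := gE p.1 * (fE p.2 * \1_T p).
have mh : measurable_fun setT h.
  apply: measurable_funM; first exact: measurableT_comp.
  apply: measurable_funM; first exact: measurableT_comp.
  exact: measurable_indic.

have if_ : forall t, mu.-integrable setT (fun s => (fE s * \1_T (t, s))%:E).
  move=> t; apply: le_integrable ifE => //.
    apply/measurable_EFinP; apply: measurable_funM => //.
    by apply: (measurableT_comp (measurable_indic mT)); exact: measurable_pair1.
  move=> s _ /=; rewrite lee_fin normrM ler_piMr// indicE.
  by case: (_ \in _); rewrite ?normr1 ?normr0.
have ig_ : forall s, mu.-integrable setT (fun t => (gE t * \1_T (t, s))%:E).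
  move=> s; apply: le_integrable igE => //.
    apply/measurable_EFinP; apply: measurable_funM => //.
    by apply: (measurableT_comp (measurable_indic mT)); exact: measurable_pair2.
  move=> t _ /=; rewrite lee_fin normrM ler_piMr// indicE.
  by case: (_ \in _); rewrite ?normr1 ?normr0.

have [c cE] : exists c : R, (\int[mu]_s `|fE s|%:E = c%:E)%E.
  exists (fine (\int[mu]_s `|fE s|%:E)%E); rewrite fineK//.
  by apply: integrable_fin_num => //; exact: integrable_norm.
have ih : (mu \x mu)%E.-integrable setT (EFin \o h).
  apply/integrable12ltyP; first exact/measurable_EFinP.
  apply: (@le_lt_trans _ _ (\int[mu]_t (c%:E * `|gE t|%:E))%E).
    apply: ge0_le_integral => //.
    - by move=> t _; exact: integral_ge0.
    - apply: (@measurable_fun_fubini_tonelli_F _ _ _ _ _ mu (fun p => (`|h p|)%:E)) => //.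
      by apply/measurable_EFinP; exact: measurableT_comp.
    - apply: measurable_funeM.
      by apply/measurable_EFinP; exact: measurableT_comp.
    - move=> t _ /=.
      rewrite -cE muleC -ge0_integralZl//; first last.
      + by apply/measurable_EFinP; exact: measurableT_comp.
      apply: ge0_le_integral => //.
      + apply/measurable_EFinP; apply: measurableT_comp => //.
        apply: (@measurable_funM _ _ _ _ (cst (gE t))) => //.
        by apply/measurable_EFinP; exact: measurable_int (if_ t).
      + apply: measurable_funeM.
        by apply/measurable_EFinP; exact: measurableT_comp.
      + move=> s _; rewrite lee_fin /h/= !normrM ler_wpM2l// ler_piMr// indicE.
        by case: (_ \in _); rewrite ?normr1 ?normr0.
  rewrite integralZl//; last exact: integrable_norm.
  have : (\int[mu]_t `|gE t|%:E \is a fin_num)%E.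
    by apply: integrable_fin_num => //; exact: integrable_norm.
  by move=> /fineK <-; rewrite -EFinM ltry.
have sub0 t : 0 <= t -> t <= x -> `[0, t] `<=` `[0, x].
  by move=> t0 tx u /=; rewrite !in_itv/= => /andP[-> /le_trans]; exact.
have key1 t : (\int[mu]_s (h (t, s))%:E = (gE t * rint f t)%:E)%E.
  under eq_integral do rewrite /h/= EFinM.
  rewrite integralZl// /gE patchE; case: ifPn => [|_]; last by rewrite !mul0r mul0e.
  rewrite inE/= in_itv/= => /andP[t0 tx]; rewrite EFinM; congr (_ * _)%E.
  rewrite rintE /Rintegral fineK; last first.
    apply: integrable_fin_num => //.
    by rewrite intgE in intf; apply: integrableS intf => //; exact: sub0.
  rewrite [RHS]integral_mkcond; apply: eq_integral => s _.
  rewrite /fE restrict_EFin/= !patchE TE !mem_setE/= !in_itv/=.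
  case: (leP 0 s) => s0 /=; last by rewrite mul0r.
  case: (leP s t) => st; rewrite ?mulr0 ?mulr1//.
  by rewrite (le_trans st tx).
have key2 s : (\int[mu]_t (h (t, s))%:E = (fE s * \int[mu]_(t in `[s, x]) g t)%:E)%E.
  under eq_integral do rewrite /h/= mulrCA EFinM.
  rewrite integralZl// /fE patchE; case: ifPn => [|_]; last by rewrite !mul0r mul0e.
  rewrite inE/= in_itv/= => /andP[s0 sx]; rewrite EFinM; congr (_ * _)%E.
  rewrite /Rintegral fineK; last first.
    apply: integrable_fin_num => //.
    rewrite intgE in intg0; apply: integrableS intg0 => // u /=; rewrite !in_itv/= => /andP[su ->].
    by rewrite (le_trans s0).
  rewrite [RHS]integral_mkcond; apply: eq_integral => t _.
  rewrite /gE restrict_EFin/= !patchE TE !mem_setE/= !in_itv/=.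
  case: (leP s t) => st /=; last by rewrite mulr0.
  by rewrite (le_trans s0 st) mulr1.
have F := Fubini ih.
split.
  apply/intgP.
  rewrite [X in mu.-integrable _ X](_ : _ = fubini_F mu (EFin \o h)).
    exact: integrable_fubini_F ih.
  apply/funext => t; rewrite /fubini_F/= [RHS]key1 /gE !patchE.
  by case: ifP; rewrite ?mul0r.
rewrite rintE /Rintegral; congr fine.
transitivity (\int[mu]_t \int[mu]_s (h (t, s))%:E)%E.
  rewrite integral_mkcond; apply: eq_integral => t _.
  by rewrite key1 /gE restrict_EFin/= !patchE; case: ifP; rewrite ?mul0r.
transitivity (\int[mu]_s \int[mu]_t (h (t, s))%:E)%E; first exact: F.
rewrite [RHS]integral_mkcond; apply: eq_integral => t _.
by rewrite key2 /fE restrict_EFin/= !patchE; case: ifP; rewrite ?mul0r.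
Qed.

Lemma sub_cc0 (x l : R) : x <= l -> `[0, x] `<=` `[0, l].
Proof.
by move=> xl t /=; rewrite !in_itv/= => /andP[-> /le_trans]; exact.
Qed.

Lemma intg_sub x l f : x <= l -> intg l f -> intg x f.
Proof. by rewrite !intgE => xl; apply: integrableS => //; exact: sub_cc0. Qed.

Lemma eq_intg l f g : (forall t, 0 <= t <= l -> f t = g t) ->
  intg l f -> intg l g.
Proof.
rewrite !intgE => fg; apply: eq_integrable => // t; rewrite inE/= in_itv/= => tl.
by rewrite fg.
Qed.

Lemma intgD l f g : intg l f -> intg l g -> intg l (fun t => f t + g t).
Proof. by rewrite !intgE => fi gi; apply: (integrableD _ fi gi). Qed.

Lemma intgZ l c f : intg l f -> intg l (fun t => c * f t).
Proof. by rewrite !intgE => fi; apply: (integrableZl _ c fi). Qed.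

Lemma intgN l f : intg l f -> intg l (fun t => - f t).
Proof.
by move=> fi; apply: eq_intg (intgZ (-1) fi) => t _; rewrite mulN1r.
Qed.

Lemma intgB l f g : intg l f -> intg l g -> intg l (fun t => f t - g t).
Proof. by move=> fi /intgN; exact: intgD. Qed.

Lemma intg_norm l f : intg l f -> intg l (fun t => `|f t|).
Proof. by rewrite !intgE => fi; exact: (integrable_norm fi). Qed.

Lemma within_intg l f : {within `[0, l], continuous f} -> intg l f.
Proof.
rewrite !intgE => cf; apply: continuous_compact_integrable => //.
exact: segment_compact.
Qed.

Lemma intg_cst l c : intg l (fun=> c).
Proof. by apply: within_intg => t; exact: cst_continuous. Qed.

Lemma within_bounded l f : {within `[0, l], continuous f} ->
  exists2 M, 0 <= M & forall x, 0 <= x <= l -> `|f x| <= M.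
Proof.
move=> cf; have := continuous_compact cf (@segment_compact _ 0 l).
move=> /compact_bounded[N [_ N1x]]; exists (`|N| + 1) => [|x xl]; first by rewrite addr_ge0.
apply: (N1x (`|N| + 1)); first by rewrite (le_lt_trans (ler_norm N))// ltrDl.
by exists x => //=; rewrite in_itv.
Qed.

Lemma within_measurable l f : {within `[0, l], continuous f} ->
  measurable_fun `[0, l] f.
Proof. exact: subspace_continuous_measurable_fun. Qed.

Lemma intgM l f g M : measurable_fun `[0, l] f ->
  (forall x, 0 <= x <= l -> `|f x| <= M) -> intg l g -> intg l (fun t => f t * g t).
Proof.
rewrite !intgE => mf fM gi.
have H : mu.-integrable `[0, l] ((EFin \o f) \* (EFin \o g))%E.
  apply: integrableMr => //.
  exists M; split; first exact: num_real.
  by move=> N MN x /=; rewrite in_itv/= => /fM /le_trans; apply; exact: ltW.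
by apply: eq_integrable H.
Qed.

Lemma within_intgM l f g : {within `[0, l], continuous f} -> intg l g ->
  intg l (fun t => f t * g t).
Proof.
move=> cf; have [M _ fM] := within_bounded cf.
by apply: intgM fM; exact: within_measurable.
Qed.

Lemma eq_rint x f g : (forall t, 0 <= t <= x -> f t = g t) -> rint f x = rint g x.
Proof.
by rewrite !rintE => fg; apply: eq_Rintegral => t; rewrite inE/= in_itv/= => /fg.
Qed.

Lemma rint0 f : rint f 0 = 0.
Proof. by rewrite rintE set_itv1 Rintegral_set1. Qed.

Lemma rintD x f g : intg x f -> intg x g ->
  rint (fun t => f t + g t) x = rint f x + rint g x.
Proof. by rewrite !intgE !rintE => fi gi; rewrite RintegralD. Qed.

Lemma rintZ x c f : intg x f -> rint (fun t => c * f t) x = c * rint f x.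
Proof. by rewrite !intgE !rintE => fi; rewrite RintegralZl. Qed.

Lemma rintN x f : intg x f -> rint (fun t => - f t) x = - rint f x.
Proof.
move=> fi; rewrite -mulN1r -rintZ//; apply: eq_rint => t _; by rewrite mulN1r.
Qed.

Lemma rintB x f g : intg x f -> intg x g ->
  rint (fun t => f t - g t) x = rint f x - rint g x.
Proof. by rewrite !intgE !rintE => fi gi; rewrite RintegralB. Qed.

Lemma rint_cst x c : 0 <= x -> rint (fun=> c) x = c * x.
Proof.
move=> x0; rewrite rintE Rintegral_cst//= lebesgue_measure_itv/= lte_fin.
case: ltrP => [|x0'] /=; first by rewrite oppr0 addr0.
by rewrite (le_anti (introT andP (conj x0' x0))).
Qed.

Lemma le_rint x f g : intg x f -> intg x g ->
  (forall t, 0 <= t <= x -> f t <= g t) -> rint f x <= rint g x.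
Proof.
rewrite !intgE !rintE => fi gi fg.
by apply: le_Rintegral => // t /=; rewrite in_itv/=; exact: fg.
Qed.

Lemma rint_ge0 x f : (forall t, 0 <= t <= x -> 0 <= f t) -> 0 <= rint f x.
Proof. by rewrite rintE => f0; apply: Rintegral_ge0 => t /=; rewrite in_itv/=; exact: f0. Qed.

Lemma rint_norm x f : intg x f -> `|rint f x| <= rint (fun t => `|f t|) x.
Proof. by rewrite intgE !rintE => fi; apply: le_normr_Rintegral. Qed.

Lemma rint_ae x f g : measurable_fun `[0, x] f -> measurable_fun `[0, x] g ->
  ae_eq mu `[0, x]%classic f g -> rint f x = rint g x.
Proof.
move=> mf mg fg; rewrite !rintE /Rintegral; congr fine.
apply: ae_eq_integral => //; try exact/measurable_EFinP.
by apply: filterS fg => t /= h /h ->.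
Qed.

Lemma intg_measurable l f : intg l f -> measurable_fun `[0, l] f.
Proof. by rewrite intgE => /measurable_int/measurable_EFinP. Qed.

Lemma rint_tail x s f : 0 <= s <= x -> intg x f ->
  (\int[mu]_(t in `[s, x]) f t)%R = rint f x - rint f s.
Proof.
rewrite intgE => /andP[s0 sx] fi; rewrite !rintE (Rintegral_itvB fi) ?bnd_simp//.
rewrite Rintegral_itv_obnd_cbnd//; apply: integrableS fi => // t /=.
by rewrite !in_itv/= => /andP[st ->]; rewrite (le_trans s0 (ltW st)).
Qed.

Lemma rint_mono x y f : 0 <= x <= y -> intg y f ->
  (forall t, 0 <= t <= y -> 0 <= f t) -> rint f x <= rint f y.
Proof.
move=> /andP[x0 xy] fi f0; rewrite -subr_ge0 -rint_tail ?x0//.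
apply: Rintegral_ge0 => t /=; rewrite in_itv/= => /andP[xt ty]; apply: f0.
by rewrite ty (le_trans x0 xt).
Qed.

Lemma rint_continuous l f : 0 <= l -> intg l f ->
  {within `[0, l], continuous (rint f)}.
Proof.
rewrite intgE => l0 fi; rewrite (_ : rint f = fun x => \int[mu]_(t in `[0%R, x]) f t).
  exact: parameterized_integral_continuous.
by apply/funext => x; rewrite rintE.
Qed.

(** The square [0, x]^2 is the union of the triangles s <= t and t <= s. *)
Lemma rint_parts x f g : 0 <= x -> intg x f -> intg x g ->
  rint (fun t => f t * rint g t) x + rint (fun t => g t * rint f t) x =
  rint f x * rint g x.
Proof.
move=> x0 fi gi; have [ifg _] := fubini_triangle gi fi.
have [igf ->] := fubini_triangle fi gi.
rewrite [X in _ + X](_ : _ = rint (fun t => rint g x * f t - f t * rint g t) x).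
  by rewrite rintB ?rintZ//; [ring|exact: intgZ].
rewrite rintE; apply: eq_Rintegral => s; rewrite inE/= in_itv/= => sx.
by rewrite rint_tail//; ring.
Qed.

(** F is absolutely continuous on [0, l] with derivative f. *)
Definition rAC l F f := intg l f /\ forall x, 0 <= x <= l -> F x = F 0 + rint f x.

Lemma rAC_continuous l F f : 0 <= l -> rAC l F f -> {within `[0, l], continuous F}.
Proof.
move=> l0 [fi Ff].
apply: (@subspace_eq_continuous _ _ _ (fun x => F 0 + rint f x)).
  by move=> x; rewrite /from_subspace/= inE/= in_itv/= => /Ff.
by move=> x; apply: continuousD; [exact: cst_continuous|exact: rint_continuous].
Qed.

Lemma rACM l F f G g : 0 <= l -> rAC l F f -> rAC l G g ->
  rAC l (fun x => F x * G x) (fun x => f x * G x + F x * g x).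
Proof.
move=> l0 Ff Gg.
have cF := rAC_continuous l0 Ff; have cG := rAC_continuous l0 Gg.
move: Ff Gg => [fi Ff] [gi Gg].
have iFg := within_intgM cF gi.
have ifG : intg l (fun t => f t * G t).
  by apply: eq_intg (within_intgM cG fi) => t _; rewrite mulrC.
split; first exact: intgD.
move=> x /andP[x0 xl].
have fx := intg_sub xl fi; have gx := intg_sub xl gi.
rewrite rintD//; [|exact: intg_sub ifG|exact: intg_sub iFg].
rewrite (@eq_rint _ _ (fun t => G 0 * f t + f t * rint g t)); last first.
  by move=> t /andP[t0 tx]; rewrite Gg ?t0 ?(le_trans tx)//; ring.
rewrite (@eq_rint _ (fun t => F t * g t) (fun t => F 0 * g t + g t * rint f t)); last first.
  by move=> t /andP[t0 tx]; rewrite Ff ?t0 ?(le_trans tx)//; ring.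
have [h1 _] := fubini_triangle gx fx; have [h2 _] := fubini_triangle fx gx.
rewrite !rintD ?rintZ//; try exact: intgZ.
have := rint_parts x0 fx gx => E.
rewrite Ff ?x0// Gg ?x0//; lra.
Qed.

Lemma rACD l F f G g : rAC l F f -> rAC l G g ->
  rAC l (fun x => F x + G x) (fun x => f x + g x).
Proof.
move=> [fi Ff] [gi Gg]; split; first exact: intgD.
move=> x /andP[x0 xl]; rewrite rintD//; first by rewrite (Ff x) ?(Gg x) ?x0//; ring.
- exact: intg_sub fi.
- exact: intg_sub gi.
Qed.

Lemma rACZ l c F f : rAC l F f -> rAC l (fun x => c * F x) (fun x => c * f x).
Proof.
move=> [fi Ff]; split; first exact: intgZ.
move=> x /andP[x0 xl]; rewrite rintZ//; first by rewrite (Ff x) ?x0//; ring.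
exact: intg_sub fi.
Qed.

Lemma rACN l F f : rAC l F f -> rAC l (fun x => - F x) (fun x => - f x).
Proof.
move=> [fi Ff]; split; first exact: intgN.
move=> x /andP[x0 xl]; rewrite rintN//; first by rewrite (Ff x) ?x0//; ring.
exact: intg_sub fi.
Qed.

Lemma rAC_cst l c : rAC l (fun=> c) (fun=> 0).
Proof.
split; first exact: intg_cst.
by move=> x /andP[x0 _]; rewrite rint_cst// mul0r addr0.
Qed.

Lemma eq_rAC l F f G g : (forall x, 0 <= x <= l -> F x = G x) ->
  (forall x, 0 <= x <= l -> f x = g x) -> rAC l F f -> rAC l G g.
Proof.
move=> FG fg [fi Ff]; split; first exact: eq_intg fi.
move=> x /andP[x0 xl]; rewrite -!FG ?lexx ?x0 ?(le_trans x0)//= Ff ?x0//.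
congr (_ + _); apply: eq_rint => t /andP[t0 tx]; apply: fg.
by rewrite t0 (le_trans tx).
Qed.

Lemma rAC_rint l f : intg l f -> rAC l (rint f) f.
Proof. by move=> fi; split => // x _; rewrite rint0 add0r. Qed.

Lemma rAC_ftc l F f : 0 <= l -> rAC l F f -> rint f l = F l - F 0.
Proof. by move=> l0 [_ /(_ l)]; rewrite l0 lexx => /(_ isT) ->; ring. Qed.
End RealIntegration.

(** * Complex-valued primitives *)
Section ComplexIntegration.
Variable R : realType.
Local Notation C := R[i].
Local Notation mu := (@lebesgue_measure R).
Local Notation Re := complex.Re.
Local Notation Im := complex.Im.
Implicit Types (f g F G p y dy : R -> C) (x l : R) (z w : C).

Lemma ReD z w : Re (z + w) = Re z + Re w. Proof. by case: z w => [a b] []. Qed.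
Lemma ImD z w : Im (z + w) = Im z + Im w. Proof. by case: z w => [a b] []. Qed.
Lemma ReN z : Re (- z) = - Re z. Proof. by case: z. Qed.
Lemma ImN z : Im (- z) = - Im z. Proof. by case: z. Qed.
Lemma ReM z w : Re (z * w) = Re z * Re w - Im z * Im w.
Proof. by case: z w => [a b] []. Qed.
Lemma ImM z w : Im (z * w) = Re z * Im w + Im z * Re w.
Proof. by case: z w => [a b] []. Qed.
Lemma complexP z w : Re z = Re w -> Im z = Im w -> z = w.
Proof. by case: z w => [a b] [c d] /= -> ->. Qed.
Lemma Re_conj z : Re z^* = Re z. Proof. by case: z. Qed.
Lemma Im_conj z : Im z^* = - Im z. Proof. by case: z. Qed.
(** Separates the real and the imaginary part of an algebraic expression. *)
Definition RI := (ReD, ImD, ReN, ImN, ReM, ImM, Re_conj, Im_conj).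

Lemma Re_sum n (F : 'I_n -> C) : Re (\sum_i F i) = \sum_i Re (F i).
Proof. by apply: (big_morph _ ReD). Qed.

Lemma Im_sum n (F : 'I_n -> C) : Im (\sum_i F i) = \sum_i Im (F i).
Proof. by apply: (big_morph _ ImD). Qed.

(** A norm with values in R, whereas `|z| is a complex number. *)
Definition n1 z : R := `|Re z| + `|Im z|.

Lemma n1_ge0 z : 0 <= n1 z. Proof. by rewrite addr_ge0. Qed.

Lemma n1D z w : n1 (z + w) <= n1 z + n1 w.
Proof.
rewrite /n1 !RI.
have := ler_normD (Re z) (Re w); have := ler_normD (Im z) (Im w); lra.
Qed.

Lemma n1N z : n1 (- z) = n1 z. Proof. by rewrite /n1 !RI !normrN. Qed.

Lemma n1B z w : n1 (z - w) <= n1 z + n1 w.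
Proof. by rewrite -(n1N w) n1D. Qed.

Lemma n1M z w : n1 (z * w) <= n1 z * n1 w.
Proof.
rewrite /n1 !RI.
have := ler_normB (Re z * Re w) (Im z * Im w).
have := ler_normD (Re z * Im w) (Im z * Re w).
rewrite !normrM; lra.
Qed.

Lemma n1_0 : n1 0 = 0. Proof. by rewrite /n1 /= normr0 addr0. Qed.

Lemma n1_le0 z : n1 z <= 0 -> z = 0.
Proof.
rewrite /n1 => h; have := normr_ge0 (Re z); have := normr_ge0 (Im z) => h1 h2.
have /eqP : `|Re z| = 0 by lra.
have /eqP : `|Im z| = 0 by lra.
by rewrite !normr_eq0 => /eqP i0 /eqP r0; apply: complexP.
Qed.

Definition cI f x : C := rint (fun t => Re (f t)) x +i* rint (fun t => Im (f t)) x.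
Definition cintg l f := intg l (fun t => Re (f t)) /\ intg l (fun t => Im (f t)).
Definition cAC l F f := rAC l (fun t => Re (F t)) (fun t => Re (f t)) /\
  rAC l (fun t => Im (F t)) (fun t => Im (f t)).
Definition ccont l F := {within `[0, l], continuous (fun t => Re (F t))} /\
  {within `[0, l], continuous (fun t => Im (F t))}.

Lemma cAC_eq l F f x : cAC l F f -> 0 <= x <= l -> F x = F 0 + cI f x.
Proof. by move=> [[_ h] [_ k]] xl; apply: complexP; rewrite !RI (h, k). Qed.

Lemma cAC_intro l F f c : cintg l f ->
  (forall x, 0 <= x <= l -> F x = c + cI f x) -> cAC l F f.
Proof.
move=> [h k] FE; split; split => // x xl; rewrite !FE ?RI/= ?rint0 ?addr0//;
 by case/andP: xl => x0 xl; rewrite ?lexx ?(le_trans x0 xl).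
Qed.

Lemma cAC_cont l F f : 0 <= l -> cAC l F f -> ccont l F.
Proof. by move=> l0 [h k]; split; [exact: rAC_continuous h|exact: rAC_continuous k]. Qed.

Lemma cACD l F f G g : cAC l F f -> cAC l G g ->
  cAC l (fun x => F x + G x) (fun x => f x + g x).
Proof.
move=> [h k] [h' k']; split.
  by apply: eq_rAC (rACD h h') => x _; rewrite !RI.
by apply: eq_rAC (rACD k k') => x _; rewrite !RI.
Qed.

Lemma cACN l F f : cAC l F f -> cAC l (fun x => - F x) (fun x => - f x).
Proof.
move=> [h k]; split.
  by apply: eq_rAC (rACN h) => x _; rewrite !RI.
by apply: eq_rAC (rACN k) => x _; rewrite !RI.
Qed.

Lemma cACB l F f G g : cAC l F f -> cAC l G g ->
  cAC l (fun x => F x - G x) (fun x => f x - g x).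
Proof. by move=> h /cACN; exact: cACD. Qed.

Lemma cACJ l F f : cAC l F f -> cAC l (fun x => (F x)^*) (fun x => (f x)^*).
Proof.
move=> [h k]; split; first by apply: eq_rAC h => x _; rewrite !RI.
by apply: eq_rAC (rACN k) => x _; rewrite !RI.
Qed.

Lemma cAC_cst l c : cAC l (fun=> c) (fun=> 0).
Proof. by split; exact: rAC_cst. Qed.

Lemma eq_cAC l F f G g : (forall x, 0 <= x <= l -> F x = G x) ->
  (forall x, 0 <= x <= l -> f x = g x) -> cAC l F f -> cAC l G g.
Proof.
by move=> FG fg [h k]; split; [apply: eq_rAC h|apply: eq_rAC k] => x xl; rewrite ?FG ?fg.
Qed.

Lemma cACM l F f G g : 0 <= l -> cAC l F f -> cAC l G g ->
  cAC l (fun x => F x * G x) (fun x => f x * G x + F x * g x).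
Proof.
move=> l0 [h k] [h' k']; split.
  apply: eq_rAC (rACD (rACM l0 h h') (rACN (rACM l0 k k'))) => x _; rewrite !RI//.
  by ring.
apply: eq_rAC (rACD (rACM l0 h k') (rACM l0 k h')) => x _; rewrite !RI//.
by ring.
Qed.

Lemma cACZ l c F f : 0 <= l -> cAC l F f -> cAC l (fun x => c * F x) (fun x => c * f x).
Proof.
move=> l0 h; apply: eq_cAC (cACM l0 (cAC_cst l c) h) => x _ //.
by rewrite mul0r add0r.
Qed.

Lemma cAC_ftc l F f : 0 <= l -> cAC l F f -> cI f l = F l - F 0.
Proof. by move=> l0 /cAC_eq -> //; rewrite ?lexx ?l0//; ring. Qed.

Lemma cAC_cI l f : cintg l f -> cAC l (cI f) f.
Proof. by move=> [h k]; split; exact: rAC_rint. Qed.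

Lemma cI0 f : cI f 0 = 0. Proof. by rewrite /cI !rint0. Qed.

Lemma eq_cI x f g : (forall t, 0 <= t <= x -> f t = g t) -> cI f x = cI g x.
Proof.
by move=> fg; congr (_ +i* _); apply: eq_rint => t tx; rewrite fg.
Qed.

Lemma cI_B x f g : cintg x f -> cintg x g ->
  cI (fun t => f t - g t) x = cI f x - cI g x.
Proof.
move=> [h k] [h' k']; apply: complexP; rewrite !RI/=.
  by rewrite -rintB//; apply: eq_rint => t _; rewrite !RI.
by rewrite -rintB//; apply: eq_rint => t _; rewrite !RI.
Qed.

Lemma cI_D x f g : cintg x f -> cintg x g ->
  cI (fun t => f t + g t) x = cI f x + cI g x.
Proof.
move=> [h k] [h' k']; apply: complexP; rewrite !RI/=.
  by rewrite -rintD//; apply: eq_rint => t _; rewrite !RI.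
by rewrite -rintD//; apply: eq_rint => t _; rewrite !RI.
Qed.

Lemma cI_const0 x : 0 <= x -> cI (fun=> 0) x = 0.
Proof. by move=> x0; apply: complexP; rewrite /= rint_cst// mul0r. Qed.

Lemma eq_cintg l f g : (forall x, 0 <= x <= l -> f x = g x) -> cintg l f -> cintg l g.
Proof.
by move=> fg [h k]; split; [apply: eq_intg h|apply: eq_intg k] => x xl; rewrite fg.
Qed.

Lemma cintg_sub x l f : x <= l -> cintg l f -> cintg x f.
Proof. by move=> xl [h k]; split; exact: intg_sub xl _. Qed.

Lemma cintgD l f g : cintg l f -> cintg l g -> cintg l (fun x => f x + g x).
Proof.
move=> [h k] [h' k']; split.
  by apply: eq_intg (intgD h h') => x _; rewrite !RI.
by apply: eq_intg (intgD k k') => x _; rewrite !RI.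
Qed.

Lemma cintgN l f : cintg l f -> cintg l (fun x => - f x).
Proof.
move=> [h k]; split.
  by apply: eq_intg (intgN h) => x _; rewrite !RI.
by apply: eq_intg (intgN k) => x _; rewrite !RI.
Qed.

Lemma cintgB l f g : cintg l f -> cintg l g -> cintg l (fun x => f x - g x).
Proof. by move=> h /cintgN; exact: cintgD. Qed.

Lemma cintg_cst l c : cintg l (fun=> c).
Proof. by split; exact: intg_cst. Qed.

Lemma cintg_sum l n (F : 'I_n -> R -> C) : (forall i, cintg l (F i)) ->
  cintg l (fun x => \sum_i F i x).
Proof.
elim: n F => [|n IH] F h.
  by apply: eq_cintg (cintg_cst l 0) => x _; rewrite big_ord0.
apply: eq_cintg (cintgD (IH (fun i => F (widen_ord (leqnSn n) i)) _) (h ord_max))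
  => [x _|//]; by rewrite big_ord_recr.
Qed.

Lemma cI_sum l n (F : 'I_n -> R -> C) : 0 <= l -> (forall i, cintg l (F i)) ->
  cI (fun x => \sum_i F i x) l = \sum_i cI (F i) l.
Proof.
move=> l0; elim: n F => [|n IH] F h.
  transitivity (cI (fun=> 0 : C) l); last by rewrite big_ord0 cI_const0.
  by apply: eq_cI => x _; rewrite big_ord0.
rewrite big_ord_recr/= -IH// -cI_D//; last exact: cintg_sum.
by apply: eq_cI => x _; rewrite big_ord_recr.
Qed.

Lemma intg_n1 l f : cintg l f -> intg l (fun x => n1 (f x)).
Proof. by move=> [h k]; apply: intgD; exact: intg_norm. Qed.

Lemma n1_cI x f : cintg x f -> n1 (cI f x) <= rint (fun t => n1 (f t)) x.
Proof.
move=> [h k]; rewrite /n1 /cI/= rintD; [|exact: intg_norm|exact: intg_norm].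
by apply: lerD; exact: rint_norm.
Qed.

Lemma n1_cI_le x f (h : R -> R) : cintg x f -> intg x h ->
  (forall t, 0 <= t <= x -> n1 (f t) <= h t) -> n1 (cI f x) <= rint h x.
Proof.
move=> fi hi fh; apply: le_trans (n1_cI fi) _; apply: le_rint => //.
exact: intg_n1.
Qed.

Lemma ccont_cI l f : 0 <= l -> cintg l f -> ccont l (cI f).
Proof. by move=> l0 fi; apply: cAC_cont (cAC_cI fi). Qed.

(** Pointwise limits of continuous functions are only known to be measurable; this
    is the class in which the limits of Picard's iteration live until the integral
    equation makes them continuous. *)
Definition mbounded l F := [/\ measurable_fun `[0, l] (fun t => Re (F t)),
  measurable_fun `[0, l] (fun t => Im (F t)) &
  exists2 M, 0 <= M & forall x, 0 <= x <= l -> n1 (F x) <= M].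

Lemma ccont_mbounded l F : ccont l F -> mbounded l F.
Proof.
move=> [h k]; split; [exact: within_measurable|exact: within_measurable|].
have [M M0 hM] := within_bounded h; have [N N0 kN] := within_bounded k.
by exists (M + N) => [|x xl]; rewrite ?addr_ge0// lerD ?hM ?kN.
Qed.

Lemma mbounded_intgM l F f : mbounded l F -> cintg l f ->
  cintg l (fun x => f x * F x).
Proof.
move=> [mh mk [M M0 FM]] [h k].
have RM x : 0 <= x <= l -> `|Re (F x)| <= M.
  by move=> xl; apply: le_trans (FM _ xl); rewrite lerDl.
have IM x : 0 <= x <= l -> `|Im (F x)| <= M.
  by move=> xl; apply: le_trans (FM _ xl); rewrite lerDr.
split.
  apply: eq_intg (intgB (intgM mh RM h) (intgM mk IM k)) => x _.
  by rewrite !RI; ring.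
apply: eq_intg (intgD (intgM mk IM h) (intgM mh RM k)) => x _.
by rewrite !RI; ring.
Qed.

Lemma mbounded_intg l F : mbounded l F -> cintg l F.
Proof.
move=> FM; apply: eq_cintg (mbounded_intgM FM (cintg_cst l 1)) => x _.
by rewrite mul1r.
Qed.

Lemma ccont_intg l F : ccont l F -> cintg l F.
Proof. by move=> h; exact/mbounded_intg/ccont_mbounded. Qed.

Lemma ccont_intgM l F f : ccont l F -> cintg l f -> cintg l (fun x => f x * F x).
Proof. by move=> /ccont_mbounded; exact: mbounded_intgM. Qed.

Lemma ccontD l F G : ccont l F -> ccont l G -> ccont l (fun x => F x + G x).
Proof.
move=> [h k] [h' k']; split.
  apply: (@subspace_eq_continuous _ _ _ (fun x => Re (F x) + Re (G x))).
    by move=> x _; rewrite /from_subspace/= RI.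
  by move=> x; apply: continuousD; [exact: h|exact: h'].
apply: (@subspace_eq_continuous _ _ _ (fun x => Im (F x) + Im (G x))).
  by move=> x _; rewrite /from_subspace/= RI.
by move=> x; apply: continuousD; [exact: k|exact: k'].
Qed.

Lemma ccont_cst l c : ccont l (fun=> c).
Proof. by split => x; exact: cst_continuous. Qed.

Lemma eq_ccont l F G : (forall x, 0 <= x <= l -> F x = G x) -> ccont l F -> ccont l G.
Proof.
move=> FG [h k]; split.
  apply: (@subspace_eq_continuous _ _ _ (fun x => Re (F x))) => // x.
  by rewrite /from_subspace/= inE/= in_itv/= => /FG ->.
apply: (@subspace_eq_continuous _ _ _ (fun x => Im (F x))) => // x.
by rewrite /from_subspace/= inE/= in_itv/= => /FG ->.
Qed.

Lemma ccont_sum l n (F : 'I_n -> R -> C) : (forall i, ccont l (F i)) ->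
  ccont l (fun x => \sum_i F i x).
Proof.
elim: n F => [|n IH] F h.
  by apply: eq_ccont (ccont_cst l 0) => x _; rewrite big_ord0.
apply: eq_ccont (ccontD (IH (fun i => F (widen_ord (leqnSn n) i)) _) (h ord_max))
  => [x _|//]; by rewrite big_ord_recr.
Qed.

End ComplexIntegration.

(** * Linear Volterra systems *)
Section Volterra.
Variable R : realType.
Local Notation C := R[i].
Local Notation Re := complex.Re.
Local Notation Im := complex.Im.

(** The factorial in the convergence of Picard's iteration: if rho is integrable
    then (int rho) ^ n / n! has derivative rho * (int rho) ^ n.-1 / n.-1!. *)
Lemma rint_pow (l : R) (rho : R -> R) n : 0 <= l -> intg l rho ->
  rAC l (fun x => rint rho x ^+ n.+1 / n.+1`!%:R)
        (fun x => rho x * (rint rho x ^+ n / n`!%:R)).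
Proof.
move=> l0 ri; elim: n => [|n IH].
  by apply: eq_rAC (rAC_rint ri) => x _; rewrite ?fact0 ?expr1 ?expr0 ?divr1 ?mulr1.
have h : rAC l (fun x => rint rho x ^+ n.+1) (fun x => n.+1%:R * (rho x * rint rho x ^+ n)).
  apply: eq_rAC (rACZ n.+1`!%:R IH) => x _.
    by rewrite mulrC divfK// pnatr_eq0 -lt0n fact_gt0.
  have e0 : (n`!%:R : R) != 0 by rewrite pnatr_eq0 -lt0n fact_gt0.
  by rewrite factS natrM; field.
have := rACZ (n.+2`!%:R^-1) (rACM l0 (rAC_rint ri) h).
apply: eq_rAC => x _; first by rewrite [RHS]mulrC -exprS.
rewrite factS natrM.
have e1 : (n.+1`!%:R : R) != 0 by rewrite pnatr_eq0 -lt0n fact_gt0.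
have e2 : (n.+2%:R : R) != 0 by rewrite pnatr_eq0.
rewrite !exprS; rewrite -[n.+2]addn1 natrD in e2 *.
move: e1 e2; set F : R := (n.+1)`!%:R; set a : R := n.+1%:R => e1 e2.
rewrite (_ : _ + _ = (a + 1) * (rho x * (rint rho x * rint rho x ^+ n))); last by ring.
by rewrite invfM mulrACA mulVf// mul1r; ring.
Qed.

Lemma exp_series_le (M : R) n : 0 <= M -> series (exp_coeff M) n <= expR M.
Proof.
move=> M0; apply: nondecreasing_cvgn_le; last exact: is_cvg_series_exp_coeff.
apply/nondecreasing_seqP => k; rewrite /series/= big_nat_recr//= lerDl.
exact: exp_coeff_ge0.
Qed.

Lemma exp_tail_cvg (M : R) : expR M - series (exp_coeff M) n @[n --> \oo] --> (0 : R).
Proof.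
rewrite -[X in _ --> X](subrr (expR M)); apply: cvgB; first exact: cvg_cst.
exact: is_cvg_series_exp_coeff.
Qed.

(** Every estimate on the limit of Picard's iteration has, for all n, a bound of this
    form, by a tail of the exponential series. *)
Lemma exp_tail_le0 (M a c : R) :
  (forall n, a <= c * (expR M - series (exp_coeff M) n)) -> a <= 0.
Proof.
move=> h; have : c * (expR M - series (exp_coeff M) n) @[n --> \oo] --> (c * 0 : R).
  by apply: cvgM; [exact: cvg_cst|exact: exp_tail_cvg].
by rewrite mulr0 => /cvgr_to_ge; apply; near=> n; exact: h.
Unshelve. all: by end_near. Qed.

Lemma exp_tail_anti (M : R) n : 0 <= M ->
  expR M - series (exp_coeff M) n.+1 <= expR M - series (exp_coeff M) n.
Proof.
by move=> M0; rewrite lerD2l lerN2 /series/= big_nat_recr//= lerDl exp_coeff_ge0.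
Qed.

(** The tail bound is uniform in x, so that limits may be taken under integrals
    without appeal to a convergence theorem. *)
Lemma dominated_series (l K M : R) (f : nat -> R -> R) : 0 <= K -> 0 <= M ->
  (forall n x, 0 <= x <= l -> `|f n x| <= K * exp_coeff M n) ->
  exists F : R -> R, forall x, 0 <= x <= l -> forall n,
    `|F x - \sum_(k < n) f k x| <= K * (expR M - series (exp_coeff M) n).
Proof.
move=> K0 M0 fK; exists (fun x => limn (series (f ^~ x))) => x xl n.
have cf : cvgn (series (f ^~ x)).
  apply: normed_cvg; apply: (@series_le_cvg _ _ (K *: exp_coeff M)).
  - by move=> k /=.
  - by move=> k; rewrite /GRing.scale/= mulr_ge0// exp_coeff_ge0.
  - by move=> k; rewrite fK.
  - exact/is_cvg_seriesZ/is_cvg_series_exp_coeff.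
rewrite -[\sum_(k < n) _](big_mkord xpredT (fun k => f k x)) distrC.
have h : `|\sum_(0 <= k < n) f k x - series (f ^~ x) m| @[m --> \oo] -->
    `|\sum_(0 <= k < n) f k x - limn (series (f ^~ x))|.
  by apply: cvg_norm; apply: cvgB; [exact: cvg_cst|].
move/cvgr_to_le : h; apply; near=> m.
have nm : (n <= m)%N by near: m; exists n.
rewrite /series/= (@big_cat_nat _ _ _ n 0 m)//= opprD addrA subrr add0r normrN.
apply: (@le_trans _ _ (\sum_(n <= k < m) K * exp_coeff M k)).
  apply: le_trans (ler_norm_sum _ _ _) _; apply: ler_sum => k _; exact: fK.
rewrite -mulr_sumr ler_wpM2l// lerBrDr addrC.
rewrite -(@big_cat_nat _ _ _ n 0 m)//=; exact: exp_series_le.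
Unshelve. all: by end_near. Qed.

Implicit Types (p u v y dy z dz f : R -> C).

Lemma picard_step (l : R) p (K : R) (n : nat) u v : 0 <= l -> cintg l p ->
  ccont l u -> ccont l v ->
  let rho x := 1 + n1 (p x) in
  (forall x, 0 <= x <= l -> n1 (u x) + n1 (v x) <= K * (rint rho x ^+ n / n`!%:R)) ->
  forall x, 0 <= x <= l ->
    n1 (cI v x) + n1 (cI (fun t => p t * u t) x) <=
      K * (rint rho x ^+ n.+1 / n.+1`!%:R).
Proof.
move=> l0 pi cu cv rho h x /andP[x0 xl].
have ri : intg l rho by apply: intgD; [exact: intg_cst|exact: intg_n1].
have iv := cintg_sub xl (ccont_intg cv).
have ipu := cintg_sub xl (ccont_intgM cu pi).
have rx := intg_sub xl ri.
have [ir Rx] := rint_pow n x0 rx.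
have := Rx x; rewrite x0 lexx rint0 expr0n/= mul0r add0r => -> //.
rewrite -rintZ//.
apply: (le_trans (lerD (n1_cI iv) (n1_cI ipu))).
rewrite -rintD; [|exact: intg_n1|exact: intg_n1].
apply: le_rint => [||t /andP[t0 tx]].
- by apply: intgD; exact: intg_n1.
- exact: intgZ.
- have := h t; rewrite t0 (le_trans tx)// => /(_ isT).
  rewrite /= (_ : K * (rho t * (rint rho t ^+ n / n`!%:R)) =
    rho t * (K * (rint rho t ^+ n / n`!%:R))); last by ring.
  move: (K * (rint rho t ^+ n / n`!%:R)) => W hW.
  apply: (@le_trans _ _ (rho t * (n1 (u t) + n1 (v t)))); last first.
    by rewrite ler_wpM2l// addr_ge0// n1_ge0.
  have := n1M (p t) (u t); have := n1_ge0 (p t); have := n1_ge0 (u t).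
  have := n1_ge0 (v t); rewrite /rho; nra.
Qed.

Fixpoint picard p (u0 v0 : R -> C) n : (R -> C) * (R -> C) :=
  if n is m.+1 then
    (cI (picard p u0 v0 m).2, cI (fun t => p t * (picard p u0 v0 m).1 t))
  else (u0, v0).

(** The series of Picard's iterates is dominated by K * M ^ n / n!, with M the
    integral of 1 + |p|, hence solves the system in the limit. The explicit bound is what
    makes the dependence on parameters uniform later on. *)
Lemma volterra_system (l : R) p (u0 v0 : R -> C) (K : R) : 0 <= l -> cintg l p ->
  ccont l u0 -> ccont l v0 ->
  (forall x, 0 <= x <= l -> n1 (u0 x) + n1 (v0 x) <= K) ->
  exists y dy, [/\ ccont l y, ccont l dy,
    forall x, 0 <= x <= l -> y x = u0 x + cI dy x,
    forall x, 0 <= x <= l -> dy x = v0 x + cI (fun t => p t * y t) x &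
    forall x, 0 <= x <= l ->
      n1 (y x) + n1 (dy x) <= 4 * K * expR (rint (fun t => 1 + n1 (p t)) l)].
Proof.
move=> l0 pi cu0 cv0 K0.
set rho := fun t => 1 + n1 (p t).
have ri : intg l rho by apply: intgD; [exact: intg_cst|exact: intg_n1].
have rho0 t : 0 <= rho t by rewrite addr_ge0// n1_ge0.
set M := rint rho l.
have M0 : 0 <= M by apply: rint_ge0.
have Kp : 0 <= K.
  by apply: le_trans (K0 0 _); rewrite ?lexx ?l0// addr_ge0// n1_ge0.
pose P := picard p u0 v0.
have cP n : ccont l (P n).1 /\ ccont l (P n).2.
  elim: n => [//|n [h k]]; split; apply: ccont_cI => //; first exact: ccont_intg.
  exact: ccont_intgM.
have bP n x : 0 <= x <= l ->
    n1 ((P n).1 x) + n1 ((P n).2 x) <= K * (rint rho x ^+ n / n`!%:R).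
  elim: n x => [|n IH] x xl; first by rewrite fact0 expr0 divr1 mulr1 K0.
  by have [h k] := cP n; apply: picard_step IH _ xl.
have bPM n x : 0 <= x <= l ->
    n1 ((P n).1 x) + n1 ((P n).2 x) <= K * exp_coeff M n.
  move=> /[dup] xl /bP /le_trans; apply; rewrite ler_wpM2l// ler_wpM2r//.
  have [x0 xl'] := andP xl; rewrite lerXn2r ?nnegrE//; first exact: rint_ge0.
  exact: rint_mono.
pose tau n := K * (expR M - series (exp_coeff M) n).
have lim (sel : (R -> C) * (R -> C) -> R -> C) :
    (forall n x, 0 <= x <= l -> n1 (sel (P n) x) <= K * exp_coeff M n) ->
    exists F : R -> C, forall x, 0 <= x <= l -> forall n,
      n1 (F x - \sum_(k < n) sel (P k) x) <= 2 * tau n.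
  move=> hs.
  have [|F FE] := @dominated_series l K M (fun n x => Re (sel (P n) x)) Kp M0.
    by move=> n x /(hs n); apply: le_trans; rewrite lerDl.
  have [|G GE] := @dominated_series l K M (fun n x => Im (sel (P n) x)) Kp M0.
    by move=> n x /(hs n); apply: le_trans; rewrite lerDr.
  exists (fun x => F x +i* G x) => x xl n; rewrite /n1 !RI/=.
  rewrite Re_sum Im_sum.
  have := FE x xl n; have := GE x xl n; rewrite -/(tau n); lra.
have [n x xl|y yE] := lim fst.
  by apply: le_trans (bPM n x xl); rewrite lerDl n1_ge0.
have [n x xl|dy dyE] := lim snd.
  by apply: le_trans (bPM n x xl); rewrite lerDr n1_ge0.
pose S n x := \sum_(k < n) (P k).1 x; pose T n x := \sum_(k < n) (P k).2 x.
have cS n : ccont l (S n) by apply: ccont_sum => i; have [] := cP i.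
have cT n : ccont l (T n) by apply: ccont_sum => i; have [] := cP i.
have mb F (s : nat -> R -> C) : (forall n, ccont l (s n)) ->
    (forall x, 0 <= x <= l -> forall n, n1 (F x - s n x) <= 2 * tau n) -> mbounded l F.
  move=> cs Fs.
  have t20 : 2 * tau n @[n --> \oo] --> (0 : R).
    rewrite -[X in _ --> X](mulr0 2); apply: cvgM; first exact: cvg_cst.
    rewrite -[X in _ --> X](mulr0 K); apply: cvgM; first exact: cvg_cst.
    exact: exp_tail_cvg.
  split.
  - apply: (@measurable_fun_cvg _ _ _ _ (fun n t => Re (s n t))).
      by move=> n; apply: within_measurable; have [] := cs n.
    move=> x /=; rewrite in_itv/= => xl.
    apply/cvgrPdist_le => e e0; near=> n.
    have : 2 * tau n <= e by near: n; apply: (cvgr_le _ t20).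
    apply: le_trans; apply: le_trans (Fs x xl n).
    by rewrite /n1 !RI lerDl.
  - apply: (@measurable_fun_cvg _ _ _ _ (fun n t => Im (s n t))).
      by move=> n; apply: within_measurable; have [] := cs n.
    move=> x /=; rewrite in_itv/= => xl.
    apply/cvgrPdist_le => e e0; near=> n.
    have : 2 * tau n <= e by near: n; apply: (cvgr_le _ t20).
    apply: le_trans; apply: le_trans (Fs x xl n).
    by rewrite /n1 !RI lerDr.
  - have [_ _ [N N0 sN]] := ccont_mbounded (cs 0%N).
    have t0 : 0 <= tau 0%N.
      by rewrite mulr_ge0// subr_ge0; exact: exp_series_le.
    exists (2 * tau 0%N + N) => [|x xl]; first by rewrite addr_ge0// mulr_ge0.
    rewrite -[F x](subrK (s 0%N x)); apply: le_trans (n1D _ _) _.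
    by rewrite lerD// ?Fs ?sN.
have my : mbounded l y by exact: (mb y S).
have mdy : mbounded l dy by exact: (mb dy T).
have idy := mbounded_intg mdy.
have ipy := mbounded_intgM my pi.
have ipS n : cintg l (fun t => p t * S n t) by exact: ccont_intgM.
have SE n x : 0 <= x <= l -> S n.+1 x = u0 x + cI (T n) x.
  move=> /andP[x0 xl]; rewrite /S big_ord_recl/= cI_sum// => i.
  by have [_ h] := cP i; apply: (cintg_sub xl); exact: ccont_intg.
have TE n x : 0 <= x <= l -> T n.+1 x = v0 x + cI (fun t => p t * S n t) x.
  move=> /andP[x0 xl]; rewrite /T big_ord_recl/=; congr (_ + _).
  under [RHS]eq_cI => t _ do rewrite mulr_sumr.
  rewrite cI_sum// => i.
  by have [h _] := cP i; apply: (cintg_sub xl); exact: ccont_intgM.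
have tauS n : tau n.+1 <= tau n.
  by rewrite /tau ler_wpM2l// exp_tail_anti.
have tau0 n : 0 <= tau n by rewrite mulr_ge0// subr_ge0; exact: exp_series_le.
have yI x : 0 <= x <= l -> y x = u0 x + cI dy x.
  move=> /[dup] xl' /andP[x0 xl]; apply/eqP; rewrite -subr_eq0; apply/eqP/n1_le0.
  apply: (@exp_tail_le0 M _ ((2 + 2 * l) * K)) => n.
  rewrite (_ : y x - _ = (y x - S n.+1 x) + cI (fun t => T n t - dy t) x); last first.
    rewrite cI_B ?SE//; first by ring.
      exact: cintg_sub (ccont_intg (cT n)).
    exact: cintg_sub idy.
  apply: le_trans (n1D _ _) _; have := yE x xl' n.+1; rewrite -/(S n.+1 x) => h1.
  have h2 : n1 (cI (fun t => T n t - dy t) x) <= rint (fun=> 2 * tau n) x.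
    apply: n1_cI_le.
    - apply: (cintg_sub xl); apply: cintgB => //; exact: ccont_intg.
    - exact: intg_cst.
    - move=> t /andP[t0 tx]; rewrite -n1N opprB; apply: dyE.
      by rewrite t0 (le_trans tx).
  rewrite rint_cst// in h2; have := tauS n; have := tau0 n.
  rewrite -mulrA -/(tau n); nra.
have dyI x : 0 <= x <= l -> dy x = v0 x + cI (fun t => p t * y t) x.
  move=> /[dup] xl' /andP[x0 xl]; apply/eqP; rewrite -subr_eq0; apply/eqP/n1_le0.
  have inp := intg_n1 pi.
  apply: (@exp_tail_le0 M _ ((2 + 2 * rint (fun t => n1 (p t)) l) * K)) => n.
  rewrite (_ : dy x - _ = (dy x - T n.+1 x) + cI (fun t => p t * S n t - p t * y t) x); last first.
    rewrite cI_B ?TE//; first by ring.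
      exact: cintg_sub (ipS n).
    exact: cintg_sub ipy.
  apply: le_trans (n1D _ _) _; have := dyE x xl' n.+1; rewrite -/(T n.+1 x) => h1.
  have h2 : n1 (cI (fun t => p t * S n t - p t * y t) x) <=
      rint (fun t => 2 * tau n * n1 (p t)) x.
    apply: n1_cI_le.
    - by apply: (cintg_sub xl); apply: cintgB.
    - by apply: intgZ; exact: intg_sub inp.
    - move=> t /andP[t0 tx]; rewrite -mulrBr; apply: le_trans (n1M _ _) _.
      rewrite mulrC ler_wpM2r ?n1_ge0// -n1N opprB; apply: yE.
      by rewrite t0 (le_trans tx).
  rewrite rintZ in h2; last exact: intg_sub inp.
  have h3 : rint (fun t => n1 (p t)) x <= rint (fun t => n1 (p t)) l.
    by apply: rint_mono => // t _; exact: n1_ge0.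
  have := tauS n; have := tau0 n.
  rewrite -mulrA -/(tau n); nra.
exists y, dy; split => //.
- apply: eq_ccont (ccontD cu0 (ccont_cI l0 idy)) => x xl; by rewrite yI.
- apply: eq_ccont (ccontD cv0 (ccont_cI l0 ipy)) => x xl; by rewrite dyI.
- move=> x xl; have := yE x xl 0%N; have := dyE x xl 0%N.
  rewrite !big_ord0 !subr0 /tau /series/= big_geq// subr0.
  lra.
Unshelve. all: by end_near. Qed.

(** Any bound on the solution improves to bound * M ^ n / n! by iterating the
    equation n times. *)
Lemma volterra_unique (l : R) p y dy : 0 <= l -> cintg l p ->
  cAC l y dy -> cAC l dy (fun t => p t * y t) -> y 0 = 0 -> dy 0 = 0 ->
  forall x, 0 <= x <= l -> y x = 0 /\ dy x = 0.
Proof.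
move=> l0 pi yA dyA y0 dy0.
set rho := fun t => 1 + n1 (p t).
have cy := cAC_cont l0 yA; have cdy := cAC_cont l0 dyA.
have [_ _ [N N0 yN]] := ccont_mbounded cy.
have [_ _ [N' N0' dyN]] := ccont_mbounded cdy.
have b n x : 0 <= x <= l -> n1 (y x) + n1 (dy x) <= (N + N') * (rint rho x ^+ n / n`!%:R).
  elim: n x => [|n IH] x xl; first by rewrite fact0 expr0 divr1 mulr1 lerD ?yN ?dyN.
  rewrite (cAC_eq yA xl) (cAC_eq dyA xl) y0 dy0 !add0r.
  exact: picard_step IH _ xl.
move=> x xl.
have h : (N + N') * exp_coeff (rint rho x) n @[n --> \oo] --> (0 : R).
  rewrite -[X in _ --> X](mulr0 (N + N')); apply: cvgM; first exact: cvg_cst.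
  exact: cvg_exp_coeff.
have {}h : n1 (y x) + n1 (dy x) <= 0.
  by move/cvgr_to_ge : h; apply; near=> n; exact: b.
have := n1_ge0 (y x); have := n1_ge0 (dy x) => h1 h2.
by split; apply: n1_le0; lra.
Unshelve. all: by end_near. Qed.
End Volterra.

(** * Square-integrable functions *)
Section SquareIntegrable.
Variable R : realType.
Local Notation mu := (@lebesgue_measure R).
Implicit Types (D : set R) (f g : R -> R) (l : R).

Lemma L2P D f : measurable D -> L2 D f <->
  measurable_fun D f /\ mu.-integrable D (EFin \o (fun x => f x ^+ 2)).
Proof.
move=> mD.
have sqE : (EFin \o (fun x => f x ^+ 2)) \_ D = EFin \o (fun x => (f \_ D) x ^+ 2).
  by apply/funext => x; rewrite /= !patchE; case: ifPn => // _; rewrite expr0n.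
split=> [h|[mf fi]].
  split.
    apply/(measurable_restrictT _ mD).
    by move: h; rewrite /L2 inE => /andP[]; rewrite inE.
  by apply/integrable_mkcond => //; rewrite sqE; exact: Lfun2_integrable_sqr.
have mfD : measurable_fun setT (f \_ D) by exact/(measurable_restrictT _ mD).
rewrite /L2 inE; apply/andP; split; rewrite inE//=.
rewrite /finite_norm unlock /Lnorm poweR_lty//.
move/integrable_mkcond : fi => /(_ mD); rewrite sqE => /integrableP[_].
by congr (_ < _)%E; apply: eq_integral => x _ /=;
  rewrite powR_mulrn// normrX.
Qed.

Lemma measurable_edge l : measurable (edge l).
Proof. exact: measurable_itv. Qed.

Lemma eq_L2 D f g : (forall x, D x -> f x = g x) -> L2 D f -> L2 D g.
Proof.
move=> fg; rewrite /L2 (_ : f \_ D = g \_ D)//; apply/funext => x.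
by rewrite !patchE; case: ifPn => //; rewrite inE => /fg.
Qed.

Lemma L2D D f g : L2 D f -> L2 D g -> L2 D (fun x => f x + g x).
Proof.
move=> hf hg; rewrite /L2 (_ : _ \_ D = f \_ D + g \_ D).
  by apply: (Lfun_addr_closed _ _).2 => //; rewrite lee_fin ler1n.
apply/funext => x; rewrite /GRing.add/= !patchE; case: ifPn => // _; by rewrite addr0.
Qed.

Lemma L2Z D (c : R) f : L2 D f -> L2 D (fun x => c * f x).
Proof.
move=> hf; rewrite /L2 (_ : _ \_ D = c \o* (f \_ D)).
  by apply: Lfun_scale; rewrite ?ler1n.
apply/funext => x; rewrite /= !patchE; case: ifPn => _; first by rewrite mulrC.
by rewrite /point/= mul0r.
Qed.

Lemma L2M_bounded D f g (M : R) : measurable D -> L2 D f -> measurable_fun D g ->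
  (forall x, D x -> `|g x| <= M) -> L2 D (fun x => f x * g x).
Proof.
move=> mD /(L2P _ mD)[mf fi] mg gM; apply/(L2P _ mD); split.
  exact: measurable_funM.
have H : mu.-integrable D ((EFin \o (fun x => (g x ^+ 2)%R)) \* (EFin \o (fun x => (f x ^+ 2)%R)))%E.
  apply: integrableMr => //; first exact: measurable_funX.
  exists (M ^+ 2); split; first exact: num_real.
  move=> N MN x Dx /=; rewrite normrX (le_trans _ (ltW MN))// lerXn2r ?nnegrE//.
    by rewrite (le_trans _ (gM x Dx)).
  exact: gM.
by apply: eq_integrable H => // x _; rewrite /= -EFinM exprMn mulrC.
Qed.

Lemma L2_bounded l f (M : R) : measurable_fun (edge l) f ->
  (forall x, 0 <= x <= l -> `|f x| <= M) -> L2 (edge l) f.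
Proof.
move=> mf fM; have mD := measurable_edge l; apply/(L2P _ mD); split => //.
have h : intg l (fun x => f x * (f x * 1)).
  apply: (intgM mf fM); apply: (intgM mf fM); exact: intg_cst.
by rewrite intgE in h; apply: eq_integrable h => // x _ /=; rewrite mulr1.
Qed.

Lemma L2_intg l f : L2 (edge l) f -> intg l f.
Proof.
move=> /(L2P _ (measurable_edge l))[mf fi].
have h : intg l (fun x => 1 + f x ^+ 2) by apply: intgD; rewrite ?intgE//; rewrite -intgE; exact: intg_cst.
rewrite !intgE in h *; apply: le_integrable h => //.
  exact/measurable_EFinP.
move=> x _; rewrite /= lee_fin [leRHS]ger0_norm; last by rewrite addr_ge0// sqr_ge0.
have <- : `|f x| ^+ 2 = f x ^+ 2 by rewrite real_normK ?num_real.
have := normr_ge0 (f x); move: `|f x| => N N0; have := sqr_ge0 (N - 1); nra.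
Qed.
End SquareIntegrable.

(** * Continuous functions with vanishing integral *)
Section ContinuousNonneg.
Variable R : realType.
Local Notation mu := (@lebesgue_measure R).

(** The primitive vanishes identically, being squeezed between 0 and its value at l,
    and f is its derivative inside the interval. *)
Lemma rint0_continuous (l : R) (f : R -> R) : 0 < l ->
  {within `[0, l], continuous f} -> (forall x, 0 <= x <= l -> 0 <= f x) ->
  rint f l = 0 -> forall x, 0 <= x <= l -> f x = 0.
Proof.
move=> l0 cf f0 fl0.
have fi := within_intg cf.
have fx0 x : 0 <= x <= l -> rint f x = 0.
  move=> xl; apply/eqP; rewrite eq_le -{1}fl0 rint_mono//= rint_ge0// => t.
  by case/andP: xl => _ xl /andP[t0 tx]; rewrite f0// t0 (le_trans tx).
have [cin c0 cl] := (continuous_within_itvP f l0).1 cf.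
have fin x : 0 < x < l -> f x = 0.
  move=> /andP[x0 xl]; rewrite intgE in fi.
  have cx : {for x, continuous f} by apply: cin; rewrite in_itv/= x0.
  have [dF <-] := continuous_FTC1_closed xl fi x0 cx.
  rewrite derive1E.
  rewrite (@near_eq_derive _ _ _ _ (cst 0)); first by rewrite derive_cst.
  near=> t; rewrite -rintE fx0//; apply/andP; split; near: t.
    by apply: filterS (lt_nbhsr x0) => u /ltW.
  by apply: filterS (lt_nbhsl xl) => u /ltW.
have at0 (F : set_system R) a : ProperFilter F -> f @ F --> f a ->
    (\forall x \near F, 0 < x < l) -> f a = 0.
  move=> FF fa nF; have : f @ F --> (0 : R).
    apply: cvg_near_cst; near=> t; apply: fin; near: t; exact: nF.
  exact: cvg_unique fa.
move=> x /andP[]; rewrite le_eqVlt => /predU1P[<- _|x0].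
  apply: (at0 0^'+) => //; near=> t; apply/andP; split; near: t.
    exact: nbhs_right_gt.
  exact: nbhs_right_lt.
rewrite le_eqVlt => /predU1P[->|xl].
  apply: (at0 l^'-) => //; near=> t; apply/andP; split; near: t.
    exact: nbhs_left_gt.
  exact: nbhs_left_lt.
by apply: fin; rewrite x0.
Unshelve. all: by end_near. Qed.
End ContinuousNonneg.

(** * The equation on one edge *)
Section EdgeEquation.
Variable R : realType.
Local Notation C := R[i].
Local Notation mu := (@lebesgue_measure R).
Local Notation Re := complex.Re.
Local Notation Im := complex.Im.
Variables (l : R) (l0 : 0 <= l).
Implicit Types (q : R -> R) (y dy z dz h k : R -> C) (lam a b : C).

(** The equation - y'' + q y = lam y as a first order system for absolutely continuous
    functions. It contains no second derivative, so that the exceptional null set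
    of the pointwise equation disappears. *)
Definition sol q lam y dy :=
  cAC l y dy /\ cAC l dy (fun x => ((q x)%:C - lam) * y x).

Lemma edgeP x : edge l x <-> 0 <= x <= l.
Proof. by rewrite /edge/= in_itv. Qed.

Lemma CL2_cintg f : CL2 (edge l) f -> cintg l f.
Proof. by move=> [h1 h2]; split; exact: L2_intg. Qed.

Lemma mbounded_CL2 f : mbounded l f -> CL2 (edge l) f.
Proof.
move=> [m1 m2 [M M0 fM]]; split.
  by apply: (L2_bounded (M := M) m1) => x xl; rewrite (le_trans _ (fM x xl))// lerDl.
by apply: (L2_bounded (M := M) m2) => x xl; rewrite (le_trans _ (fM x xl))// lerDr.
Qed.

Lemma primitive_cAC y dy : cintg l dy -> primitive (edge l) y dy -> cAC l y dy.
Proof.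
move=> di yp; apply: (@cAC_intro _ _ _ _ (y 0)) => // x /edgeP /yp.
by rewrite /cI !rintE.
Qed.

Lemma cAC_primitive y dy : cAC l y dy -> primitive (edge l) y dy.
Proof. by move=> yA x /edgeP /(cAC_eq yA); rewrite /cI !rintE. Qed.

Lemma cintg_potential q lam : L2 (edge l) q -> cintg l (fun x => (q x)%:C - lam).
Proof.
move=> /L2_intg qi; split.
  by apply: eq_intg (intgB qi (intg_cst l (Re lam))) => x _; rewrite !RI.
by apply: eq_intg (intg_cst l (- Im lam)) => x _; rewrite !RI/= sub0r.
Qed.

Lemma H2_sol q lam y dy ddy : L2 (edge l) q -> H2 (edge l) y dy ddy ->
  ae_eq mu (edge l) (fun x => - ddy x + (q x)%:C * y x) (fun x => lam * y x) ->
  sol q lam y dy.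
Proof.
move=> qL [yL dyL ddyL yp dyp] eq.
have yA := primitive_cAC (CL2_cintg dyL) yp.
have dyA := primitive_cAC (CL2_cintg ddyL) dyp.
split=> //.
have pi := ccont_intgM (cAC_cont l0 yA) (cintg_potential lam qL).
apply: (@cAC_intro _ _ _ _ (dy 0)) => // x /andP[x0 xl].
rewrite (cAC_eq dyA) ?x0//; congr (_ + _).
have {}eq : ae_eq mu (edge x) ddy (fun x => ((q x)%:C - lam) * y x).
  apply: filterS eq => t /= h tx.
  have /h : edge l t by move: tx; rewrite /edge/= !in_itv/= => /andP[-> /le_trans]; exact.
  by move=> /eqP; rewrite addrC subr_eq => /eqP e; rewrite mulrBl e; ring.
have [i1 i2] := cintg_sub xl (CL2_cintg ddyL).
have [i3 i4] := cintg_sub xl pi.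
rewrite /cI; congr (_ +i* _); apply: rint_ae; try exact: intg_measurable.
  by apply: filterS eq => t /= h /h ->.
by apply: filterS eq => t /= h /h ->.
Qed.

Lemma CL2_potentialM q lam y : L2 (edge l) q -> ccont l y ->
  CL2 (edge l) (fun x => ((q x)%:C - lam) * y x).
Proof.
move=> qL /ccont_mbounded my; have [m1 m2 [M M0 yM]] := my.
have [h1 h2] : CL2 (edge l) y by exact: mbounded_CL2.
have mE := measurable_edge l.
have k1 : L2 (edge l) (fun x => q x * Re (y x)).
  by apply: (L2M_bounded (M := M)) => // x /edgeP xl; rewrite (le_trans _ (yM x xl))// lerDl.
have k2 : L2 (edge l) (fun x => q x * Im (y x)).
  by apply: (L2M_bounded (M := M)) => // x /edgeP xl; rewrite (le_trans _ (yM x xl))// lerDr.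
split.
  apply: eq_L2 (L2D k1 (L2D (L2Z (- Re lam) h1) (L2Z (Im lam) h2))) => x _.
  by rewrite !RI/=; ring.
apply: eq_L2 (L2D k2 (L2D (L2Z (- Re lam) h2) (L2Z (- Im lam) h1))) => x _.
by rewrite !RI/=; ring.
Qed.

Lemma sol_H2 q lam y dy : L2 (edge l) q -> sol q lam y dy ->
  H2 (edge l) y dy (fun x => ((q x)%:C - lam) * y x).
Proof.
move=> qL [yA dyA].
have cy := cAC_cont l0 yA; have cdy := cAC_cont l0 dyA.
split; try exact: cAC_primitive.
- exact/mbounded_CL2/ccont_mbounded.
- exact/mbounded_CL2/ccont_mbounded.
- exact: CL2_potentialM.
Qed.

Lemma sol_ae q lam y : ae_eq mu (edge l)
  (fun x => - (((q x)%:C - lam) * y x) + (q x)%:C * y x) (fun x => lam * y x).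
Proof. by apply: nearW => x _ /=; ring. Qed.

Lemma ivpP q lam a b y dy : L2 (edge l) q ->
  initial_value_problem l q lam a b y dy <-> [/\ y 0 = a, dy 0 = b & sol q lam y dy].
Proof.
move=> qL; split=> [[y0 dy0 [ddy h eq]]|[y0 dy0 s]]; split => //.
  exact: H2_sol eq.
by eexists; [exact: sol_H2 s|exact: sol_ae].
Qed.

(** The integral equation starts from (0, - int f). *)
Lemma inhom_exists (p f : R -> C) (K : R) : cintg l p -> ccont l f ->
  (forall x, 0 <= x <= l -> n1 (f x) <= K) ->
  exists z dz, [/\ cAC l z dz, cAC l dz (fun x => p x * z x - f x), z 0 = 0, dz 0 = 0 &
    forall x, 0 <= x <= l ->
      n1 (z x) + n1 (dz x) <= 4 * (K * l) * expR (rint (fun t => 1 + n1 (p t)) l)].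
Proof.
move=> pi cf fK.
have fi := ccont_intg cf.
have nfi := cintgN fi.
have [|z [dz [cz cdz zE dzE zK]]] := @volterra_system _ l p (fun=> 0)
    (cI (fun x => - f x)) (K * l) l0 pi (ccont_cst l 0) (ccont_cI l0 nfi).
  move=> x /andP[x0 xl]; rewrite n1_0 add0r.
  have : n1 (cI (fun x => - f x) x) <= rint (fun=> K) x.
    apply: n1_cI_le; [exact: cintg_sub nfi|exact: intg_cst|].
    by move=> t /andP[t0 tx]; rewrite n1N fK// t0 (le_trans tx).
  rewrite rint_cst// => /le_trans; apply; apply: ler_wpM2l => //.
  by apply: le_trans (fK 0 _); rewrite ?n1_ge0 ?lexx.
have pz := ccont_intgM cz pi.
exists z, dz; split => //.
- by apply: (@cAC_intro _ _ _ _ 0) => //; exact: ccont_intg.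
- apply: (@cAC_intro _ _ _ _ 0); first exact: cintgB.
  move=> x /[dup] xl' /andP[x0 xl]; rewrite dzE// -cI_D; last 2 first.
  - exact: cintg_sub nfi.
  - exact: cintg_sub pz.
  by rewrite add0r; apply: eq_cI => t _; ring.
- by rewrite zE ?lexx ?l0// cI0 addr0.
- by rewrite dzE ?lexx ?l0// !cI0 addr0.
Qed.

Lemma ivp_exists q lam a b : L2 (edge l) q ->
  exists y dy, [/\ y 0 = a, dy 0 = b, sol q lam y dy &
    forall x, 0 <= x <= l -> n1 (y x) + n1 (dy x) <=
      4 * (n1 a + n1 b) * expR (rint (fun t => 1 + n1 ((q t)%:C - lam)) l)].
Proof.
move=> qL; have pi := cintg_potential lam qL.
have [|y [dy [cy cdy yE dyE yK]]] := @volterra_system _ l _ (fun=> a)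
    (fun=> b) (n1 a + n1 b) l0 pi (ccont_cst l a) (ccont_cst l b).
  by move=> x _.
have py := ccont_intgM cy pi.
exists y, dy; split => //.
- by rewrite yE ?lexx ?l0// cI0 addr0.
- by rewrite dyE ?lexx ?l0// cI0 addr0.
- split; first by apply: (cAC_intro (ccont_intg cdy) yE).
  exact: (cAC_intro py dyE).
Qed.

Lemma sol_unique q lam y dy z dz : L2 (edge l) q ->
  sol q lam y dy -> sol q lam z dz -> y 0 = z 0 -> dy 0 = dz 0 ->
  forall x, 0 <= x <= l -> y x = z x /\ dy x = dz x.
Proof.
move=> qL [yA dyA] [zA dzA] y0 dy0 x xl.
have [] := @volterra_unique _ l _ (fun x => y x - z x) (fun x => dy x - dz x)
  l0 (cintg_potential lam qL) (cACB yA zA) _ _ _ x xl.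
- by apply: eq_cAC (cACB dyA dzA) => t _ //; ring.
- by rewrite y0 subrr.
- by rewrite dy0 subrr.
by move=> /eqP; rewrite subr_eq0 => /eqP -> /eqP; rewrite subr_eq0 => /eqP ->.
Qed.

Lemma sol_lin q lam c d y dy z dz : sol q lam y dy -> sol q lam z dz ->
  sol q lam (fun x => c * y x + d * z x) (fun x => c * dy x + d * dz x).
Proof.
move=> [yA dyA] [zA dzA]; split.
  exact: (cACD (cACZ c l0 yA) (cACZ d l0 zA)).
by apply: eq_cAC (cACD (cACZ c l0 dyA) (cACZ d l0 dzA)) => x _ //; ring.
Qed.

Lemma sol_conj q lam y dy : sol q lam y dy ->
  sol q lam^* (fun x => (y x)^*) (fun x => (dy x)^*).
Proof.
move=> [yA dyA]; split; first exact: cACJ.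
apply: eq_cAC (cACJ dyA) => x _ //.
by rewrite rmorphM rmorphB/= oppr0.
Qed.

Lemma solutionP q lam a b : L2 (edge l) q ->
  let w := solution l q lam a b in
  [/\ w.1 0 = a, w.2 0 = b & sol q lam w.1 w.2].
Proof.
move=> qL w; have [y [dy [y0 dy0 s _]]] := ivp_exists lam a b qL.
apply/ivpP => //.
rewrite /w /solution; case: xgetP => [v _ //|].
by move=> /(_ (y, dy)) []; apply/ivpP.
Qed.

Lemma solution_bound q lam a b x : L2 (edge l) q -> 0 <= x <= l ->
  let w := solution l q lam a b in
  n1 (w.1 x) + n1 (w.2 x) <=
    4 * (n1 a + n1 b) * expR (rint (fun t => 1 + n1 ((q t)%:C - lam)) l).
Proof.
move=> qL xl; set w := solution _ _ _ _ _ => /=; have [y [dy [y0 dy0 s h]]] := ivp_exists lam a b qL.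
have [w0 dw0 ws] := solutionP lam a b qL.
have [] := sol_unique qL ws s _ _ xl; rewrite ?w0 ?y0 ?dw0 ?dy0//.
by move=> -> ->; exact: h.
Qed.

Lemma sol_basis q lam y dy x : L2 (edge l) q -> sol q lam y dy -> 0 <= x <= l ->
  y x = y 0 * cos_sol l q lam x + dy 0 * sin_sol l q lam x /\
  dy x = y 0 * cos_sol' l q lam x + dy 0 * sin_sol' l q lam x.
Proof.
move=> qL s xl.
have [c0 dc0 cs] := solutionP lam 1 0 qL.
have [s0 ds0 ss] := solutionP lam 0 1 qL.
apply: (sol_unique qL s (sol_lin (y 0) (dy 0) cs ss) _ _ xl).
  by rewrite c0 s0; ring.
by rewrite dc0 ds0; ring.
Qed.

(** For real data the conjugate solves the same initial value problem. *)
Lemma solution_real q (r : R) (a b : R) x : L2 (edge l) q -> 0 <= x <= l ->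
  let w := solution l q r%:C a%:C b%:C in
  (w.1 x)^* = w.1 x /\ (w.2 x)^* = w.2 x.
Proof.
move=> qL xl w.
have [w0 dw0 ws] := solutionP r%:C a%:C b%:C qL.
have := sol_conj ws; rewrite conjc_real => s.
by apply: (sol_unique qL s ws _ _ xl); rewrite ?w0 ?dw0 conjc_real.
Qed.

Lemma cI_Z c h : cintg l h -> cI (fun x => c * h x) l = c * cI h l.
Proof.
move=> hi; rewrite (cAC_ftc l0 (cACZ c l0 (cAC_cI hi))) cI0; ring.
Qed.

Lemma cI_real (f : R -> R) : cI (fun x => (f x)%:C) l = (rint f l)%:C.
Proof. by rewrite /cI/= rint_cst// mul0r. Qed.

Definition sqabs (z : C) : R := Re z ^+ 2 + Im z ^+ 2.

Lemma sqabs_ge0 (z : C) : 0 <= sqabs z. Proof. by rewrite addr_ge0// sqr_ge0. Qed.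

Lemma mulcJ (z : C) : z * z^* = (sqabs z)%:C.
Proof. by apply: complexP; rewrite !RI/= /sqabs; ring. Qed.

Lemma sqabs_eq0 (z : C) : sqabs z = 0 -> z = 0.
Proof.
move=> /eqP; rewrite paddr_eq0 ?sqr_ge0// !sqrf_eq0 => /andP[/eqP r0 /eqP i0].
exact: complexP.
Qed.

Definition sqnorm y := rint (fun x => sqabs (y x)) l.
(** The quadratic form of - y'' + q y on an edge. *)
Definition edge_form q y dy := rint (fun x => sqabs (dy x) + q x * sqabs (y x)) l.

Lemma within_sqabs y : ccont l y -> {within `[0, l], continuous (fun x => sqabs (y x))}.
Proof.
move=> [h k]; apply: (@subspace_eq_continuous _ _ _
    (fun x => Re (y x) * Re (y x) + Im (y x) * Im (y x))).
  by move=> x _; rewrite /from_subspace/= /sqabs !expr2.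
move=> x; exact: (continuousD (continuousM (h x) (h x)) (continuousM (k x) (k x))).
Qed.

Lemma sqnorm_ge0 y : 0 <= sqnorm y.
Proof. by apply: rint_ge0 => x _; exact: sqabs_ge0. Qed.

Lemma sqnorm_eq0 y : 0 < l -> ccont l y -> sqnorm y = 0 -> forall x, 0 <= x <= l -> y x = 0.
Proof.
move=> lp cy y0 x xl; apply: sqabs_eq0.
by apply: (rint0_continuous lp (within_sqabs cy)) => // t _; exact: sqabs_ge0.
Qed.

(** Integrate the derivative of y' * conj y. *)
Lemma energy q lam y dy : intg l q -> sol q lam y dy ->
  dy l * (y l)^* - dy 0 * (y 0)^* = (edge_form q y dy)%:C - lam * (sqnorm y)%:C.
Proof.
move=> qi [yA dyA].
have cy := within_sqabs (cAC_cont l0 yA); have cdy := within_sqabs (cAC_cont l0 dyA).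
rewrite -(cAC_ftc l0 (cACM l0 dyA (cACJ yA))).
rewrite -!cI_real -cI_Z; last first.
  by split => /=; [exact: within_intg|exact: intg_cst].
have i1 : intg l (fun x => sqabs (dy x) + q x * sqabs (y x)).
  apply: intgD; first exact: within_intg.
  by apply: eq_intg (within_intgM cy qi) => x _; rewrite mulrC.
rewrite -cI_B; last 2 first.
- by split=> //=; exact: intg_cst.
- have i2 := within_intg cy.
  split; first by apply: eq_intg (intgZ (Re lam) i2) => x _; rewrite !RI/=; ring.
  by apply: eq_intg (intgZ (Im lam) i2) => x _; rewrite !RI/=; ring.
apply: eq_cI => x _; rewrite rmorphD rmorphM/= -!mulcJ; ring.
Qed.

(** Lagrange's identity between y and a solution z of the equation with right-hand
    side kap * y. Its left-hand side consists of boundary terms only, while the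
    right-hand side is a nonzero multiple of the squared norm of y: this is what
    forbids Jordan chains. *)
Lemma jordan_identity q (r : R) (kap : C) y dy z dz : sol q r%:C y dy ->
  cAC l z dz -> cAC l dz (fun x => ((q x)%:C - r%:C) * z x - kap * y x) ->
  dz l * (y l)^* - z l * (dy l)^* - (dz 0 * (y 0)^* - z 0 * (dy 0)^*) =
    - kap * (sqnorm y)%:C.
Proof.
move=> [yA dyA] zA dzA.
have cy := within_sqabs (cAC_cont l0 yA).
rewrite -(cAC_ftc l0 (cACB (cACM l0 dzA (cACJ yA)) (cACM l0 zA (cACJ dyA)))).
rewrite -cI_real -cI_Z; last by split => /=; [exact: within_intg|exact: intg_cst].
apply: eq_cI => x _; rewrite -mulcJ (_ : (((q x)%:C - r%:C) * y x)^* = ((q x)%:C - r%:C) * (y x)^*).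
  by ring.
by apply: complexP; rewrite !RI/=; ring.
Qed.

(** Subtracting its mean m from q leaves g = q - m with a primitive G that
    vanishes at both ends. Integration by parts gives
    int g |y|^2 = - int G (|y|^2)' >= - int (B ^ 2 |y|^2 + |y'|^2), with B a bound of G.
    The term in y' is absorbed by the form and no boundary term remains. *)
Lemma edge_form_ge q : 0 < l -> intg l q -> exists2 c : R, 0 <= c &
  forall y dy, cAC l y dy -> ccont l dy -> - c * sqnorm y <= edge_form q y dy.
Proof.
move=> lp qi; set m := rint q l / l; pose g x := q x - m.
have gi : intg l g by apply: intgB => //; exact: intg_cst.
have gA := rAC_rint gi.
have [B B0 GB] := within_bounded (rint_continuous l0 gi).
have gl : rint g l = 0 by rewrite rintB ?rint_cst//; [rewrite divfK ?gt_eqF ?subrr|exact: intg_cst].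
exists (`|m| + B ^+ 2) => [|y dy yA cdy]; first by rewrite addr_ge0 ?sqr_ge0.
have [cy1 cy2] := cAC_cont l0 yA; have [cd1 cd2] := cdy.
have cy := within_sqabs (cAC_cont l0 yA); have cd := within_sqabs cdy.
have [y1 y2] := yA.
have fA := rACD (rACM l0 y1 y1) (rACM l0 y2 y2).
pose f' x := Re (dy x) * Re (y x) + Re (y x) * Re (dy x) +
  (Im (dy x) * Im (y x) + Im (y x) * Im (dy x)).
have := rAC_ftc l0 (rACM l0 gA fA); rewrite gl rint0 !mul0r subrr => E.
have if' : intg l (fun x => rint g x * f' x).
  by apply: within_intgM; [exact: rint_continuous|exact: fA.1].
have iy := within_intg cy; have id := within_intg cd.
have igf : intg l (fun x => g x * sqabs (y x)).
  by apply: eq_intg (within_intgM cy gi) => x _; rewrite mulrC.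
have iqf : intg l (fun x => q x * sqabs (y x)).
  by apply: eq_intg (within_intgM cy qi) => x _; rewrite mulrC.
have {}E : rint (fun x => g x * sqabs (y x)) l + rint (fun x => rint g x * f' x) l = 0.
  by rewrite -rintD// -{}E; apply: eq_rint => x _; rewrite /f' /sqabs !expr2.
have F : rint (fun x => rint g x * f' x) l <= rint (fun x => B ^+ 2 * sqabs (y x) + sqabs (dy x)) l.
  apply: le_rint => // [|x xl].
    by apply: intgD => //; exact: intgZ.
  have := GB x xl; rewrite ler_norml => /andP[]; rewrite /f' /sqabs.
  move: (rint g x) (Re (y x)) (Im (y x)) (Re (dy x)) (Im (dy x)) => G a b c d h1 h2.
  have h3 : G ^+ 2 <= B ^+ 2 by nra.
  have := sqr_ge0 (G * a - c); have := sqr_ge0 (G * b - d).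
  have : G ^+ 2 * (a ^+ 2 + b ^+ 2) <= B ^+ 2 * (a ^+ 2 + b ^+ 2).
    by apply: ler_wpM2r => //; rewrite addr_ge0// sqr_ge0.
  nra.
rewrite rintD ?rintZ// in F; last exact: intgZ.
have qE : rint (fun x => q x * sqabs (y x)) l =
    rint (fun x => g x * sqabs (y x)) l + m * sqnorm y.
  by rewrite -rintZ// -rintD//; [apply: eq_rint => x _; rewrite /g; ring|exact: intgZ].
rewrite /edge_form rintD// qE -/(sqnorm y).
rewrite -/(sqnorm y) in F; have := sqnorm_ge0 y; have := ler_norm (- m); rewrite normrN.
nra.
Qed.

(** A choice of the solution operator f |-> z of - z'' + p z = f, z(0) = z'(0) = 0,
    which can be iterated. *)
Lemma inhom_operator (p : R -> C) : cintg l p ->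
  exists (W dW : (R -> C) -> R -> C) (A : R), 0 <= A /\
    forall f, ccont l f -> [/\ cAC l (W f) (dW f),
      cAC l (dW f) (fun x => p x * W f x - f x), W f 0 = 0, dW f 0 = 0 &
      forall K, (forall x, 0 <= x <= l -> n1 (f x) <= K) ->
        forall x, 0 <= x <= l -> n1 (W f x) + n1 (dW f x) <= A * K].
Proof.
move=> pi; set A := 4 * l * expR (rint (fun t => 1 + n1 (p t)) l).
have h f : {w : (R -> C) * (R -> C) | ccont l f -> [/\ cAC l w.1 w.2,
      cAC l w.2 (fun x => p x * w.1 x - f x), w.1 0 = 0, w.2 0 = 0 &
      forall K, (forall x, 0 <= x <= l -> n1 (f x) <= K) ->
        forall x, 0 <= x <= l -> n1 (w.1 x) + n1 (w.2 x) <= A * K]}.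
  apply: cid; have [cf|ncf] := pselect (ccont l f); last by exists (f, f).
  have [_ _ [N N0 fN]] := ccont_mbounded cf.
  have [z [dz [zA dzA z0 dz0 _]]] := inhom_exists pi cf fN.
  exists (z, dz) => _; split => //= K fK x xl.
  have [z' [dz' [zA' dzA' z0' dz0' zK]]] := inhom_exists pi cf fK.
  have [] := @volterra_unique _ l p (fun x => z x - z' x) (fun x => dz x - dz' x)
    l0 pi (cACB zA zA') _ _ _ x xl.
  - by apply: eq_cAC (cACB dzA dzA') => t _ //; ring.
  - by rewrite z0 z0' subrr.
  - by rewrite dz0 dz0' subrr.
  move=> /eqP; rewrite subr_eq0 => /eqP -> /eqP; rewrite subr_eq0 => /eqP ->.
  by apply: le_trans (zK x xl) _; rewrite /A le_eqVlt; apply/orP; left; apply/eqP; ring.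
exists (fun f => (sval (h f)).1), (fun f => (sval (h f)).2), A; split.
  by rewrite /A mulr_ge0 ?expR_ge0// mulr_ge0.
by move=> f cf; case: (h f) => w /= /(_ cf).
Qed.

(** With W the solution operator of the inhomogeneous problem at lam0 and
    eps = lam - lam0, uniqueness gives Y lam = Y lam0 + eps * W (Y lam); substituting this
    three times leaves the remainder eps ^ 3 * W (W (W (Y lam))), and the bound on the
    solutions makes it uniform. The expansion has order three because it serves to
    differentiate the difference quotient at lam0 itself. *)
Lemma solution_taylor q (lam0 a b : C) : L2 (edge l) q ->
  let Y lam := solution l q lam a b in
  exists u du (v dv : C) (B : R), [/\
    cAC l u du,
    cAC l du (fun x => ((q x)%:C - lam0) * u x - (Y lam0).1 x),
    u 0 = 0 /\ du 0 = 0, 0 <= B &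
    forall lam, n1 (lam - lam0) <= 1 -> exists r dr, [/\ n1 r <= B, n1 dr <= B,
      (Y lam).1 l = (Y lam0).1 l + (lam - lam0) * u l + (lam - lam0) ^+ 2 * v
                    + (lam - lam0) ^+ 3 * r &
      (Y lam).2 l = (Y lam0).2 l + (lam - lam0) * du l + (lam - lam0) ^+ 2 * dv
                    + (lam - lam0) ^+ 3 * dr]].
Proof.
move=> qL Y.
have pi := cintg_potential lam0 qL; set p := (fun x => (q x)%:C - lam0) in pi.
have [W [dW [A [A0 WP]]]] := inhom_operator pi.
have sY lam := solutionP lam a b qL.
have cY lam : ccont l (Y lam).1 by have [_ _ [h _]] := sY lam; exact: cAC_cont h.
have cW f : ccont l f -> ccont l (W f) by move=> /WP[h _ _ _ _]; exact: cAC_cont h.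
pose y0 := (Y lam0).1.
have [uA duA u0 du0 _] := WP y0 (cY lam0).
set K := 4 * (n1 a + n1 b) * expR (rint (fun t => 1 + n1 (p t) + 1) l).
have ir : intg l (fun t => 1 + n1 (p t)) by apply: intgD; [exact: intg_cst|exact: intg_n1].
have YK lam : n1 (lam - lam0) <= 1 -> forall x, 0 <= x <= l -> n1 ((Y lam).1 x) <= K.
  move=> near x xl; have := solution_bound lam a b qL xl => h.
  apply: le_trans (_ : n1 ((Y lam).1 x) + n1 ((Y lam).2 x) <= _).
    by rewrite lerDl n1_ge0.
  apply: le_trans h _; apply: ler_wpM2l.
    by rewrite mulr_ge0// addr_ge0 ?n1_ge0.
  rewrite ler_expR; apply: le_rint.
  - by apply: intgD; [exact: intg_cst|apply/intg_n1/cintg_potential].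
  - by apply: intgD => //; exact: intg_cst.
  - move=> t _; rewrite -addrA lerD2l.
    have -> : (q t)%:C - lam = p t - (lam - lam0) by rewrite /p; ring.
    by apply: le_trans (n1B _ _) _; rewrite lerD2l.
have K0 : 0 <= K by rewrite mulr_ge0 ?expR_ge0// mulr_ge0// addr_ge0 ?n1_ge0.
have zero (f f' : R -> C) : cAC l f f' -> cAC l f' (fun x => p x * f x) ->
    f 0 = 0 -> f' 0 = 0 -> forall x, 0 <= x <= l -> f x = 0 /\ f' x = 0.
  exact: volterra_unique.
exists (W y0), (dW y0), (W (W y0) l), (dW (W y0) l), (A * (A * (A * K))).
split; [exact: uA|exact: duA|by []|by apply: mulr_ge0 => //; apply: mulr_ge0 => //; exact: mulr_ge0|move=> lam near].
set eps := lam - lam0; set y := (Y lam).1.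
have [r1A dr1A r10 dr10 r1K] := WP y (cY lam).
have [r2A dr2A r20 dr20 r2K] := WP (W y) (cW _ (cY lam)).
have [r3A dr3A r30 dr30 r3K] := WP (W (W y)) (cW _ (cW _ (cY lam))).
have [u2A du2A u20 du20 _] := WP (W y0) (cW _ (cY lam0)).
have [ys dys [yA dyA]] := sY lam; have [y0s dy0s [y0A dy0A]] := sY lam0.
have e1 x : 0 <= x <= l -> (Y lam).1 x - y0 x - eps * W y x = 0 /\
    (Y lam).2 x - (Y lam0).2 x - eps * dW y x = 0.
  move: x; apply: (zero _ _ (cACB (cACB yA y0A) (cACZ eps l0 r1A))).
  - apply: eq_cAC (cACB (cACB dyA dy0A) (cACZ eps l0 dr1A)) => x _ //.
    by rewrite /p /eps -/y -/y0; ring.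
  - by rewrite ys y0s r10; ring.
  - by rewrite dys dy0s dr10; ring.
have e2 x : 0 <= x <= l -> W y x - W y0 x - eps * W (W y) x = 0 /\
    dW y x - dW y0 x - eps * dW (W y) x = 0.
  move: x; apply: (zero _ _ (cACB (cACB r1A uA) (cACZ eps l0 r2A))).
  - apply: eq_cAC (cACB (cACB dr1A duA) (cACZ eps l0 dr2A)) => x xl //.
    have [h _] := e1 x xl; apply/eqP; rewrite -subr_eq0; apply/eqP.
    by rewrite -[RHS]oppr0 -h /y; ring.
  - by rewrite r10 u0 r20; ring.
  - by rewrite dr10 du0 dr20; ring.
have e3 x : 0 <= x <= l -> W (W y) x - W (W y0) x - eps * W (W (W y)) x = 0 /\
    dW (W y) x - dW (W y0) x - eps * dW (W (W y)) x = 0.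
  move: x; apply: (zero _ _ (cACB (cACB r2A u2A) (cACZ eps l0 r3A))).
  - apply: eq_cAC (cACB (cACB dr2A du2A) (cACZ eps l0 dr3A)) => x xl //.
    have [h _] := e2 x xl; apply/eqP; rewrite -subr_eq0; apply/eqP.
    by rewrite -[RHS]oppr0 -h; ring.
  - by rewrite r20 u20 r30; ring.
  - by rewrite dr20 du20 dr30; ring.
have ll : 0 <= l <= l by rewrite l0 lexx.
have bd f x M : n1 (W f x) + n1 (dW f x) <= M -> n1 (W f x) <= M.
  by apply: le_trans; rewrite lerDl n1_ge0.
have k1 x : 0 <= x <= l -> n1 (W y x) <= A * K.
  by move=> xl; apply: bd; apply: r1K xl; exact: YK.
have k2 x : 0 <= x <= l -> n1 (W (W y) x) <= A * (A * K).
  by move=> xl; apply: bd; apply: r2K xl; exact: k1.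
have := r3K _ k2 l ll => k3.
exists (W (W (W y)) l), (dW (W (W y)) l); split.
- by apply: le_trans k3; rewrite lerDl n1_ge0.
- by apply: le_trans k3; rewrite lerDr n1_ge0.
- have [/eqP h1 _] := e1 l ll; have [/eqP h2 _] := e2 l ll; have [/eqP h3 _] := e3 l ll.
  move: h1 h2 h3; rewrite !subr_eq add0r => /eqP h1 /eqP h2 /eqP h3.
  by rewrite {1}/y h1 h2 h3 -/y0; ring.
- have [_ /eqP h1] := e1 l ll; have [_ /eqP h2] := e2 l ll; have [_ /eqP h3] := e3 l ll.
  move: h1 h2 h3; rewrite !subr_eq add0r => /eqP h1 /eqP h2 /eqP h3.
  by rewrite h1 h2 h3; ring.
Qed.
End EdgeEquation.

(** * Complex derivability *)

(** Locked; the topology of the field C is that of the normed space C^o. *)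
HB.lock Definition cderivable (R : realType) (f : R[i] -> R[i]) (z : R[i]) : Prop :=
  derivable (f : (R[i])^o -> (R[i])^o) z 1.

Section ComplexDerivability.
Variable R : realType.
Local Notation C := R[i].
Implicit Types (f g h : C -> C) (z w : C).

Lemma cdvE f z : cderivable f z = derivable (f : C^o -> C^o) z 1.
Proof. by rewrite unlock. Qed.

Lemma cdv_cst c z : cderivable (fun=> c) z.
Proof. rewrite cdvE; exact: derivable_cst. Qed.

Lemma cdv_id z : cderivable (fun w => w) z.
Proof. rewrite cdvE; exact: derivable_id. Qed.

Lemma cdvD f g z : cderivable f z -> cderivable g z -> cderivable (fun w => f w + g w) z.
Proof. rewrite !cdvE; exact: derivableD. Qed.

Lemma cdvM f g z : cderivable f z -> cderivable g z -> cderivable (fun w => f w * g w) z.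
Proof. rewrite !cdvE; exact: derivableM. Qed.

Lemma cdvB f g z : cderivable f z -> cderivable g z -> cderivable (fun w => f w - g w) z.
Proof. rewrite !cdvE; exact: derivableB. Qed.

Lemma cdvV f z : f z != 0 -> cderivable f z -> cderivable (fun w => (f w)^-1) z.
Proof. rewrite !cdvE; exact: derivableV. Qed.

Lemma eq_cdv f g z : f =1 g -> cderivable f z -> cderivable g z.
Proof. by move=> /funext ->. Qed.

Lemma cdv_sum (I : Type) (r : seq I) (P : pred I) (F : I -> C -> C) z :
  (forall i, cderivable (F i) z) -> cderivable (fun w => \sum_(i <- r | P i) F i w) z.
Proof.
move=> h; elim: r => [|i r IH].
  by apply: eq_cdv (cdv_cst _ z) => w; rewrite big_nil.
have [Pi|Pi] := boolP (P i).
  by apply: eq_cdv (cdvD (h i) IH) => w; rewrite big_cons Pi.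
by apply: eq_cdv IH => w; rewrite big_cons (negbTE Pi).
Qed.

Lemma cdv_prod (I : Type) (r : seq I) (P : pred I) (F : I -> C -> C) z :
  (forall i, cderivable (F i) z) -> cderivable (fun w => \prod_(i <- r | P i) F i w) z.
Proof.
move=> h; elim: r => [|i r IH].
  by apply: eq_cdv (cdv_cst _ z) => w; rewrite big_nil.
have [Pi|Pi] := boolP (P i).
  by apply: eq_cdv (cdvM (h i) IH) => w; rewrite big_cons Pi.
by apply: eq_cdv IH => w; rewrite big_cons (negbTE Pi).
Qed.

Lemma cdv_det n (M : C -> 'M[C]_n) z : (forall i j, cderivable (fun w => M w i j) z) ->
  cderivable (fun w => \det (M w)) z.
Proof.
move=> h; rewrite /determinant; apply: cdv_sum => s.
by apply: cdvM; [exact: cdv_cst|exact: cdv_prod].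
Qed.

Lemma cdv_comp f g z : cderivable g z -> cderivable f (g z) -> cderivable (fun w => f (g w)) z.
Proof.
rewrite !cdvE => /derivable1_diffP dg /derivable1_diffP df; apply/derivable1_diffP.
exact: (differentiable_comp dg df).
Qed.

Lemma cdv_continuous f z : cderivable f z -> {for z, continuous (f : C^o -> C^o)}.
Proof. by rewrite cdvE => /derivable1_diffP/differentiable_continuous. Qed.

(** h is the difference quotient of f at z0, extended analytically to z0. *)
Definition slope f z0 h := (forall z, f z = f z0 + (z - z0) * h z) /\
  (forall z, cderivable h z).

Lemma norm_n1 z : `|z| <= (n1 z)%:C.
Proof.
have nr (x : R) : `|x%:C| = `|x|%:C by rewrite normc_def/= expr0n/= addr0 sqrtr_sqr.
have ni : `|'i%C| = 1 :> C by rewrite normc_def/= expr0n/= add0r expr1n sqrtr1.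
rewrite {1}(complexE z); apply: le_trans (ler_normD _ _) _.
by rewrite normrM ni mul1r !nr /n1 rmorphD.
Qed.

Lemma n1_norm z (e : R) : `|z| <= e%:C -> n1 z <= 2 * e.
Proof.
move=> h.
have h1 := le_trans (normc_ge_Re z) h.
have h2 : `|complex.Im z|%:C <= e%:C.
  apply: le_trans h; have := normc_ge_Re (z * 'i%C); rewrite ReiNIm normrN normrM.
  by rewrite [`|'i%C|]normc_def/= expr0n/= add0r expr1n sqrtr1 mulr1.
move: h1 h2; rewrite !lecR /n1; lra.
Qed.

Lemma near_n1 z0 (P : set C) (e : R) : 0 < e ->
  (forall z, n1 (z - z0) <= e -> P z) -> \forall z \near (z0 : C^o), P z.
Proof.
move=> e0 h; apply/nbhs_normP; exists (e / 2)%:C => /=.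
  by rewrite ltcR divr_gt0.
move=> z /= zz; apply: h; rewrite -n1N opprB.
apply: le_trans (@n1_norm _ (e / 2) (ltW zz)) _.
by rewrite mulrC divfK.
Qed.

(** A first order expansion with a remainder that is quadratic near z0. *)
Lemma cdv_remainder f z0 (d1 : C) (B : R) (g : C -> C) :
  (forall z, n1 (z - z0) <= 1 -> f z = f z0 + (z - z0) * d1 + (z - z0) ^+ 2 * g z /\
    n1 (g z) <= B) ->
  is_derive (z0 : C^o) 1 (f : C^o -> C^o) d1.
Proof.
move=> h.
suff H : h^-1 *: (f (h *: 1 + z0) - f z0) @[h --> (0 : C^o)^'] --> (d1 : C^o).
  by apply: DeriveDef; [apply/cvg_ex; exists d1|apply: cvg_lim].
have B0 : 0 <= B.
  have [|_] := h z0; first by rewrite subrr n1_0.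
  by apply: le_trans; exact: n1_ge0.
apply/(@cvgrPdist_le _ C^o) => e e0.
have [e' ee' e'0] : exists2 e' : R, e = e'%:C & 0 < e'.
  exists (complex.Re e); first by rewrite RRe_real// ger0_real// ltW.
  by move: e0; rewrite ltcE/= => /andP[].
near=> t.
have t0 : t != 0 by near: t; rewrite near_withinE; exact: filterE.
have t1 : n1 t <= Num.min 1 (e' / (B + 1)).
  near: t; apply: nbhs_dnbhs; apply: (@near_n1 0 _ (Num.min 1 (e' / (B + 1)))).
    by rewrite lt_min ltr01 divr_gt0// ltr_wpDl.
  by move=> z; rewrite subr0.
move: t1; rewrite le_min => /andP[t1 t2].
have [|E gB] := h (t + z0); first by rewrite addrK.
have tE : t *: (1 : C^o) = t by exact: mulr1.
rewrite tE E addrK.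
have -> : d1 - t^-1 *: (f z0 + t * d1 + t ^+ 2 * g (t + z0) - f z0) = - (t * g (t + z0)).
  by rewrite /GRing.scale/=; field.
apply: le_trans (norm_n1 _) _; rewrite ee' lecR n1N.
apply: le_trans (n1M _ _) _.
apply: (@le_trans _ _ (e' / (B + 1) * B)); first by rewrite ler_pM ?n1_ge0.
rewrite mulrAC ler_pdivrMr ?ltr_wpDl// ler_wpM2l ?ltW//; lra.
Unshelve. all: by end_near. Qed.

(** Away from z0 the difference quotient is derivable because f is; at z0 it has the
    expansion obtained from that of f by division by z - z0. *)
Lemma slope_exists f z0 :
  (forall w, exists (d1 d2 : C) (B : R) (g : C -> C), forall z, n1 (z - w) <= 1 ->
    f z = f w + (z - w) * d1 + (z - w) ^+ 2 * d2 + (z - w) ^+ 3 * g z /\ n1 (g z) <= B) ->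
  forall (d1 d2 : C) (B : R) (g : C -> C), (forall z, n1 (z - z0) <= 1 ->
    f z = f z0 + (z - z0) * d1 + (z - z0) ^+ 2 * d2 + (z - z0) ^+ 3 * g z /\ n1 (g z) <= B) ->
  exists2 h, slope f z0 h & h z0 = d1.
Proof.
move=> all d1 d2 B g fg.
have cdv_rem (k : C -> C) w (k1 : C) (B' : R) r : (forall z, n1 (z - w) <= 1 ->
    k z = k w + (z - w) * k1 + (z - w) ^+ 2 * r z /\ n1 (r z) <= B') -> cderivable k w.
  by move=> /cdv_remainder[dk _]; rewrite cdvE.
have df w : cderivable f w.
  have [w1 [w2 [B' [k fk]]]] := all w.
  apply: (cdv_rem f w w1 (n1 w2 + B') (fun z => w2 + (z - w) * k z)).
  move=> z /[dup] zw /fk[-> kB]; split; first by ring.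
  apply: le_trans (n1D _ _) _; rewrite lerD2l; apply: le_trans (n1M _ _) _.
  by apply: le_trans kB; rewrite ler_piMl ?n1_ge0.
exists (fun z => if z == z0 then d1 else (f z - f z0) / (z - z0)); last by rewrite eqxx.
split=> z.
  case: eqVneq => [->|zz0]; first by rewrite subrr mul0r addr0.
  by rewrite mulrC divfK ?subr_eq0//; ring.
have [->|zz0] := eqVneq z z0.
  apply: (cdv_rem _ z0 d2 B g).
  move=> w ww; rewrite eqxx; have [E gB] := fg w ww; split => //.
  case: eqVneq => [->|wz0]; first by rewrite subrr expr0n/= !mul0r !addr0.
  rewrite E; have : w - z0 != 0 by rewrite subr_eq0.
  by move=> ?; field.
have e0 : 0 < complex.Re `|z - z0|.
  by rewrite -ltcR RRe_real ?normr_real// normr_gt0 subr_eq0.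
have e1 : `|z - z0| = (complex.Re `|z - z0|)%:C by rewrite RRe_real// normr_real.
have h : cderivable (fun w => (f w - f z0) / (w - z0)) z.
  apply: cdvM; first by apply: cdvB => //; exact: cdv_cst.
  apply: cdvV; first by rewrite subr_eq0.
  by apply: cdvB; [exact: cdv_id|exact: cdv_cst].
rewrite cdvE in h; rewrite cdvE; apply: (near_eq_derivable _ h).
apply: (@near_n1 z _ (complex.Re `|z - z0| / 2)); first by rewrite divr_gt0.
move=> w wz; case: eqVneq => [wE|//].
have := norm_n1 (w - z); rewrite wE distrC e1 lecR; rewrite wE in wz.
by move=> h2; exfalso; lra.
Qed.
End ComplexDerivability.

(** * The order of a zero of an analytic determinant *)
Section DeterminantOrder.
Variable R : realType.
Local Notation C := R[i].

Lemma unitmx_colP (F : fieldType) n (A : 'M[F]_n) :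
  (forall v : 'cV_n, A *m v = 0 -> v = 0) -> A \in unitmx.
Proof.
move=> h; rewrite unitmxE unitfE -det_tr; apply/negP => /det0P[v v0 vA].
move/negP: v0; apply; apply/eqP; apply: trmx_inj; rewrite trmx0; apply: h.
by rewrite -[A]trmxK -trmx_mul vA trmx0.
Qed.

(** Write M z0 = L * pid_mx r * U with L and U invertible. In these bases the last
    n - r rows of M z are divisible by z - z0; taking the factors out leaves a
    matrix Q z, and det (Q z0) is nonzero exactly if there is no Jordan chain v, u of
    length two. *)
Lemma det_order_corank n (M H : C -> 'M[C]_n) (z0 : C) :
  (forall z, M z = M z0 + (z - z0) *: H z) ->
  (forall i j z, cderivable (fun w => H w i j) z) ->
  (forall u v : 'cV_n, M z0 *m v = 0 -> M z0 *m u + H z0 *m v = 0 -> v = 0) ->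
  zero_order (fun z => \det (M z)) z0 (n - \rank (M z0)).
Proof.
move=> MH dH nondeg.
have [L [U [Lu Uu]]] : exists L U : 'M[C]_n, [/\ L \in unitmx, U \in unitmx &
    M z0 = L *m pid_mx (\rank (M z0)) *m U].
  exists (col_ebase (M z0)), (row_ebase (M z0)).
  by rewrite col_ebase_unit row_ebase_unit mulmx_ebase.
have rn : (\rank (M z0) <= n)%N by exact: rank_leq_row.
move: (\rank (M z0)) rn => r rn AE.
pose K z := invmx L *m H z *m invmx U.
have HE z : H z = L *m K z *m U.
  by rewrite /K !mulmxA mulmxV// mul1mx mulmxKV.
pose Q z := \matrix_(i, j) if (i < r)%N then (pid_mx r + (z - z0) *: K z) i j else K z i j.
have ME z : M z = L *m (diag_mx (\row_i if (i < r)%N then 1 else z - z0) *m Q z) *m U.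
  rewrite MH AE HE (_ : _ + _ = L *m (pid_mx r + (z - z0) *: K z) *m U); last first.
    by rewrite mulmxDr mulmxDl -scalemxAr -scalemxAl.
  congr (_ *m _ *m _).
  apply/matrixP => i j; rewrite mul_diag_mx !mxE.
  case: ifPn => ir; first by rewrite mul1r.
  by rewrite ?(negbTE ir) andbF add0r.
exists (fun z => \det L * \det U * \det (Q z)).
  apply: mulf_neq0; first by apply: mulf_neq0; rewrite -unitfE -unitmxE.
  rewrite -unitfE -unitmxE; apply: unitmx_colP => x Qx.
  have pidx : pid_mx r *m x = 0 :> 'cV_n.
    apply/matrixP => i j; move/matrixP/(_ i j): Qx; rewrite !mxE.
    case: (ltnP i r) => ir.
      by move=> Q0; rewrite -[RHS]Q0; apply: eq_bigr => k _; rewrite !mxE ir subrr mul0r addr0.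
    by move=> _; apply: big1 => k _; rewrite !mxE ltnNge ir andbF mul0r.
  have Kx : pid_mx r *m (- (K z0 *m x)) + K z0 *m x = 0.
    apply/matrixP => i j; rewrite [LHS]mxE.
    case: (ltnP i r) => ir.
      rewrite [X in X + _]mxE (bigD1 i)//= big1 => [|k ki].
        by rewrite addr0 !mxE eqxx ir mul1r addNr.
      by rewrite mxE eq_sym (negbTE ki : (k == i :> nat) = false) mul0r.
    rewrite [X in X + _]mxE big1 ?add0r => [|k _].
      move/matrixP/(_ i j): Qx; rewrite !mxE => Q0; rewrite -[RHS]Q0.
      by apply: eq_bigr => k _; rewrite !mxE ltnNge ir.
    by rewrite mxE ltnNge ir andbF mul0r.
  have v0 : invmx U *m x = 0.
    apply: (nondeg (invmx U *m (- (K z0 *m x)))).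
      by rewrite AE -!mulmxA (mulKVmx Uu) pidx mulmx0.
    rewrite AE HE -!mulmxA !(mulKVmx Uu) -mulmxDr.
    by rewrite !mulmxA in Kx *; rewrite Kx mulmx0.
  by rewrite -(mulKVmx Uu x) v0 mulmx0.
apply: (@filterE _ (nbhs (z0 : C^o))) => w; split; last first.
  rewrite ME !det_mulmx det_diag.
  rewrite (_ : \prod_i _ = (w - z0) ^+ (n - r)); first by ring.
  under eq_bigr do rewrite mxE.
  rewrite -(big_mkord xpredT (fun i => if (i < r)%N then 1 else w - z0)).
  rewrite (@big_cat_nat _ _ _ r)//= big_nat_cond big1 => [|i]; last first.
    by rewrite andbT => /andP[_ ->].
  rewrite mul1r (eq_big_nat _ _ (F2 := fun=> w - z0)) => [|i /andP[ri _]].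
    by rewrite prodr_const_nat.
  by rewrite ltnNge ri.
suff : cderivable (fun z => \det L * \det U * \det (Q z)) w by rewrite cdvE.
apply: cdvM; first exact: cdv_cst.
apply: cdv_det => i j.
have dK : cderivable (fun z => K z i j) w.
  apply: (@eq_cdv _ (fun z => \sum_k (\sum_m invmx L i m * H z m k) * invmx U k j)).
    move=> z; rewrite /K mxE; apply: eq_bigr => k _; by rewrite mxE.
  apply: cdv_sum => k; apply: cdvM; last exact: cdv_cst.
  by apply: cdv_sum => m; apply: cdvM => //; exact: cdv_cst.
have [ir|ir] := ltnP i r; last first.
  by apply: eq_cdv dK => z; rewrite [RHS]mxE ltnNge ir.
apply: (@eq_cdv _ (fun z => (pid_mx r : 'M[C]_n) i j + (z - z0) * K z i j)).
  by move=> z; rewrite [RHS]mxE ir !mxE.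
apply: cdvD; first exact: cdv_cst.
apply: cdvM => //; apply: cdvB; [exact: cdv_id|exact: cdv_cst].
Qed.
End DeterminantOrder.

(** * The directed edges of a rooted tree *)
Section TreeCombinatorics.
Variables (g : nat) (T : rooted_tree g).
Local Notation V := (vert T).
Local Notation src := (@src g T).
Local Notation tgt := (@tgt g T).
Local Notation root := (Defs.root T).

Lemma tgt_neq_root j : tgt j != root.
Proof.
have [p [_ _]] := @away_from_root g T j.
by rewrite inE negb_or => /andP[].
Qed.

Definition del_edge (u v : V) : rel V := fun a b =>
  adj a b && (((a, b) != (u, v)) && ((a, b) != (v, u))).

Lemma path_avoid (u v x : V) p : path (@adj g T) x p -> v \notin x :: p ->
  path (del_edge u v) x p.
Proof.
elim: p x => [//|y p IH] x /= /andP[xy yp].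
rewrite inE negb_or => /andP[vx vyp]; rewrite IH// andbT /del_edge xy/=.
move: vyp; rewrite inE negb_or => /andP[vy _].
by rewrite !xpair_eqE (eq_sym y) (negbTE vy) andbF eq_sym (negbTE vx).
Qed.

(** The last edge of a simple path from the root to v enters v: if it were directed
    away from v, then the path that reaches v and avoids its other end, together with the
    simple path, would close a cycle. *)
Lemma non_root_is_tgt (v : V) : v != root -> exists j, tgt j = v.
Proof.
move=> vr; have /connectP[p0 + vE0] := @adj_connected g T root v.
have : last root p0 = v by [].
move=> {vE0} vE0 pp0.
case/shortenP: pp0 vE0 => p pp up _ vE.
case: (lastP p) pp up vE => [_ _ /= /eqP|{}p w]; first by rewrite eq_sym (negbTE vr).
rewrite last_rcons rcons_path -rcons_cons rcons_uniq => /andP[pp uw] /andP[wp _] wv.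
rewrite {}wv {w} in uw wp *; set u := last root p in uw.
have [j [[[ju jv]|[jv ju]] _]] := @edge_unique g T _ _ uw; first by exists j.
exfalso.
have [p' [pp' lp' vp']] := @away_from_root g T j.
rewrite jv in lp'; rewrite ju in vp'.
(* Without the edge from u to v both ends are still connected to the root. *)
pose e := del_edge u v.
have esym : connect_sym e.
  apply: sym_connect_sym => a b; rewrite /e /del_edge adj_sym; congr (_ && _).
  by rewrite andbC !xpair_eqE (andbC (b == v)) (andbC (b == u)).
have c1 : connect e root u by apply/connectP; exists p => //; exact: path_avoid.
have c2 : connect e root v.
  apply/connectP; exists p' => //; have := @path_avoid v u root p' pp' vp'.
  by apply: sub_path => a b /and3P[/= ab h1 h2]; rewrite /e /del_edge ab h1 h2.
have : connect e v u by apply: connect_trans c1; rewrite esym.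
case/connectP => r0 + uE; have {uE} uE : last v r0 = u by [].
move=> pr0; case/shortenP: pr0 uE => r pr ur _ uE.
have vu : v != u.
  apply/negP => /eqP vu; move: uw; rewrite -vu.
  by have /= -> := @adj_irrefl g T v.
case: r pr ur uE => [_ _ /= /eqP|w r]; first by rewrite (negbTE vu).
case: r => [/= /andP[/and3P[_ h1 h2] _] _ wu|w2 r pr ur uE].
  by move: h2; rewrite wu eqxx.
suff /(@adj_acyclic g T) : ucycle (@adj g T) (v :: w :: w2 :: r) by [].
apply/andP; split => //.
rewrite /path.cycle rcons_path; apply/andP; split; last by rewrite uE.
by apply: sub_path pr => a b /andP[].
Qed.

(** There are as many edges as vertices other than the root, and all of these are
    final vertices. *)
Lemma tgt_inj : injective tgt.
Proof.
have im : [set tgt j | j : 'I_g]%SET = [set~ root]%SET.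
  apply/setP => v; rewrite !inE; apply/imsetP/idP => [[j _ ->]|/non_root_is_tgt[j <-]].
    exact: tgt_neq_root.
  by exists j.
have : #|[set tgt j | j : 'I_g]%SET| = #|'I_g|.
  by rewrite im cardsC1 card_vert card_ord.
by move/eqP/imset_injP => h x y; apply: h.
Qed.

Lemma sum_tgt_src (R : pzSemiRingType) k :
  \sum_(j < g) ((tgt j == src k)%:R : R) = (src k != root)%:R.
Proof.
have [->|kr] := eqVneq (src k) root.
  by rewrite big1// => j _; rewrite (negbTE (tgt_neq_root j)).
have [j jk] := non_root_is_tgt kr; rewrite (bigD1 j)//= jk eqxx big1 ?addr0//.
by move=> i ij; case: eqP => // ik; move/eqP: ij; case; apply: tgt_inj; rewrite jk.
Qed.

Lemma src_root_lt (k : 'I_g) : (src k == root) = (k < root_degree T)%N.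
Proof. exact: root_edges_first. Qed.

Lemma root_degree_gt0 : (0 < g)%N -> (0 < root_degree T)%N.
Proof.
move=> g0; rewrite /root_degree card_gt0; apply/set0Pn.
have [p [pp lp tp]] := @away_from_root g T (Ordinal g0).
case: p pp lp tp => [_ /= sr _|w p /= /andP[rw _] _ _]; last by exists w; rewrite inE.
exists (tgt (Ordinal g0)); rewrite inE sr; exact: adj_edge.
Qed.

Lemma root_degree_le : (root_degree T <= g)%N.
Proof.
have e : #|[set~ root]%SET| = g by rewrite cardsC1 card_vert.
rewrite -[X in (_ <= X)%N]e.
apply: fintype.subset_leq_card; apply/fintype.subsetP => v; rewrite !inE => rv.
by apply: contraTneq rv => ->; rewrite (@adj_irrefl g T).
Qed.

(** Boundary terms of Green's formula: every vertex other than the root has one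
    incoming edge, whose term cancels those of the outgoing edges by continuity and
    Kirchhoff's condition. *)
Lemma tree_sum (R : comPzRingType) (ya yl dz0 dzl : 'I_g -> R) :
  (forall j k, src k = tgt j -> yl j = ya k) ->
  (forall j, dzl j = \sum_(k < g | src k == tgt j) dz0 k) ->
  \sum_j (dzl j * yl j - dz0 j * ya j) =
    - \sum_(k < g | src k == root) dz0 k * ya k.
Proof.
move=> cont kirch; rewrite sumrB.
have -> : \sum_j dzl j * yl j = \sum_(k < g | src k != root) dz0 k * ya k.
  transitivity (\sum_j \sum_k ((tgt j == src k)%:R * (dz0 k * ya k))).
    apply: eq_bigr => j _; rewrite kirch mulr_suml big_mkcond; apply: eq_bigr => k _.
    rewrite eq_sym; case: eqP => [jk|_]; last by rewrite mul0r.
    by rewrite mul1r (cont j k).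
  rewrite exchange_big [RHS]big_mkcond; apply: eq_bigr => k _.
  by rewrite -mulr_suml sum_tgt_src; case: eqP; rewrite ?mul1r ?mul0r.
rewrite [X in _ - X](bigID (fun k => src k == root))/=; ring.
Qed.
End TreeCombinatorics.

(** * The matrix of the vertex conditions *)
Section VertexMatrix.
Variables (R : realType) (g : nat) (hg : (0 < g)%N) (T : rooted_tree g) (l : R)
  (q : 'I_g -> R -> R).
Local Notation C := R[i].
Local Notation src := (@src g T).
Local Notation tgt := (@tgt g T).
Local Notation root := (Defs.root T).
Local Notation d := (root_degree T).
Implicit Types (lam al be : C).

(** The rows a_0 - a_k for 0 < k < d, followed by the row
    be * (b_0 + ... + b_(d-1)) + al * a_0. *)
Definition root_A al : 'M[C]_g := \matrix_(k, j) if (k.+1 < d)%N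
  then (j == 0%N :> nat)%:R - (j == k.+1 :> nat)%:R else al * (j == 0%N :> nat)%:R.
Definition root_B be : 'M[C]_g := \matrix_(k, j) if (k.+1 < d)%N
  then 0 else be * (j < d)%N%:R.
Definition robin_mx be al lam := vertex_matrix T l q (root_A al) (root_B be) lam.

Lemma last_root_subproof : (d.-1 < g)%N.
Proof. by rewrite prednK ?root_degree_gt0// root_degree_le. Qed.
Definition last_root : 'I_g := Ordinal last_root_subproof.

(** The parameters be and al occur in one row only. *)
Lemma robin_mx_other_row be al be' al' lam x y : x != lshift g last_root ->
  robin_mx be al lam x y = robin_mx be' al' lam x y.
Proof.
have E k : k != last_root -> src k == root -> (k.+1 < d)%N.
  move=> kn; rewrite src_root_lt => kd; rewrite ltn_neqAle kd andbT.
  apply: contra kn => /eqP kE; apply/eqP/val_inj; by rewrite /= -kE.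
rewrite /robin_mx /vertex_matrix; case: (split_ordP x) => k -> kn.
  have {}kn : k != last_root by apply: contra kn => /eqP ->.
  case: (split_ordP y) => j ->; rewrite ?(block_mxEul, block_mxEur) !mxE.
    by case: ifP => // /(E _ kn) ->.
  by case: ifP => // /(E _ kn) ->.
by case: (split_ordP y) => j ->; rewrite ?(block_mxEdl, block_mxEdr).
Qed.

Lemma last_rootE : (last_root.+1 < d)%N = false /\ src last_root == root.
Proof.
split; first by rewrite /= prednK ?root_degree_gt0// ltnn.
by rewrite src_root_lt /= prednK ?root_degree_gt0.
Qed.

Lemma robin_mx_last_row be al lam y : robin_mx be al lam (lshift g last_root) y =
  be * robin_mx 1 0 lam (lshift g last_root) y + al * robin_mx 0 1 lam (lshift g last_root) y.
Proof.
have [h1 h2] := last_rootE.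
rewrite /robin_mx /vertex_matrix; case: (split_ordP y) => j ->;
  rewrite ?(block_mxEul, block_mxEur) !mxE h1 h2; ring.
Qed.

Lemma det_robin_mx al lam :
  \det (robin_mx 1 al lam) = \det (robin_mx 1 0 lam) + al * \det (robin_mx 0 1 lam).
Proof.
rewrite -[X in X + _]mul1r.
apply: (determinant_multilinear (i0 := lshift g last_root)).
- move: (robin_mx_last_row 1 al lam); move: (robin_mx 1 al lam) (robin_mx 1 0 lam) (robin_mx 0 1 lam) => A B D H.
  by apply/rowP => y; rewrite !mxE; exact: H.
- move: (robin_mx_other_row 1 0 1 al lam); move: (robin_mx 1 al lam) (robin_mx 1 0 lam) => A B H.
  by apply/matrixP => x y; rewrite !mxE; apply: H; rewrite eq_sym neq_lift.
- move: (robin_mx_other_row 0 1 1 al lam); move: (robin_mx 1 al lam) (robin_mx 0 1 lam) => A B H.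
  by apply/matrixP => x y; rewrite !mxE; apply: H; rewrite eq_sym neq_lift.
Qed.

(** Partial sums over the first d indices. The product with [diff_mx] telescopes
    to the rows a_0 - a_(k+1). *)
Definition cum_mx : 'M[C]_g :=
  \matrix_(k, j) if (k < d)%N then (j <= k)%N%:R else (j == k)%:R.
Definition diff_mx : 'M[C]_g :=
  \matrix_(k, j) ((j == k)%:R - if (k.+1 < d)%N then (j == k.+1 :> nat)%:R else 0).

Lemma det_cum_mx : \det cum_mx = 1.
Proof.
rewrite det_trig.
  by rewrite big1// => i _; rewrite mxE leqnn eqxx; case: ifP.
apply/is_trig_mxP => i j ij; rewrite mxE [(j <= i)%N]leqNgt ij/= -val_eqE /= gtn_eqF//.
by case: ifP.
Qed.

Lemma det_diff_mx : \det diff_mx = 1.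
Proof.
rewrite -det_tr det_trig.
  rewrite big1// => i _; rewrite !mxE eqxx (_ : _ == _ = false) ?if_same ?subr0//.
  by rewrite ltn_eqF.
apply/is_trig_mxP => i j ij; rewrite !mxE -val_eqE /= (ltn_eqF ij) sub0r.
by rewrite (ltn_eqF (ltnW _ : (i < j.+1)%N)) ?if_same ?oppr0// ltnS ltnW.
Qed.

Lemma cum_diff_mx k j : (cum_mx *m diff_mx) k j = if (k < d)%N then
  if (k.+1 < d)%N then (j == 0%N :> nat)%:R - (j == k.+1 :> nat)%:R
  else (j == 0%N :> nat)%:R else (j == k)%:R.
Proof.
rewrite mxE; have [kd|kd] := ltnP k d; last first.
  rewrite (bigD1 k)//= big1 => [|i ik]; last by rewrite !mxE ltnNge kd/= (negbTE ik) mul0r.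
  by rewrite !mxE ltnNge kd eqxx mul1r ltnNge (leqW kd) subr0 addr0.
pose f m : C := - (j == m :> nat)%:R.
transitivity (\sum_(0 <= m < k.+1) if (m.+1 < d)%N then f m.+1 - f m else - f m).
  rewrite [RHS](@big_nat_widen _ _ _ 0 k.+1 g)// big_mkord [RHS]big_mkcond.
  apply: eq_bigr => m _; rewrite !mxE kd ltnS.
  case: (leqP m k) => mk /=; last by rewrite mul0r.
  by rewrite mul1r /f -val_eqE/= opprK; case: ifP => _; [ring|rewrite subr0].
rewrite big_nat_recr//=.
rewrite (eq_big_nat _ _ (F2 := fun m => f m.+1 - f m)) => [|m /andP[_ mk]]; last first.
  by rewrite (leq_trans _ kd)// ltnS.
rewrite telescope_sumr//; case: ifP => _; rewrite /f; ring.
Qed.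

(** The rows a_0 - a_1, ..., a_0 - a_(d-1), a_0 are obtained from
    a_0, ..., a_(d-1) by a matrix of determinant 1, namely the product of the two
    unitriangular matrices [cum_mx] and [diff_mx]. *)
Lemma det_robin_mx_dirichlet lam : \det (robin_mx 0 1 lam) =
  \det (vertex_matrix T l q (dirichlet_rootA R g) (dirichlet_rootB R g) lam).
Proof.
have -> : robin_mx 0 1 lam = block_mx (cum_mx *m diff_mx) 0 0 1%:M *m
    vertex_matrix T l q (dirichlet_rootA R g) (dirichlet_rootB R g) lam.
  rewrite /robin_mx /vertex_matrix mulmx_block !mul0mx !mul1mx !addr0 !add0r.
  have top (X Y : 'M[C]_g) : (forall k j : 'I_g, (k < d)%N ->
      Y k j = if (k.+1 < d)%N then \sum_(i < g) ((i == 0%N :> nat)%:R - (i == k.+1 :> nat)%:R) * X i j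
              else \sum_(i < g) (i == 0%N :> nat)%:R * X i j) ->
      (forall k j : 'I_g, (d <= k)%N -> Y k j = X k j) -> Y = cum_mx *m diff_mx *m X.
    move=> h1 h2; apply/matrixP => k j; rewrite mxE.
    under eq_bigr do rewrite cum_diff_mx.
    have [kd|kd] := ltnP k d; first by rewrite h1//; case: ifP.
    rewrite h2// (bigD1 k)//= eqxx mul1r big1 ?addr0// => i /negbTE ->.
    by rewrite mul0r.
  have pick (m : 'I_g) (F : 'I_g -> C) : \sum_(i < g) (i == m :> nat)%:R * F i = F m.
    rewrite (bigD1 m)//= eqxx mul1r big1 ?addr0// => i im.
    by rewrite (_ : _ == _ = false) ?mul0r//; exact: negbTE.
  have pickd (m m' : 'I_g) (F : 'I_g -> C) :
      \sum_(i < g) ((i == m :> nat)%:R - (i == m' :> nat)%:R) * F i = F m - F m'.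
    by under eq_bigr do rewrite mulrBl; rewrite sumrB !pick.
  have d0 := root_degree_gt0 T hg; have dg := root_degree_le T.
  congr block_mx; apply: top => k j kd.
  - case: ifPn => kd1; last first.
      rewrite (pick (Ordinal hg)) !mxE !src_root_lt kd (negbTE kd1)/= d0 mul1r.
      by rewrite -val_eqE/= eq_sym.
    have k1g : (k.+1 < g)%N by exact: leq_trans dg.
    rewrite (pickd (Ordinal hg) (Ordinal k1g)) !mxE !src_root_lt kd kd1/= d0.
    by rewrite -!val_eqE/= ![(_ == j :> nat)]eq_sym.
  - by rewrite !mxE src_root_lt ltnNge kd.
  - case: ifPn => kd1; last first.
      by rewrite (pick (Ordinal hg)) !mxE !src_root_lt kd (negbTE kd1)/= d0 mul0r.
    have k1g : (k.+1 < g)%N by exact: leq_trans dg.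
    by rewrite (pickd (Ordinal hg) (Ordinal k1g)) !mxE !src_root_lt kd kd1/= d0 subr0.
  - by rewrite !mxE src_root_lt ltnNge kd.
by rewrite det_mulmx det_ublock det1 mulr1 det_mulmx det_cum_mx det_diff_mx !mul1r.
Qed.

(** What is left of the vertex conditions when y_j has values a_j, yl_j and
    derivatives b_j, dyl_j at the two ends of edge j, the last root condition being
    be * (b_0 + ... + b_(d-1)) + r = 0. Values and derivatives at l are kept apart from the
    solutions, because in a Jordan chain they do not come from a solution. *)
Definition residual be (r : C) (a yl b dyl : 'I_g -> C) : 'cV[C]_(g + g) :=
  col_mx (\col_k if src k == root then
            if (k.+1 < d)%N then
              \sum_(j < g) ((j == 0%N :> nat)%:R - (j == k.+1 :> nat)%:R) * a j
            else be * \sum_(j < g | src j == root) b j + r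
          else \sum_j (tgt j == src k)%:R * yl j - a k)
         (\col_i (dyl i - \sum_(k < g | src k == tgt i) b k)).

Definition root_ord : 'I_g := Ordinal hg.

Lemma robin_mx_mul be al lam (a b : 'I_g -> C) :
  robin_mx be al lam *m col_mx (\col_j a j) (\col_j b j) =
  residual be (al * a root_ord) a
    (fun j => a j * cos_sol l (q j) lam l + b j * sin_sol l (q j) lam l) b
    (fun j => a j * cos_sol' l (q j) lam l + b j * sin_sol' l (q j) lam l).
Proof.
rewrite /robin_mx /vertex_matrix /residual mul_block_col; congr col_mx.
  apply/matrixP => k j0; rewrite !mxE.
  have [sk|sk] := boolP (src k == root).
    case: ifPn => kd.
      rewrite [X in _ + X]big1 ?addr0 => [|j _]; last by rewrite !mxE sk kd mul0r.
      by apply: eq_bigr => j _; rewrite !mxE sk kd.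
    rewrite addrC; congr (_ + _).
      rewrite mulr_sumr [RHS]big_mkcond; apply: eq_bigr => j _.
      by rewrite !mxE sk (negbTE kd) src_root_lt; case: ifP; rewrite ?mulr1// mulr0 mul0r.
    rewrite (bigD1 root_ord)//= !mxE sk (negbTE kd)/= mulr1 big1 ?addr0// => j jr.
    rewrite !mxE sk (negbTE kd) (_ : _ == _ = false) ?mulr0 ?mul0r//.
    by apply: contraNF jr => /eqP j0'; apply/eqP/val_inj.
  rewrite -big_split/= [in RHS](_ : a k = \sum_j (j == k)%:R * a j); last first.
    rewrite (bigD1 k)//= eqxx mul1r big1 ?addr0// => j /negbTE ->.
    by rewrite mul0r.
  rewrite -sumrB; apply: eq_bigr => j _; rewrite !mxE (negbTE sk); ring.
apply/matrixP => i j0; rewrite !mxE -big_split/=.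
have -> : a i * cos_sol' l (q i) lam l + b i * sin_sol' l (q i) lam l =
    \sum_j (j == i)%:R * (a j * cos_sol' l (q j) lam l + b j * sin_sol' l (q j) lam l).
  by rewrite (bigD1 i)//= eqxx mul1r big1 ?addr0// => j /negbTE ->; rewrite mul0r.
rewrite [X in _ - X]big_mkcond -sumrB; apply: eq_bigr => j _; rewrite !mxE.
by case: (src j == tgt i) => /=; ring.
Qed.

(** The first d - 1 root rows say that all values at the root equal a_0. In a row
    of a vertex that is not the root, the sum has one term, since the entering edge is
    unique. *)
Lemma residual0P be r a yl b dyl : residual be r a yl b dyl = 0 <->
  [/\ forall j k, src k = tgt j -> yl j = a k,
      forall j, dyl j = \sum_(k < g | src k == tgt j) b k,
      forall k, src k = root -> a k = a root_ord &
      be * \sum_(j < g | src j == root) b j + r = 0].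
Proof.
have d0 := root_degree_gt0 T hg; have dg := root_degree_le T.
have pickd (m m' : 'I_g) (F : 'I_g -> C) :
    \sum_(i < g) ((i == m :> nat)%:R - (i == m' :> nat)%:R) * F i = F m - F m'.
  have pick (n : 'I_g) : \sum_(i < g) (i == n :> nat)%:R * F i = F n.
    rewrite (bigD1 n)//= eqxx mul1r big1 ?addr0// => i im.
    by rewrite (_ : _ == _ = false) ?mul0r//; exact: negbTE.
  by under eq_bigr do rewrite mulrBl; rewrite sumrB !pick.
have sumt k : \sum_j (tgt j == src k)%:R * yl j =
    \sum_(j < g | tgt j == src k) yl j.
  by rewrite [RHS]big_mkcond; apply: eq_bigr => j _; case: ifP; rewrite ?mul1r ?mul0r.
have sumt1 j k : src k = tgt j -> \sum_(i < g | tgt i == src k) yl i = yl j.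
  move=> skj; rewrite (big_pred1 j)// => i /=; rewrite skj.
  by apply/eqP/eqP => [/tgt_inj|->].
have z : 0 = col_mx 0 0 :> 'cV[C]_(g + g) by rewrite col_mx0.
rewrite /residual z; split.
  move=> /eq_col_mx[/colP h1 /colP h2]; split.
  - move=> j k skj; move: (h1 k); rewrite !mxE skj (negbTE (tgt_neq_root T j)).
    by rewrite -skj sumt (sumt1 j)// => /eqP; rewrite subr_eq0 => /eqP.
  - by move=> j; move: (h2 j); rewrite !mxE => /eqP; rewrite subr_eq0 => /eqP.
  - move=> k /eqP; rewrite src_root_lt => kd.
    case: (posnP k) => [k0|k0]; first by congr a; apply: val_inj.
    have km : (k.-1 < g)%N by exact: leq_ltn_trans (leq_pred _) (ltn_ord k).
    move: (h1 (Ordinal km)); rewrite !mxE src_root_lt /= prednK// kd.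
    rewrite (ltnW kd) (pickd root_ord k).
    by move=> /eqP; rewrite subr_eq0 => /eqP ->.
  - by move: (h1 last_root); have [e1 e2] := last_rootE; rewrite !mxE e1 e2.
move=> [h1 h2 h3 h4]; congr col_mx; apply/colP => k; rewrite !mxE.
  have [sk|sk] := boolP (src k == root); last first.
    have [j jk] := non_root_is_tgt sk.
    by rewrite sumt (sumt1 j)// (h1 j k)// subrr.
  case: ifP => kd //; have k1g : (k.+1 < g)%N by exact: leq_trans dg.
  rewrite (pickd root_ord (Ordinal k1g)) (h3 (Ordinal k1g)) ?subrr//.
  by apply/eqP; rewrite src_root_lt.
by rewrite h2 subrr.
Qed.

Variable s : 'S_(g + g).

Lemma phi_DE lam : phi_D T l q s lam = (-1) ^+ s * \det (robin_mx 0 1 lam).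
Proof. by rewrite /phi_D /Phi_D row_permE det_mulmx det_perm det_robin_mx_dirichlet. Qed.

Lemma phi_NE lam : phi_N T l q s lam = (-1) ^+ s * \det (robin_mx 1 0 lam).
Proof.
rewrite /phi_N /Phi_N row_permE det_mulmx det_perm /robin_mx.
have -> : root_A 0 = standard_rootA R T.
  by apply/matrixP => k j; rewrite !mxE; case: ifP; rewrite ?mul0r.
have -> // : root_B 1 = standard_rootB R T.
by apply/matrixP => k j; rewrite !mxE; case: ifP; rewrite ?mul1r.
Qed.

Lemma jostE (z : C) : jost T l q s z = (-1) ^+ s * \det (robin_mx 1 ((0 +i* 1) * z) (z ^+ 2)).
Proof.
rewrite /jost phi_NE phi_DE (det_robin_mx (_ * z)) [RHS]mulrDr; congr (_ + _); exact: mulrCA.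
Qed.

End VertexMatrix.

(** * Energy identities on the tree *)
Section TreeEquation.
Variables (R : realType) (g : nat) (hg : (0 < g)%N) (T : rooted_tree g) (l : R)
  (hl : 0 < l) (q : 'I_g -> R -> R) (hq : forall j, L2 (edge l) (q j)).
Local Notation C := R[i].
Local Notation src := (@src g T).
Local Notation tgt := (@tgt g T).
Local Notation root := (Defs.root T).
Local Notation Re := complex.Re.
Local Notation Im := complex.Im.
Local Notation robin_mx := (robin_mx T l q).
Local Notation root_ord := (root_ord hg).
Implicit Types (lam al be : C) (a b : 'I_g -> C).

Let l0 : 0 <= l := ltW hl.

Definition ysol lam a b j x :=
  a j * cos_sol l (q j) lam x + b j * sin_sol l (q j) lam x.
Definition dysol lam a b j x :=
  a j * cos_sol' l (q j) lam x + b j * sin_sol' l (q j) lam x.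

Lemma ysolP lam a b j : [/\ sol l (q j) lam (ysol lam a b j) (dysol lam a b j),
  ysol lam a b j 0 = a j & dysol lam a b j 0 = b j].
Proof.
have [c0 dc0 cs] := solutionP l0 lam 1 0 (hq j).
have [s0 ds0 ss] := solutionP l0 lam 0 1 (hq j).
split; first exact: (sol_lin l0 (a j) (b j) cs ss).
- by rewrite /ysol /cos_sol /sin_sol c0 s0; ring.
- by rewrite /dysol /cos_sol' /sin_sol' dc0 ds0; ring.
Qed.

Definition tree_sqnorm (y : 'I_g -> R -> C) := \sum_j sqnorm l (y j).
Definition tree_form (y dy : 'I_g -> R -> C) := \sum_j edge_form l (q j) (y j) (dy j).

Lemma tree_sqnorm_ge0 y : 0 <= tree_sqnorm y.
Proof. by apply: sumr_ge0 => j _; exact: sqnorm_ge0. Qed.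

(** If y vanishes on the edge then so does y'' in the integrated equation, hence y'
    is constant, and its integral y(l) - y(0) is 0. *)
Lemma tree_sqnorm_eq0 lam y dy : (forall j, sol l (q j) lam (y j) (dy j)) -> tree_sqnorm y = 0 ->
  forall j, y j 0 = 0 /\ dy j 0 = 0.
Proof.
move=> ys n0 j; have [yA dyA] := ys j.
have y0 x : 0 <= x <= l -> y j x = 0.
  apply: (sqnorm_eq0 hl (cAC_cont l0 yA)).
  move/eqP: n0; rewrite psumr_eq0; last by move=> i _; exact: sqnorm_ge0.
  by move=> /allP/(_ j)/=; rewrite mem_index_enum => /(_ isT)/eqP.
split; first by rewrite y0 ?lexx.
have dyc x : 0 <= x <= l -> dy j x = dy j 0.
  move=> xl; rewrite (cAC_eq dyA xl) (@eq_cI _ _ _ (fun=> 0)).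
    by rewrite cI_const0 ?addr0//; case/andP: xl.
  move=> t /andP[t0 tx]; rewrite y0 ?mulr0// t0 (le_trans tx)//.
  by case/andP: xl.
have ll : 0 <= l <= l by rewrite l0 lexx.
have := cAC_eq yA ll; rewrite (y0 l)// (y0 0) ?lexx// add0r => /esym.
rewrite (@eq_cI _ _ _ (fun x => dy j 0 * 1)); last by move=> x xl; rewrite mulr1 dyc.
rewrite (cI_Z l0); last exact: cintg_cst.
have -> : cI (fun=> 1) l = l%:C :> C.
  by apply: complexP; rewrite /= rint_cst// ?mul1r ?mul0r.
by move=> /eqP; rewrite mulf_eq0 => /orP[/eqP//|/eqP[] l00]; move: hl; rewrite l00 ltxx.
Qed.

Lemma tree_form_ge : exists2 c : R, 0 <= c & forall lam y dy,
  (forall j, sol l (q j) lam (y j) (dy j)) -> - c * tree_sqnorm y <= tree_form y dy.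
Proof.
have H j : {c : R | 0 <= c & forall y dy, cAC l y dy -> ccont l dy ->
    - c * sqnorm l y <= edge_form l (q j) y dy}.
  apply: cid2; exact: (edge_form_ge l0 hl (L2_intg (hq j))).
pose c j := s2val (H j).
have c0 j : 0 <= c j by rewrite /c; case: (H j).
exists (\sum_j c j); first by apply: sumr_ge0.
move=> lam y dy ys; rewrite /tree_sqnorm /tree_form mulr_sumr; apply: ler_sum => j _.
have [yA dyA] := ys j.
have h : - c j * sqnorm l (y j) <= edge_form l (q j) (y j) (dy j).
  by rewrite /c; case: (H j) => /= c1 _; apply => //; exact: cAC_cont dyA.
apply: le_trans h; apply: ler_wpM2r; first exact: sqnorm_ge0.
by rewrite lerN2 (bigD1 j)//= lerDl sumr_ge0.
Qed.

(** The root condition on the derivatives is left out: it is what distinguishes the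
    boundary value problems. *)
Definition tree_conditions (A : C) (y dy : 'I_g -> R -> C) :=
  [/\ forall j k, src k = tgt j -> y j l = y k 0,
      forall j, dy j l = \sum_(k < g | src k == tgt j) dy k 0 &
      forall k, src k = root -> y k 0 = A].

Lemma tree_energy lam A y dy : (forall j, sol l (q j) lam (y j) (dy j)) ->
  tree_conditions A y dy ->
  (tree_form y dy)%:C - lam * (tree_sqnorm y)%:C = - (\sum_(k < g | src k == root) dy k 0) * A^*.
Proof.
move=> ys [h1 h2 h3].
have := @tree_sum g T C (fun j => (y j 0)^*) (fun j => (y j l)^*)
  (fun j => dy j 0) (fun j => dy j l) _ h2.
rewrite (eq_bigr (fun j => (edge_form l (q j) (y j) (dy j))%:C - lam * (sqnorm l (y j))%:C)).
  rewrite sumrB -mulr_sumr /tree_form /tree_sqnorm !rmorph_sum/= => -> => [|j k jk].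
    rewrite mulNr mulr_suml; congr (- _); apply: eq_bigr => k /eqP kr.
    by rewrite h3.
  by rewrite (h1 j k).
by move=> j _; rewrite (energy l0 (L2_intg (hq j)) (ys j)).
Qed.

(** The unknowns a_j and b_j are the value and the derivative of y_j at 0. *)
Definition initial_data (v : 'cV[C]_(g + g)) : ('I_g -> C) * ('I_g -> C) :=
  (fun j => v (lshift g j) 0, fun j => v (rshift g j) 0).

Lemma initial_dataK v : v = col_mx (\col_j (initial_data v).1 j) (\col_j (initial_data v).2 j).
Proof.
apply/colP => x; case: (split_ordP x) => j ->.
  by rewrite col_mxEu mxE.
by rewrite col_mxEd mxE.
Qed.

Lemma robin_mx_ker be al lam v : robin_mx be al lam *m v = 0 ->
  let y := ysol lam (initial_data v).1 (initial_data v).2 in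
  let dy := dysol lam (initial_data v).1 (initial_data v).2 in
  tree_conditions ((initial_data v).1 root_ord) y dy /\
  be * \sum_(k < g | src k == root) dy k 0 + al * (initial_data v).1 root_ord = 0.
Proof.
rewrite {1}[v]initial_dataK (robin_mx_mul hg) => /(residual0P hg)[h1 h2 h3 h4] y dy.
have y0 j : y j 0 = (initial_data v).1 j by rewrite /y; have [_ -> _] := ysolP lam (initial_data v).1 (initial_data v).2 j.
have dy0 j : dy j 0 = (initial_data v).2 j by rewrite /dy; have [_ _ ->] := ysolP lam (initial_data v).1 (initial_data v).2 j.
split; first split.
- by move=> j k jk; rewrite y0; exact: h1.
- by move=> j; under eq_bigr do rewrite dy0; exact: h2.
- by move=> k kr; rewrite y0; exact: h3.
- by under eq_bigr do rewrite dy0.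
Qed.

Lemma det0_vector n (M : 'M[C]_n) : \det M = 0 -> exists2 v : 'cV_n, v != 0 & M *m v = 0.
Proof.
move=> /eqP; rewrite -det_tr => /det0P[v v0 vM]; exists v^T; first by rewrite trmx_eq0.
by apply: trmx_inj; rewrite trmx_mul trmxK vM trmx0.
Qed.

Lemma initial_data_neq0 lam v : v != 0 ->
  0 < tree_sqnorm (ysol lam (initial_data v).1 (initial_data v).2).
Proof.
move=> v0; rewrite lt_def tree_sqnorm_ge0 andbT; apply: contraNneq v0 => n0.
have ys j : sol l (q j) lam (ysol lam (initial_data v).1 (initial_data v).2 j)
    (dysol lam (initial_data v).1 (initial_data v).2 j) by have [] := ysolP lam (initial_data v).1 (initial_data v).2 j.
have h j := tree_sqnorm_eq0 ys n0 j.
have [ya yb] : (forall j, (initial_data v).1 j = 0) /\ (forall j, (initial_data v).2 j = 0).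
  split=> j; have [_ ea eb] := ysolP lam (initial_data v).1 (initial_data v).2 j; have [] := h j.
    by rewrite ea.
  by rewrite eb.
apply/eqP; rewrite [v]initial_dataK; apply/colP => x; case: (split_ordP x) => j ->.
  by rewrite col_mxEu mxE ya mxE.
by rewrite col_mxEd mxE yb mxE.
Qed.

(** The Robin condition turns the boundary term at the root into a multiple of
    |y(root)|^2; in the Dirichlet case it is 0. *)
Lemma singular_energy : exists2 c : R, 0 <= c & forall be al lam,
  be = 1 \/ (be = 0 /\ al = 1) -> \det (robin_mx be al lam) = 0 ->
  exists n F s : R, [/\ 0 < n, 0 <= s, - c * n <= F &
    F%:C - lam * n%:C = be * al * s%:C].
Proof.
have [c c0 cF] := tree_form_ge; exists c => // be al lam hbe /det0_vector[v v0 Mv].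
have [hc hr] := robin_mx_ker Mv.
set y := ysol _ _ _ in hc hr; set dy := dysol _ _ _ in hc hr.
have ys j : sol l (q j) lam (y j) (dy j) by have [] := ysolP lam (initial_data v).1 (initial_data v).2 j.
exists (tree_sqnorm y), (tree_form y dy), (sqabs ((initial_data v).1 root_ord)); split.
- exact: initial_data_neq0.
- exact: sqabs_ge0.
- exact: cF ys.
- rewrite (tree_energy ys hc) -mulcJ.
  case: hbe hr => [->|[-> ->]].
    by rewrite mul1r => /eqP; rewrite addr_eq0 => /eqP ->; ring.
  by rewrite mul0r mul1r add0r => ->; ring.
Qed.

(** The solutions at l are analytic in lam, and their derivatives at lam0 are the
    values at l of a solution u of the inhomogeneous equation. *)
Lemma solution_slopes (a b : C) j lam0 : exists u du h dh, [/\
  cAC l u du,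
  cAC l du (fun x => ((q j x)%:C - lam0) * u x - (solution l (q j) lam0 a b).1 x),
  u 0 = 0 /\ du 0 = 0,
  slope (fun lam => (solution l (q j) lam a b).1 l) lam0 h /\ h lam0 = u l &
  slope (fun lam => (solution l (q j) lam a b).2 l) lam0 dh /\ dh lam0 = du l].
Proof.
have H lam1 := solution_taylor l0 lam1 a b (hq j).
have rem lam1 : forall u du (v dv : C) (B : R),
    (forall lam, n1 (lam - lam1) <= 1 -> exists r dr, [/\ n1 r <= B, n1 dr <= B,
      (solution l (q j) lam a b).1 l = (solution l (q j) lam1 a b).1 l
        + (lam - lam1) * u + (lam - lam1) ^+ 2 * v + (lam - lam1) ^+ 3 * r &
      (solution l (q j) lam a b).2 l = (solution l (q j) lam1 a b).2 l
        + (lam - lam1) * du + (lam - lam1) ^+ 2 * dv + (lam - lam1) ^+ 3 * dr]) ->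
    exists r dr : C -> C, forall lam, n1 (lam - lam1) <= 1 -> [/\ n1 (r lam) <= B,
      n1 (dr lam) <= B,
      (solution l (q j) lam a b).1 l = (solution l (q j) lam1 a b).1 l
        + (lam - lam1) * u + (lam - lam1) ^+ 2 * v + (lam - lam1) ^+ 3 * r lam &
      (solution l (q j) lam a b).2 l = (solution l (q j) lam1 a b).2 l
        + (lam - lam1) * du + (lam - lam1) ^+ 2 * dv + (lam - lam1) ^+ 3 * dr lam].
  move=> u du v dv B h.
  have h' lam : {w : C * C | n1 (lam - lam1) <= 1 -> [/\ n1 w.1 <= B, n1 w.2 <= B,
      (solution l (q j) lam a b).1 l = (solution l (q j) lam1 a b).1 l
        + (lam - lam1) * u + (lam - lam1) ^+ 2 * v + (lam - lam1) ^+ 3 * w.1 &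
      (solution l (q j) lam a b).2 l = (solution l (q j) lam1 a b).2 l
        + (lam - lam1) * du + (lam - lam1) ^+ 2 * dv + (lam - lam1) ^+ 3 * w.2]}.
    apply: cid; have [near|far] := pselect (n1 (lam - lam1) <= 1); last by exists (0, 0).
    by have [r [dr hr]] := h lam near; exists (r, dr).
  by exists (fun lam => (sval (h' lam)).1), (fun lam => (sval (h' lam)).2) => lam;
    case: (h' lam).
have [u [du [v [dv [B [uA duA u0 B0 hr]]]]]] := H lam0.
have [r [dr hrr]] := rem _ _ _ _ _ _ hr.
have ex1 w : exists (d1 d2 : C) (B : R) (g : C -> C), forall z, n1 (z - w) <= 1 ->
    (solution l (q j) z a b).1 l = (solution l (q j) w a b).1 l + (z - w) * d1
      + (z - w) ^+ 2 * d2 + (z - w) ^+ 3 * g z /\ n1 (g z) <= B.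
  have [u1 [du1 [v1 [dv1 [B1 [_ _ _ _ /rem[r1 [dr1 hr1]]]]]]]] := H w.
  by exists (u1 l), v1, B1, r1 => z /hr1[].
have ex2 w : exists (d1 d2 : C) (B : R) (g : C -> C), forall z, n1 (z - w) <= 1 ->
    (solution l (q j) z a b).2 l = (solution l (q j) w a b).2 l + (z - w) * d1
      + (z - w) ^+ 2 * d2 + (z - w) ^+ 3 * g z /\ n1 (g z) <= B.
  have [u1 [du1 [v1 [dv1 [B1 [_ _ _ _ /rem[r1 [dr1 hr1]]]]]]]] := H w.
  by exists (du1 l), dv1, B1, dr1 => z /hr1[].
have [|h hs h0] := slope_exists ex1 (z0 := lam0) (d1 := u l) (d2 := v) (B := B) (g := r).
  by move=> z /hrr[].
have [|dh dhs dh0] := slope_exists ex2 (z0 := lam0) (d1 := du l) (d2 := dv) (B := B) (g := dr).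
  by move=> z /hrr[].
by exists u, du, h, dh.
Qed.

(** The matrix is taken along a curve z |-> (al, lam) = (A z, L z). If v, u is a
    Jordan chain at z0, then v gives a solution y, and u, corrected by the derivative of y
    in lam, a solution Z with right-hand side kap * y, kap = HL z0, which satisfies
    the vertex conditions except for a defect HA z0 * y(root) in the last root
    condition. Lagrange's identity, summed over the tree, becomes
    HL z0 * |y|^2 + HA z0 * |y(root)|^2 = 0, and by hypothesis y = 0. *)
Lemma robin_mx_det_order (be : C) (L A HL HA : C -> C) (z0 : C) (r al0 : R) :
  slope L z0 HL -> slope A z0 HA -> L z0 = r%:C -> A z0 = al0%:C ->
  be = 1 \/ [/\ be = 0, A z0 = 1 & HA z0 = 0] ->
  (forall n s : R, 0 <= n -> 0 <= s -> HL z0 * n%:C + HA z0 * s%:C = 0 -> n = 0) ->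
  zero_order (fun z => \det (robin_mx be (A z) (L z))) z0
    (g + g - \rank (robin_mx be (A z0) (L z0))).
Proof.
move=> [LE dHL] [AE dHA] Lr Ar hbe nd.
have dL z : cderivable L z.
  apply: (@eq_cdv _ (fun z => L z0 + (z - z0) * HL z)) => [w|]; first by rewrite -LE.
  apply: cdvD; first exact: cdv_cst.
  by apply: cdvM => //; apply: cdvB; [exact: cdv_id|exact: cdv_cst].
have hc j := solution_slopes 1 0 j (L z0); have hs j := solution_slopes 0 1 j (L z0).
pose Sc j (w : (R -> C) * (R -> C) * ((C -> C) * (C -> C))) (a b : C) := [/\
  cAC l w.1.1 w.1.2,
  cAC l w.1.2 (fun x => ((q j x)%:C - L z0) * w.1.1 x - (solution l (q j) (L z0) a b).1 x),
  w.1.1 0 = 0 /\ w.1.2 0 = 0,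
  slope (fun lam => (solution l (q j) lam a b).1 l) (L z0) w.2.1 /\ w.2.1 (L z0) = w.1.1 l &
  slope (fun lam => (solution l (q j) lam a b).2 l) (L z0) w.2.2 /\ w.2.2 (L z0) = w.1.2 l].
have wc j : {w | Sc j w 1 0}.
  by apply: cid; have [u [du [h [dh H]]]] := hc j; exists ((u, du), (h, dh)).
have ws j : {w | Sc j w 0 1}.
  by apply: cid; have [u [du [h [dh H]]]] := hs j; exists ((u, du), (h, dh)).
pose HC j z := HL z * (sval (wc j)).2.1 (L z).
pose HC' j z := HL z * (sval (wc j)).2.2 (L z).
pose HS j z := HL z * (sval (ws j)).2.1 (L z).
pose HS' j z := HL z * (sval (ws j)).2.2 (L z).
have slopeE (f h : C -> C) z : slope f (L z0) h ->
    f (L z) = f (L z0) + (z - z0) * (HL z * h (L z)).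
  move=> [fE _]; have e : L z - L z0 = (z - z0) * HL z by rewrite (LE z) addrC addKr.
  by rewrite (fE (L z)) e; ring.
have CE j z : cos_sol l (q j) (L z) l = cos_sol l (q j) (L z0) l + (z - z0) * HC j z.
  by rewrite /HC; case: (wc j) => w /= [_ _ _ [/slopeE h _] _]; exact: h.
have CE' j z : cos_sol' l (q j) (L z) l = cos_sol' l (q j) (L z0) l + (z - z0) * HC' j z.
  by rewrite /HC'; case: (wc j) => w /= [_ _ _ _ [/slopeE h _]]; exact: h.
have SE j z : sin_sol l (q j) (L z) l = sin_sol l (q j) (L z0) l + (z - z0) * HS j z.
  by rewrite /HS; case: (ws j) => w /= [_ _ _ [/slopeE h _] _]; exact: h.
have SE' j z : sin_sol' l (q j) (L z) l = sin_sol' l (q j) (L z0) l + (z - z0) * HS' j z.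
  by rewrite /HS'; case: (ws j) => w /= [_ _ _ _ [/slopeE h _]]; exact: h.
have dcomp h z : (forall w, cderivable h w) -> cderivable (fun z => HL z * h (L z)) z.
  by move=> dh; apply: cdvM => //; exact: cdv_comp.
have dHC j z : cderivable (HC j) z by apply: dcomp; case: (wc j) => w /= [_ _ _ [[_ h] _] _]; exact: h.
have dHC' j z : cderivable (HC' j) z by apply: dcomp; case: (wc j) => w /= [_ _ _ _ [[_ h] _]]; exact: h.
have dHS j z : cderivable (HS j) z by apply: dcomp; case: (ws j) => w /= [_ _ _ [[_ h] _] _]; exact: h.
have dHS' j z : cderivable (HS' j) z by apply: dcomp; case: (ws j) => w /= [_ _ _ _ [[_ h] _]]; exact: h.
pose H z : 'M[C]_(g + g) := block_mx
  (\matrix_(k, j) if src k == root then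
     (if (k.+1 < root_degree T)%N then 0 else HA z * (j == 0%N :> nat)%:R)
     else (tgt j == src k)%:R * HC j z)
  (\matrix_(k, j) if src k == root then 0 else (tgt j == src k)%:R * HS j z)
  (\matrix_(i, j) ((j == i)%:R * HC' j z))
  (\matrix_(i, j) ((j == i)%:R * HS' j z)).
apply: (@det_order_corank _ _ (fun z => robin_mx be (A z) (L z)) H).
- move=> z; rewrite /robin_mx /vertex_matrix /H scale_block_mx add_block_mx; congr block_mx;
    apply/matrixP => k j; rewrite !mxE.
  + case: ifP => _; last by rewrite CE; ring.
    case: ifP => _; first by rewrite mulr0 addr0.
    by rewrite {1}AE; ring.
  + by case: ifP => _; [rewrite mulr0 addr0|rewrite SE; ring].
  + by rewrite CE'; ring.
  + by rewrite SE'; ring.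
- move=> x y z; rewrite /H; case: (split_ordP x) => k ->; case: (split_ordP y) => j ->.
  + apply: (@eq_cdv _ (fun w => if src k == root then
     (if (k.+1 < root_degree T)%N then 0 else HA w * (j == 0%N :> nat)%:R)
     else (tgt j == src k)%:R * HC j w)); first by move=> w; rewrite block_mxEul mxE.
    case: (src k == root); last by apply: cdvM => //; exact: cdv_cst.
    by case: (k.+1 < _)%N; [exact: cdv_cst|apply: cdvM => //; exact: cdv_cst].
  + apply: (@eq_cdv _ (fun w => if src k == root then 0 else (tgt j == src k)%:R * HS j w)).
      by move=> w; rewrite block_mxEur mxE.
    by case: (src k == root); [exact: cdv_cst|apply: cdvM => //; exact: cdv_cst].
  + apply: (@eq_cdv _ (fun w => (j == k)%:R * HC' j w)).
      by move=> w; rewrite block_mxEdl mxE.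
    by apply: cdvM => //; exact: cdv_cst.
  + apply: (@eq_cdv _ (fun w => (j == k)%:R * HS' j w)).
      by move=> w; rewrite block_mxEdr mxE.
    by apply: cdvM => //; exact: cdv_cst.
move=> u v Mv0 Muv.
have [hcv hrv] := robin_mx_ker Mv0.
set va := (initial_data v).1 in hcv hrv; set vb := (initial_data v).2 in hcv hrv.
set ua := (initial_data u).1; set ub := (initial_data u).2.
set y := ysol _ _ _ in hcv hrv; set dy := dysol _ _ _ in hcv hrv.
have ys j : sol l (q j) (L z0) (y j) (dy j) by have [] := ysolP (L z0) va vb j.
suff n0 : tree_sqnorm y = 0.
  by apply/eqP; apply: contraTT isT => /(initial_data_neq0 (L z0)); rewrite -/y n0 ltxx.
pose kap := HL z0.
pose uc j := (sval (wc j)).1.1; pose duc j := (sval (wc j)).1.2.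
pose us j := (sval (ws j)).1.1; pose dus j := (sval (ws j)).1.2.
(* the derivative of ysol along the chain, at z0 *)
pose Z j x := ysol (L z0) ua ub j x + kap * (va j * uc j x + vb j * us j x).
pose dZ j x := dysol (L z0) ua ub j x + kap * (va j * duc j x + vb j * dus j x).
have ZA j : [/\ cAC l (Z j) (dZ j),
    cAC l (dZ j) (fun x => ((q j x)%:C - r%:C) * Z j x - kap * y j x),
    Z j 0 = ua j & dZ j 0 = ub j].
  have [[zA dzA] z0E dz0E] := ysolP (L z0) ua ub j.
  rewrite /Z /dZ /uc /us /duc /dus.
  case: (wc j) => w /= [wA dwA [w0 dw0] _ _]; case: (ws j) => w' /= [wA' dwA' [w0' dw0'] _ _].
  split.
  - exact: (cACD zA (cACZ kap l0 (cACD (cACZ _ l0 wA) (cACZ _ l0 wA')))).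
  - apply: eq_cAC (cACD dzA (cACZ kap l0 (cACD (cACZ _ l0 dwA) (cACZ _ l0 dwA')))) => x _ //.
    by rewrite -Lr /y /ysol /cos_sol /sin_sol; ring.
  - by rewrite z0E w0 w0'; ring.
  - by rewrite dz0E dw0 dw0'; ring.
have zl j : Z j l = ysol (L z0) ua ub j l + (HC j z0 * va j + HS j z0 * vb j).
  rewrite /Z /HC /HS /uc /us /kap.
  case: (wc j) => w /= [_ _ _ [_ ->] _]; case: (ws j) => w' /= [_ _ _ [_ ->] _]; ring.
have dzl j : dZ j l = dysol (L z0) ua ub j l + (HC' j z0 * va j + HS' j z0 * vb j).
  rewrite /dZ /HC' /HS' /duc /dus /kap.
  case: (wc j) => w /= [_ _ _ _ [_ ->]]; case: (ws j) => w' /= [_ _ _ _ [_ ->]]; ring.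
have Hv : H z0 *m v = col_mx
    (\col_k if src k == root then
      (if (k.+1 < root_degree T)%N then 0 else HA z0 * va root_ord)
      else \sum_j (tgt j == src k)%:R * (HC j z0 * va j + HS j z0 * vb j))
    (\col_i (HC' i z0 * va i + HS' i z0 * vb i)).
  rewrite [v]initial_dataK /H mul_block_col; congr col_mx; apply/colP => k; rewrite !mxE.
    case: ifPn => sk.
      rewrite [X in _ + X]big1 ?addr0 => [|j _]; last by rewrite !mxE sk mul0r.
      case: ifPn => kd; first by rewrite big1// => j _; rewrite !mxE sk kd mul0r.
      rewrite (bigD1 root_ord)//= !mxE sk (negbTE kd)/= mulr1 big1 ?addr0// => j jr.
      rewrite !mxE sk (negbTE kd) (_ : _ == _ = false) ?mulr0 ?mul0r//.
      by apply: contraNF jr => /eqP j0'; apply/eqP/val_inj.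
    rewrite -big_split/=; apply: eq_bigr => j _; rewrite !mxE (negbTE sk).
    by move: (HC j z0) (HS j z0) => h1 h2; rewrite mulrDr !mulrA.
  rewrite -big_split/= (bigD1 k)//= !mxE eqxx big1 ?addr0 ?mul1r// => j jk.
  by rewrite !mxE (negbTE jk) !mul0r addr0.
have res : residual T be (A z0 * ua root_ord + HA z0 * va root_ord) ua
    (fun j => Z j l) ub (fun j => dZ j l) = 0.
  rewrite -Muv Hv [u in _ *m u]initial_dataK (robin_mx_mul hg) /residual add_col_mx; congr col_mx;
    apply/colP => k; rewrite !mxE.
    case: ifP => sk.
      by case: ifP => kd; rewrite ?addr0// addrA.
    rewrite (eq_bigr (fun j => (tgt j == src k)%:R * ysol (L z0) ua ub j l +
       (tgt j == src k)%:R * (HC j z0 * va j + HS j z0 * vb j))).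
      by rewrite big_split/= addrAC.
    by move=> j _; rewrite zl mulrDr.
  by rewrite dzl /dysol -/ua -/ub; ring.
move/(residual0P hg): res => [h1 h2 h3 h4].
have [k1 k2 k3] := hcv.
have E1 := @tree_sum g T C (fun j => (y j 0)^*) (fun j => (y j l)^*)
  (fun j => dZ j 0) (fun j => dZ j l).
have E2 := @tree_sum g T C (fun j => Z j 0) (fun j => Z j l)
  (fun j => (dy j 0)^*) (fun j => (dy j l)^*).
have {}E1 : \sum_j (dZ j l * (y j l)^* - dZ j 0 * (y j 0)^*) =
    - (\sum_(k < g | src k == root) ub k) * (va root_ord)^*.
  rewrite E1.
  - rewrite mulNr mulr_suml; congr (- _); apply: eq_bigr => k /eqP kr.
    by have [_ _ _ ->] := ZA k; rewrite k3.
  - by move=> j k jk; rewrite (k1 j k).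
  - move=> j; rewrite h2; apply: eq_bigr => k _; by have [_ _ _ ->] := ZA k.
have {}E2 : \sum_j ((dy j l)^* * Z j l - (dy j 0)^* * Z j 0) =
    - (\sum_(k < g | src k == root) dy k 0)^* * ua root_ord.
  rewrite E2.
  - rewrite mulNr rmorph_sum mulr_suml; congr (- _); apply: eq_bigr => k /eqP kr.
    by have [_ _ -> _] := ZA k; rewrite h3.
  - by move=> j k jk; have [_ _ -> _] := ZA k; exact: h1.
  - by move=> j; rewrite k2 rmorph_sum.
have J : \sum_j (dZ j l * (y j l)^* - dZ j 0 * (y j 0)^*) -
    \sum_j ((dy j l)^* * Z j l - (dy j 0)^* * Z j 0) = - kap * (tree_sqnorm y)%:C.
  rewrite -sumrB /tree_sqnorm rmorph_sum mulr_sumr; apply: eq_bigr => j _.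
  have [zA dzA _ _] := ZA j; have ysj := ys j; rewrite Lr in ysj.
  rewrite -(jordan_identity l0 ysj zA dzA); ring.
apply: (nd _ (sqabs (va root_ord))); [exact: tree_sqnorm_ge0|exact: sqabs_ge0|].
rewrite E1 E2 in J; rewrite -/kap -mulcJ.
case: hbe => [b1|[b0 A1 HA0]].
  rewrite b1 !mul1r Ar in hrv h4.
  have e1 : \sum_(k < g | src k == root) ub k =
      - (al0%:C * ua root_ord + HA z0 * va root_ord).
    by apply/eqP; rewrite -addr_eq0 h4.
  have e2 : \sum_(k < g | src k == root) dy k 0 = - (al0%:C * va root_ord).
    by apply/eqP; rewrite -addr_eq0 hrv.
  have cr : Num.conj_op (al0%:C : C) = al0%:C := conjc_real _.
  have e3 : Num.conj_op (\sum_(k < g | src k == root) dy k 0) =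
      - (al0%:C * Num.conj_op (va root_ord)).
    transitivity (- (Num.conj_op (al0%:C : C) * Num.conj_op (va root_ord))).
      by rewrite e2 rmorphN rmorphM.
    by rewrite cr.
  move: J; rewrite e1 e3 => J.
  apply/eqP; rewrite -oppr_eq0 opprD -mulNr -J; apply/eqP; ring.
rewrite b0 A1 !mul0r !mul1r !add0r in hrv h4.
have v0 : va root_ord = 0 by exact: hrv.
rewrite HA0 v0 mul0r addr0 in h4; move: J; rewrite h4 v0 !mulr0 subr0.
have -> : Num.conj_op (0 : C) = 0 := conjc0 R.
by move/eqP; rewrite HA0 mulr0 mulNr eq_sym oppr_eq0 mul0r addr0 => /eqP.
Qed.

Lemma det_robin_mx_real be al r : be^* = be -> al^* = al ->
  (\det (robin_mx be al r%:C))^* = \det (robin_mx be al r%:C).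
Proof.
move=> hb ha; suff H x y : (robin_mx be al r%:C x y)^* = robin_mx be al r%:C x y.
  by rewrite -det_map_mx; congr (\det _); apply/matrixP => x y; rewrite mxE; exact: H.
have cB (z w : C) : conjc (z - w) = conjc z - conjc w by exact: rmorphB.
have cM (z w : C) : conjc (z * w) = conjc z * conjc w by exact: rmorphM.
have ll : 0 <= l <= l by rewrite l0 lexx.
have c1 j := solution_real l0 r 1 0 (hq j) ll.
have s1 j := solution_real l0 r 0 1 (hq j) ll.
rewrite /robin_mx /vertex_matrix.
have cn (b : bool) : conjc (b%:R : C) = b%:R by rewrite conjc_nat.
case: (split_ordP x) => k ->; case: (split_ordP y) => j ->;
  rewrite ?(block_mxEul, block_mxEur, block_mxEdl, block_mxEdr) !mxE.
- case: ifP => _; last by rewrite cB cM !cn /cos_sol (c1 j).1.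
  by case: ifP => _; rewrite ?cB ?cM ?cn ?ha.
- case: ifP => _; last by rewrite cM !cn /sin_sol (s1 j).1.
  by case: ifP => _; rewrite ?conjc0 ?cM ?cn ?hb.
- by rewrite cM !cn /cos_sol' (c1 j).2.
- by rewrite cB cM !cn /sin_sol' (s1 j).2.
Qed.

Lemma robin_mx_corank_le be al be' al' lam :
  (g + g - \rank (robin_mx be al lam) <= (g + g - \rank (robin_mx be' al' lam)).+1)%N.
Proof.
have : (\rank (robin_mx be' al' lam) <= \rank (robin_mx be al lam) + 1)%N.
  set i0 := lshift g (last_root hg T).
  have -> : robin_mx be' al' lam = robin_mx be al lam +
      delta_mx i0 0 *m (row i0 (robin_mx be' al' lam) - row i0 (robin_mx be al lam)).
    apply/matrixP => x y.
    have := @robin_mx_other_row R g hg T l q be al be' al' lam x y.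
    move: (robin_mx be al lam) (robin_mx be' al' lam) => A B H; rewrite !mxE.
    rewrite big_ord_recl big_ord0 addr0 !mxE/= andbT.
    have [->|xn] := eqVneq x i0; first by rewrite mul1r; ring.
    by rewrite mul0r addr0 H.
  apply: leq_trans (mxrank_add _ _) _; rewrite leq_add2l.
  exact: leq_trans (mulmx_max_rank _ _) _.
have := rank_leq_row (robin_mx be al lam); have := rank_leq_row (robin_mx be' al' lam); lia.
Qed.

End TreeEquation.

(** * Neighbourhoods in the complex plane *)
Section PlaneNeighbourhoods.
Variable R : realType.
Local Notation C := R[i].
Local Notation Re := complex.Re.
Local Notation Im := complex.Im.
Implicit Types (f : C -> C) (z w : C).

Lemma n1_near z0 (P : set C) : (\forall z \near (z0 : C^o), P z) ->
  exists2 e : R, 0 < e & forall z, n1 (z - z0) <= e -> P z.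
Proof.
move=> /nbhs_normP[e /= e0 h].
have eE : e = (Re e)%:C by move: e0; rewrite ltcE/= => /andP[/eqP e0 _]; case: (e) e0 => a b /= ->.
have e0' : 0 < Re e by move: e0; rewrite ltcE/= => /andP[].
exists (Re e / 2); first by rewrite divr_gt0.
move=> z hz; apply: h => /=.
rewrite -normrN opprB; apply: le_lt_trans (norm_n1 _) _; rewrite eE ltcR.
by apply: le_lt_trans hz _; rewrite /=; lra.
Qed.

Lemma cdv_n1 f z0 : cderivable f z0 -> forall eta : R, 0 < eta ->
  exists2 e : R, 0 < e & forall z, n1 (z - z0) <= e -> n1 (f z - f z0) <= eta.
Proof.
move=> /cdv_continuous fc eta eta0; apply: n1_near.
have /(@cvgrPdist_le _ C^o _ (nbhs (z0 : C^o)))/(_ (eta / 2)%:C) h := fc.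
have : (0 : C) < (eta / 2)%:C by rewrite ltcR divr_gt0.
move=> /h; apply: filterS => z /= hz.
rewrite -n1N opprB; apply: le_trans (n1_norm hz) _; lra.
Qed.

Lemma ReD_n1 z w : `|Re z - Re w| <= n1 (z - w) /\ `|Im z - Im w| <= n1 (z - w).
Proof. by rewrite /n1; case: z w => a b [c d] /=; rewrite lerDl lerDr !normr_ge0. Qed.

End PlaneNeighbourhoods.

(** * Induction along an interval *)
Section RealInduction.
Variable R : realType.

(** The supremum of the points reached from a can be reached, and cannot be
    surpassed only if it is b. *)
Lemma real_induction (P : R -> Prop) (a b : R) : a <= b -> P a ->
  (forall x, a <= x <= b -> exists2 e, 0 < e &
    (forall y, a <= y -> x - e < y < x -> P y -> P x) /\
    (forall y, x < y < x + e -> P x -> P y)) -> P b.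
Proof.
move=> ab Pa H; pose S := [set x | a <= x <= b /\ P x].
have Sa : S a by split; rewrite ?lexx.
have Sub : has_sup S by split; [exists a|exists b => x [/andP[]]].
have cS : a <= sup S <= b.
  apply/andP; split; first exact: sup_upper_bound.
  by apply: ge_sup => //; [exists a|move=> x [/andP[]]].
have [e e0 [h1 h2]] := H _ cS.
have Pc : P (sup S).
  have [y [/andP[ay yb] Py] ey] := sup_adherent e0 Sub.
  have : y <= sup S by apply: sup_upper_bound => //; split=> //; rewrite ay.
  rewrite le_eqVlt => /orP[/eqP <- //|yc]; apply: (h1 y) => //; exact/andP.
have [cb|] := ltP (sup S) b; last first.
  by case/andP: cS => _ ? ?; have -> : b = sup S by apply/eqP; rewrite eq_le; apply/andP.
pose y := Num.min b (sup S + e / 2).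
have cy : sup S < y by rewrite lt_min cb ltrDl divr_gt0.
have : y <= sup S.
  apply: sup_upper_bound => //; split.
    by rewrite (le_trans _ (ltW cy)) ?ge_min ?lexx//; case/andP: cS.
  apply: h2 => //; rewrite cy/=; apply: le_lt_trans (_ : y <= sup S + e / 2) _; first by rewrite ge_min lexx orbT.
  by lra.
by rewrite leNgt cy.
Qed.

End RealInduction.

Lemma sign_near (R : realType) (a v : R) : a != 0 -> `|v - a| <= `|a| / 2 ->
  v != 0 /\ (0 < v) = (0 < a).
Proof.
have [a0|a0|->] := ltrgtP a 0; rewrite ?eqxx// => _ /ler_normlP[].
  rewrite (ltr0_norm a0) => h1 h2; have v0 : v < 0 by lra.
  by rewrite (lt_eqF v0) (lt_gtF v0).
rewrite (gtr0_norm a0) => h1 h2; have v0 : 0 < v by lra.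
by rewrite (gt_eqF v0) v0.
Qed.

Lemma mul_small (R : realType) (m d : R) : 0 < d <= 1 -> 0 < m * d -> m * d <= m.
Proof. by move=> /andP[d0 d1]; rewrite pmulr_lgt0// => m0; rewrite ler_piMr// ltW. Qed.

(** * Zeros on the negative half-line *)
Section Counting.
Variables (R : realType) (g : nat) (hg : (0 < g)%N) (T : rooted_tree g) (l : R)
  (hl : 0 < l) (q : 'I_g -> R -> R) (hq : forall j, L2 (edge l) (q j)).
Local Notation C := R[i].
Local Notation Re := complex.Re.
Local Notation Im := complex.Im.
Local Notation robin_mx := (robin_mx T l q).
Local Notation dN z := (\det (robin_mx 1 0 z)).
Local Notation dD z := (\det (robin_mx 0 1 z)).
Implicit Types (x y : R).

Definition corank be al (lam : C) := (g + g - \rank (robin_mx be al lam))%N.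

Lemma corank0P be al lam : reflect (\det (robin_mx be al lam) = 0) (corank be al lam != 0%N).
Proof.
rewrite /corank subn_eq0 -ltnNge ltn_neqAle rank_leq_row andbT.
move: (robin_mx be al lam) => M; apply: (iffP idP) => [|/eqP].
  by apply: contraNeq; rewrite -unitfE -unitmxE -row_free_unit.
by rewrite -[_ == 0]negbK -unitfE -unitmxE -row_free_unit.
Qed.

Lemma det_robinE al z : \det (robin_mx 1 al z) = dN z + al * dD z.
Proof. exact: (det_robin_mx hg). Qed.

(** Imaginary part of the energy identity for al = - N / D. *)
Lemma herglotz z : 0 < Im z -> dD z != 0 /\ 0 < Im (dN z / dD z).
Proof.
have [c c0 h] := singular_energy hg T hl hq => z0.
have D0 : dD z != 0.
  apply/eqP => /(h 0 1 z (or_intror (conj erefl erefl)))[n [F [s [n0 _ _]]]].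
  rewrite !mul0r => /(congr1 (@complex.Im R)); rewrite !RI /= => /eqP.
  rewrite ?mulr0 ?add0r oppr_eq0 mulf_eq0.
  by rewrite (gt_eqF z0) (gt_eqF n0).
split=> //.
have : \det (robin_mx 1 (- (dN z / dD z)) z) = 0.
  by rewrite det_robinE mulNr divfK// subrr.
move=> /(h 1 _ z (or_introl erefl))[n [F [s [n0 s0 _]]]].
move: (dN z / dD z) => w /(congr1 (@complex.Im R)); rewrite mul1r !RI /= => e.
have {}e : Im z * n = Im w * s by move: e; rewrite !mulr0; lra.
have := mulr_gt0 z0 n0; rewrite e => ws.
rewrite -(pmulr_lgt0 _ (_ : 0 < s))// lt_def s0 andbT.
by apply: contraTneq ws => ->; rewrite mulr0 ltxx.
Qed.

(** The Weyl function N / D on the real axis, where it is real. *)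
Definition weyl x := Re (dN x%:C / dD x%:C).

Lemma weylE x : dN x%:C / dD x%:C = (weyl x)%:C.
Proof.
have r (z : C) : conjc z = z -> Im z = 0.
  by case: z => a b [] /= e; apply/eqP; rewrite -[_ == _](@mulrn_eq0 _ b 2); rewrite mulr2n -{1}e addNr.
apply: complexP => //=; apply: r.
have hN := det_robin_mx_real T hl hq (be := 1) (al := 0) x (conjc1 _) (conjc0 _).
have hD := det_robin_mx_real T hl hq (be := 0) (al := 1) x (conjc0 _) (conjc1 _).
transitivity (conjc (dN x%:C) / conjc (dD x%:C)); last by rewrite hN hD.
by rewrite (rmorphM conjc) fmorphV.
Qed.

(** To the left of - c the left-hand side F - lam * n of the energy identity is
    positive. *)
Lemma weyl_lt0 : exists2 c, 0 <= c & forall x, x < - c -> dD x%:C != 0 /\ weyl x < 0.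
Proof.
have [c c0 h] := singular_energy hg T hl hq; exists c => // x xc.
have D0 : dD x%:C != 0.
  apply/eqP => /(h 0 1 x%:C (or_intror (conj erefl erefl)))[n [F [s [n0 _ Fn]]]].
  rewrite !mul0r => /(congr1 (@complex.Re R)); rewrite !RI /= => e.
  have : x * n < - c * n by rewrite ltr_pM2r.
  by rewrite mul0r subr0 in e; lra.
split=> //.
have : \det (robin_mx 1 (- (weyl x)%:C) x%:C) = 0.
  by rewrite det_robinE -weylE mulNr divfK// subrr.
move=> /(h 1 _ x%:C (or_introl erefl))[n [F [s [n0 s0 Fn]]]].
move: (weyl x) => m /(congr1 (@complex.Re R)); rewrite mul1r !RI /= => e.
have h1 : x * n < - c * n by rewrite ltr_pM2r.
have h2 : 0 < - m * s by move: e; rewrite ?mulr0 ?mul0r ?oppr0; lra.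
by move: h2; rewrite ltNge mulNr oppr_le0 -ltNge; nra.
Qed.

Lemma corank_le be al be' al' lam : (corank be al lam <= (corank be' al' lam).+1)%N.
Proof. exact: robin_mx_corank_le. Qed.

(** Both are orders of zeros at x, by [robin_order_det] and
    [dirichlet_order_det]. *)
Definition dirichlet_order x := corank 0 1 x%:C.
Definition robin_order al x := corank 1 al%:C x%:C.

Lemma robin_order_det al x : zero_order (fun z => \det (robin_mx 1 al%:C z)) x%:C (robin_order al x).
Proof.
apply: (@robin_mx_det_order R g hg T l hl q hq 1 id (fun=> al%:C) (fun=> 1) (fun=> 0)
  x%:C x al) => //; try by left.
- by split=> [z|z]; [rewrite mulr1 addrC subrK|exact: cdv_cst].
- by split=> [z|z]; [rewrite mulr0 addr0|exact: cdv_cst].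
- by move=> n s _ _ /(congr1 (@complex.Re R)); rewrite !RI /=; lra.
Qed.

Lemma dirichlet_order_det x : zero_order (fun z => dD z) x%:C (dirichlet_order x).
Proof.
apply: (@robin_mx_det_order R g hg T l hl q hq 0 id (fun=> 1) (fun=> 1) (fun=> 0)
  x%:C x 1) => //; try by right.
- by split=> [z|z]; [rewrite mulr1 addrC subrK|exact: cdv_cst].
- by split=> [z|z]; [rewrite mulr0 addr0|exact: cdv_cst].
- by move=> n s _ _ /(congr1 (@complex.Re R)); rewrite !RI /=; lra.
Qed.

Lemma jost_order_det (t : R) : 0 < t ->
  zero_order (fun z => \det (robin_mx 1 ((0 +i* 1) * z) (z ^+ 2))) (0 +i* t)
    (robin_order (- t) (- t ^+ 2)).
Proof.
move=> t0; pose z0 : C := 0 +i* t.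
have E1 : z0 ^+ 2 = (- t ^+ 2)%:C by apply: complexP; rewrite expr2 /=; ring.
have E2 : (0 +i* 1) * z0 = (- t)%:C by apply: complexP; rewrite /=; ring.
rewrite /robin_order -E2 -E1; apply: (@robin_mx_det_order R g hg T l hl q hq 1 (fun z => z ^+ 2) (fun z => (0 +i* 1) * z)
  (fun z => z + z0) (fun=> 0 +i* 1) _ _ _ _ _ E1 E2); try by left.
- split=> z; first by rewrite -subr_sqr addrC subrK.
  by apply: cdvD; [exact: cdv_id|exact: cdv_cst].
- by split=> z; [ring|exact: cdv_cst].
- move=> n s n0 s0 /(congr1 (@complex.Im R)); rewrite !RI /= => e.
  by move: e n0 s0; rewrite ?mul0r ?mul1r ?addr0 ?add0r; nra.
Qed.

(** w is the quotient of the two analytic functions that remain when the powers of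
    z - x0 are taken out of N + al * D and of D. The powers are written on both sides of
    the equation because either exponent may be the larger one. *)
Lemma local_chart x0 (al : R) : exists (w : C -> C) (e0 : R), [/\ 0 < e0, w x0%:C != 0,
  forall eta : R, 0 < eta -> exists2 e : R, 0 < e &
    forall z, n1 (z - x0%:C) <= e -> n1 (w z - w x0%:C) <= eta &
  forall z, n1 (z - x0%:C) <= e0 -> z != x0%:C -> dD z != 0 /\
    (dN z / dD z + al%:C) * (z - x0%:C) ^+ dirichlet_order x0 =
    w z * (z - x0%:C) ^+ robin_order al x0].
Proof.
have [h1 h10 near1] := robin_order_det al x0.
have [h2 h20 near2] := dirichlet_order_det x0.
have d1 : cderivable h1 x0%:C by rewrite cdvE; exact: (nbhs_singleton near1).1.
have d2 : cderivable h2 x0%:C by rewrite cdvE; exact: (nbhs_singleton near2).1.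
have [e1 e10 H1] := n1_near near1; have [e2 e20 H2] := n1_near near2.
have [e3 e30 H3] : exists2 e : R, 0 < e & forall z, n1 (z - x0%:C) <= e -> h2 z != 0.
  have h20' : 0 < n1 (h2 x0%:C) / 2.
    rewrite divr_gt0// lt_def n1_ge0 andbT; apply: contraNneq h20 => e.
    by apply/eqP; apply: n1_le0; rewrite e.
  have [e e0 H] := cdv_n1 d2 h20'; exists e => // z /H.
  by apply: contraTneq => ->; rewrite sub0r n1N -ltNge; move: h20'; lra.
exists (fun z => h1 z / h2 z), (Num.min e1 (Num.min e2 e3)); split.
- by rewrite !lt_min e10 e20.
- by rewrite mulf_neq0 ?invr_neq0.
- by move=> eta eta0; apply: cdv_n1 => //; apply: cdvM => //; exact: cdvV.
- move=> z; rewrite !le_min => /and3P[/H1[_ N1] /H2[_ D2] /H3 h2z] zx.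
  have zx' : z - x0%:C != 0 by rewrite subr_eq0.
  have Dz : dD z != 0 by rewrite D2 mulf_neq0// expf_neq0.
  split=> //; have -> : dN z / dD z + al%:C = \det (robin_mx 1 al%:C z) / dD z.
    by rewrite (det_robinE al%:C) mulrDl mulfK.
  rewrite N1 D2; move: ((z - _) ^+ robin_order al x0) (expf_neq0 (dirichlet_order x0) zx') h2z => d.
  by move: (_ ^+ dirichlet_order x0) (h1 z) (h2 z) => a b c a0 c0; field; rewrite ?c0 ?a0.
Qed.

(** The jump of the sign of N / D - s at x0 is the difference of the orders of
    N + al * D and of D, where al = - s x0. The two signs depend on x0 and al only, not
    on s, which is why s is quantified after them: this is used at x0 = 0. *)
Lemma sign_jump x0 (al : R) : exists b1 b2 : bool,
  (b2 + dirichlet_order x0 = b1 + robin_order al x0)%N /\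
  forall s : R -> R, (forall x y, x <= y -> s y <= s x) ->
    (forall eta : R, 0 < eta -> exists2 e, 0 < e &
       forall y, `|y - x0| <= e -> `|s y - s x0| <= eta) ->
    s x0 = - al -> exists2 e, 0 < e & forall y, y != x0 -> `|y - x0| <= e ->
      [/\ dD y%:C != 0, weyl y - s y != 0 & (0 < weyl y - s y) = if y < x0 then b1 else b2].
Proof.
have [w [e0 [e00 w0 wc H]]] := local_chart x0 al.
have n1r y : n1 (y%:C - x0%:C) = `|y - x0| by rewrite /n1 /= subr0 normr0 addr0.
pose W y := Re (w y%:C).
(* On the real axis all quantities are real, and so is the limit of w. *)
have HR y : y != x0 -> `|y - x0| <= e0 -> dD y%:C != 0 /\
    w y%:C = (W y)%:C /\
    (weyl y + al) * (y - x0) ^+ dirichlet_order x0 = W y * (y - x0) ^+ robin_order al x0.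
  move=> yx ye; have [||Dy] := H y%:C; [by rewrite n1r|by apply: contra_neq yx => -[]|].
  rewrite weylE -rmorphD -rmorphB -!rmorphXn -rmorphM => E; split=> //.
  have yx' : (y - x0)%:C ^+ robin_order al x0 != 0.
    by rewrite expf_neq0//; apply: contra_neq yx => -[] /eqP; rewrite subr_eq0 => /eqP.
  have wE : w y%:C = (W y)%:C.
    apply: complexP => //=; move: yx' E; rewrite -rmorphXn/=.
    move: (_ ^+ _) (_ * _) => a b a0 /(congr1 (@complex.Im R)).
    rewrite RI /= mulr0 add0r => /esym/eqP; rewrite mulf_eq0 => /orP[/eqP//|/eqP a00].
    by move: a0; rewrite a00 eqxx.
  split=> //; move: E; rewrite wE -rmorphM => /(congr1 (@complex.Re R)).
  by rewrite /=.
have wreal : w x0%:C = (W x0)%:C.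
  apply: complexP => //=; apply/eqP; apply: contraT => Iw.
  have eta0 : 0 < `|Im (w x0%:C)| / 2 by rewrite divr_gt0// normr_gt0.
  have [e e1 He] := wc _ eta0.
  pose y := x0 + Num.min e e0.
  have m0 : 0 < Num.min e e0 by rewrite lt_min e1.
  have ym : y - x0 = Num.min e e0 by rewrite /y addrAC subrr add0r.
  have [||_ [wy _]] := HR y.
  - by rewrite -subr_eq0 ym gt_eqF.
  - by rewrite ym gtr0_norm// ge_min lexx orbT.
  have /He : n1 (y%:C - x0%:C) <= e by rewrite n1r ym gtr0_norm// ge_min lexx.
  move=> /(le_trans (ReD_n1 _ _).2); rewrite wy/= sub0r normrN.
  by move: eta0; lra.
have W0 : W x0 != 0 by apply: contraNneq w0 => e; rewrite wreal e.
have Wc eta : 0 < eta -> exists2 e : R, 0 < e &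
    forall z, n1 (z - x0%:C) <= e -> `|Re (w z) - W x0| <= eta.
  by move=> /wc[e e1 He]; exists e => // z /He; exact: le_trans (ReD_n1 _ _).1.
(* On the vertical line above x0 the sign of Im (N / D) is known. *)
have up eta : 0 < eta -> exists2 e : R, 0 < e & let z := x0%:C + (0 +i* e) in
    `|Re (w z) - W x0| <= eta /\ exists2 Q, 0 < Im Q &
    Q * (0 +i* e) ^+ dirichlet_order x0 = w z * (0 +i* e) ^+ robin_order al x0.
  move=> /Wc[e e1 He]; exists (Num.min e e0); first by rewrite lt_min e1.
  move=> z; have m0 : 0 < Num.min e e0 by rewrite lt_min e1.
  have zx : z - x0%:C = (0 +i* Num.min e e0) by rewrite /z addrAC subrr add0r.
  have n1z : n1 (z - x0%:C) = Num.min e e0.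
    by rewrite zx /n1 /= normr0 add0r gtr0_norm.
  split; first by apply: He; rewrite n1z ge_min lexx.
  exists (dN z / dD z + al%:C).
    have [] := @herglotz z; first by rewrite /z /= add0r.
    by move: (dN z / dD z) => v _ v0; rewrite !RI /= addr0.
  have [||_] := H z; last by rewrite zx.
    by rewrite n1z ge_min lexx orbT.
  by rewrite -subr_eq0 zx; apply/eqP => -[] m00; rewrite m00 ltxx in m0.
have le1 : (dirichlet_order x0 <= (robin_order al x0).+1)%N by exact: corank_le.
have le2 : (robin_order al x0 <= (dirichlet_order x0).+1)%N by exact: corank_le.
move: le1 le2 HR up; move: (robin_order al x0) (dirichlet_order x0) => k kD le1 le2 HR up.
have eta1 : 0 < `|W x0| / 4 by rewrite divr_gt0// normr_gt0.
(* a quarter of |W x0| bounds the variation of W and of s, so that their sum cannot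
   change the sign *)
have [e1 e10 He1] := Wc _ eta1.
have HW y : `|y - x0| <= e1 -> `|W y - W x0| <= `|W x0| / 4.
  by move=> ye; apply: He1; rewrite n1r.
have [kE|[kE|kE]] : k = kD \/ k = kD.+1 \/ kD = k.+1 by lia.
(* The quotient is finite and nonzero at x0. *)
- exists (0 < W x0), (0 < W x0); split; first by rewrite kE.
  move=> s sm sc sx; have [e2 e20 He2] := sc _ eta1.
  exists (Num.min e0 (Num.min e1 e2)); first by rewrite !lt_min e00 e10.
  move=> y yx; rewrite !le_min => /and3P[/(HR y yx)[Dy [_ Ey]] /HW Wy /He2 sy].
  have {}Ey : weyl y = W y - al.
    have p0 : (y - x0) ^+ kD != 0 by rewrite expf_neq0// subr_eq0.
    by rewrite kE in Ey; move/(mulIf p0): Ey => <-; rewrite addrK.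
  have [] := @sign_near R (W x0) (weyl y - s y) W0; last by rewrite if_same.
  have -> : weyl y - s y - W x0 = (W y - W x0) - (s y - s x0) by rewrite Ey sx; ring.
  by apply: le_trans (ler_normB _ _) _; lra.
(* A simple zero: at x0 + i * e the quotient is close to i * e * W x0. The term in s
   has the same sign as the quotient on both sides, as s is nonincreasing. *)
- have Wp : 0 < W x0.
    rewrite lt_def W0 leNgt; apply/negP => Wn.
    have eta2 : 0 < - W x0 / 2 by lra.
    have [e e20 [We [Q Q0]]] := up _ eta2.
    rewrite kE exprSr mulrA mulrAC => /mulIf QE.
    have e0i : (0 +i* e : C) ^+ kD != 0.
      by rewrite expf_neq0//; apply/eqP => -[] ee; rewrite ee ltxx in e20.
    move: Q0; rewrite (QE e0i); move: We; move: (w _) => v We.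
    rewrite RI /= mulr0 addr0 pmulr_lgt0// => v0.
    by move: We; rewrite ler_norml => /andP[]; lra.
  exists false, true; split; first by rewrite kE add1n.
  move=> s sm sc sx.
  exists (Num.min e0 e1); first by rewrite !lt_min e00 e10.
  move=> y yx; rewrite !le_min => /andP[/(HR y yx)[Dy [_ Ey]] /HW Wy].
  have {}Ey : weyl y = (y - x0) * W y - al.
    have p0 : (y - x0) ^+ kD != 0 by rewrite expf_neq0// subr_eq0.
    rewrite kE exprS mulrA (mulrC (W y)) in Ey.
    by move/(mulIf p0): Ey => <-; rewrite addrK.
  have Wy0 : 0 < W y.
    by move: Wy; rewrite (gtr0_norm Wp) ler_norml => /andP[]; lra.
  have -> : weyl y - s y = (y - x0) * W y + (s x0 - s y) by rewrite Ey sx; ring.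
  have [yl|yr|ye] := ltrgtP y x0; last by rewrite ye eqxx in yx.
    have h : (y - x0) * W y + (s x0 - s y) < 0.
      by have := sm _ _ (ltW yl); have := mulr_gt0 (_ : 0 < x0 - y) Wy0; rewrite subr_gt0 => /(_ yl); lra.
    by rewrite (lt_eqF h) (lt_gtF h).
  have h : 0 < (y - x0) * W y + (s x0 - s y).
    by have := sm _ _ (ltW yr); have := mulr_gt0 (_ : 0 < y - x0) Wy0; rewrite subr_gt0 => /(_ yr); lra.
  by rewrite (gt_eqF h) h.
(* A simple pole: at x0 + i * e the quotient is close to - i * W x0 / e, and near
   x0 it dominates the variation of s. *)
- have Wn : W x0 < 0.
    rewrite lt_def eq_sym W0 leNgt; apply/negP => Wn.
    have eta2 : 0 < W x0 / 2 by lra.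
    have [e e20 [We [Q Q0]]] := up _ eta2.
    rewrite kE exprS mulrA => /mulIf QE.
    have e0i : (0 +i* e : C) ^+ k != 0.
      by rewrite expf_neq0//; apply/eqP => -[] ee; rewrite ee ltxx in e20.
    move: We; rewrite -(QE e0i) RI /= => We.
    have h : 0 < Im Q * e by rewrite mulr_gt0.
    by move: We; rewrite ler_norml => /andP[]; rewrite ?mulr0; lra.
  exists true, false; split; first by rewrite kE add1n.
  move=> s sm sc sx; have [e2 e20 He2] := sc _ eta1.
  exists (Num.min e0 (Num.min e1 (Num.min e2 1))); first by rewrite !lt_min e00 e10 e20/=.
  move=> y yx; rewrite !le_min => /and4P[/(HR y yx)[Dy [_ Ey]] /HW Wy /He2 sy y1].
  have yx' : y - x0 != 0 by rewrite subr_eq0.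
  have {}Ey : (weyl y + al) * (y - x0) = W y.
    have p0 : (y - x0) ^+ k != 0 by rewrite expf_neq0.
    by rewrite kE exprS mulrA in Ey; move/(mulIf p0): Ey.
  have -> : weyl y - s y = (weyl y + al) - (s y - s x0) by rewrite sx; ring.
  move: Wy sy; rewrite (ltr0_norm Wn) !ler_norml => /andP[W1 W2] /andP[s1 s2].
  move: y1; rewrite ler_norml => /andP[y1 y2].
  have [yl|yr|ye] := ltrgtP y x0; last by rewrite ye eqxx in yx.
    have h : 0 < weyl y + al - (s y - s x0).
      suff : - W y <= weyl y + al by lra.
      have -> : - W y = (weyl y + al) * (x0 - y) by rewrite -Ey; ring.
      apply: mul_small; first by rewrite subr_gt0 yl/= -opprB lerNl.
      by rewrite -opprB mulrN Ey; lra.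
    by rewrite (gt_eqF h) h.
  have h : weyl y + al - (s y - s x0) < 0.
    suff : weyl y + al <= W y by lra.
    rewrite -lerN2.
    have -> : - W y = - (weyl y + al) * (y - x0) by rewrite -Ey; ring.
    apply: mul_small; first by rewrite subr_gt0 yr y2.
    by rewrite mulNr Ey; lra.
  by rewrite (lt_eqF h) (lt_gtF h).
Qed.

Definition sqrt_opp x := Num.sqrt (Num.max (- x) 0).

Lemma sqrt_opp_noninc x y : x <= y -> sqrt_opp y <= sqrt_opp x.
Proof.
move=> xy; rewrite /sqrt_opp; apply: ler_wsqrtr; rewrite ge_max !le_max lexx orbT andbT.
by rewrite lerN2 xy.
Qed.

Lemma sqrt_opp_continuous x0 (eta : R) : 0 < eta -> exists2 e, 0 < e &
  forall y, `|y - x0| <= e -> `|sqrt_opp y - sqrt_opp x0| <= eta.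
Proof.
move=> eta0; have c : {for x0, continuous sqrt_opp}.
  apply: continuous_comp; last exact: sqrt_continuous.
  apply: continuous_max; [exact: opp_continuous|exact: cst_continuous].
move/cvgrPdist_le: c => /(_ _ eta0)/nbhs_normP[e /= e0 H]; exists (e / 2); first by rewrite divr_gt0.
move=> y ye; rewrite distrC; apply: H => /=; rewrite distrC; apply: le_lt_trans ye _.
by rewrite ltr_pdivrMr// ltr_pMr// ltrDl.
Qed.

Lemma sqrt_opp_gt0 x : x < 0 -> 0 < sqrt_opp x /\ - sqrt_opp x ^+ 2 = x.
Proof.
move=> x0; have m : Num.max (- x) 0 = - x by apply/max_idPl; rewrite oppr_ge0 ltW.
by rewrite /sqrt_opp m sqrtr_gt0 oppr_gt0 x0 sqr_sqrtr ?opprK// oppr_ge0 ltW.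
Qed.

Lemma sqrt_opp0 : sqrt_opp 0 = 0.
Proof. by rewrite /sqrt_opp oppr0 maxxx sqrtr0. Qed.

Lemma robin_order_eq0 al y : dD y%:C != 0 -> weyl y + al != 0 -> robin_order al y = 0%N.
Proof.
move=> Dy m0; apply/eqP; apply/negP => /negP/corank0P; rewrite det_robinE => e.
move/eqP: m0; apply; apply: (@complexI R).
have -> : (weyl y + al)%:C = (weyl y)%:C + al%:C by exact: rmorphD.
by rewrite -weylE -[al%:C](mulfK Dy) -mulrDl e mul0r.
Qed.

Lemma sign_jumps x0 : exists (e : R) (a1 a2 b1 b2 : bool), [/\ 0 < e,
  (a2 + dirichlet_order x0 = a1 + robin_order 0 x0)%N /\ (b2 + dirichlet_order x0 = b1 + robin_order (- sqrt_opp x0) x0)%N,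
  forall y, y != x0 -> `|y - x0| <= e -> [/\ robin_order 0 y = 0%N, robin_order (- sqrt_opp y) y = 0%N,
    (0 < weyl y) = if y < x0 then a1 else a2 &
    (0 < weyl y - sqrt_opp y) = if y < x0 then b1 else b2] &
  sqrt_opp x0 = 0 -> a1 = b1].
Proof.
have [a1 [a2 [Ea Ha]]] := sign_jump x0 0.
have Hb : exists b1 b2 : bool, [/\ (b2 + dirichlet_order x0 = b1 + robin_order (- sqrt_opp x0) x0)%N,
    sqrt_opp x0 = 0 -> a1 = b1 &
    exists2 e, 0 < e & forall y, y != x0 -> `|y - x0| <= e ->
      [/\ dD y%:C != 0, weyl y - sqrt_opp y != 0 & (0 < weyl y - sqrt_opp y) = if y < x0 then b1 else b2]].
  have [r0|r0] := eqVneq (sqrt_opp x0) 0.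
    exists a1, a2; split=> //; first by rewrite r0 oppr0.
    by apply: Ha; [exact: sqrt_opp_noninc|exact: sqrt_opp_continuous|rewrite r0 oppr0].
  have [b1 [b2 [Eb Hb]]] := sign_jump x0 (- sqrt_opp x0).
  exists b1, b2; split=> //; first by move/eqP: r0.
  by apply: Hb; [exact: sqrt_opp_noninc|exact: sqrt_opp_continuous|rewrite opprK].
have [b1 [b2 [Eb ab [e2 e20 He2]]]] := Hb.
have [||e1 e10 He1] := Ha (fun=> 0) (fun _ _ _ => lexx 0); last 2 first.
- by rewrite oppr0.
- exists (Num.min e1 e2), a1, a2, b1, b2; split=> //; first by rewrite lt_min e10.
  move=> y yx; rewrite le_min => /andP[/(He1 y yx)[D1 m1 s1] /(He2 y yx)[_ m2 s2]].
  split; [|exact: robin_order_eq0| |by []]; first by apply: robin_order_eq0 => //; rewrite addr0 -(subr0 (weyl y)).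
  by rewrite -s1 subr0.
by move=> eta eta0; exists 1 => // y _; rewrite subrr normr0 ltW.
Qed.

(** By induction along [- c, 0]: the sum of the orders of N minus the sum of the
    orders of N - sqrt_opp * D, over the points to the left of x, is the indicator of
    N / D > 0 minus that of N / D - sqrt_opp > 0, immediately to the left of x. Near
    any point only the point itself contributes, so that the finiteness of the set of
    zeros comes out of the same induction. *)
Lemma equal_total_orders : exists pts : seq R, [/\ uniq pts, all (fun y => y < 0) pts,
  forall y, y < 0 -> y \notin pts -> robin_order 0 y = 0%N /\ robin_order (- sqrt_opp y) y = 0%N &
  (\sum_(y <- pts) robin_order 0 y = \sum_(y <- pts) robin_order (- sqrt_opp y) y)%N].
Proof.
have [c c0 far] := weyl_lt0.
pose Inv x := exists (pts : seq R) (a b : bool), [/\ uniq pts, all (fun y => y < x) pts,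
  forall y, y < x -> y \notin pts -> robin_order 0 y = 0%N /\ robin_order (- sqrt_opp y) y = 0%N,
  exists2 e, 0 < e & forall y, x - e < y < x -> (0 < weyl y) = a /\ (0 < weyl y - sqrt_opp y) = b &
  (\sum_(y <- pts) robin_order 0 y + b = \sum_(y <- pts) robin_order (- sqrt_opp y) y + a)%N].
have base : Inv (- c).
  exists [::], false, false; split=> //; last first.
  - by rewrite !big_nil.
  - exists 1 => // y /andP[_ /far[_ m0]]; rewrite (lt_gtF m0); split=> //.
    by apply: lt_gtF; apply: le_lt_trans m0; rewrite gerBl sqrtr_ge0.
  - move=> y /far[D0 m0] _; split; apply: robin_order_eq0 => //.
      by rewrite addr0 lt_eqF.
    by rewrite lt_eqF// (le_lt_trans _ m0)// gerBl sqrtr_ge0.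
have step x : - c <= x <= 0 -> exists2 e, 0 < e &
    (forall y, - c <= y -> x - e < y < x -> Inv y -> Inv x) /\
    (forall y, x < y < x + e -> Inv x -> Inv y).
  move=> _; have [e [a1 [a2 [b1 [b2 [e0 [Ea Eb] H _]]]]]] := sign_jumps x.
  have Hl z : x - e < z < x -> [/\ robin_order 0 z = 0%N, robin_order (- sqrt_opp z) z = 0%N,
      (0 < weyl z) = a1 & (0 < weyl z - sqrt_opp z) = b1].
    move=> /andP[z1 z2]; have [||h1 h2 h3 h4] := H z; first by rewrite lt_eqF.
      by rewrite ler_norml; apply/andP; split; lra.
    by rewrite z2 in h3 h4.
  have Hr z : x < z < x + e -> [/\ robin_order 0 z = 0%N, robin_order (- sqrt_opp z) z = 0%N,
      (0 < weyl z) = a2 & (0 < weyl z - sqrt_opp z) = b2].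
    move=> /andP[z1 z2]; have [||h1 h2 h3 h4] := H z; first by rewrite gt_eqF.
      by rewrite ler_norml; apply/andP; split; lra.
    by rewrite (lt_gtF z1) in h3 h4.
  exists e => //; split=> y.
    move=> _ /andP[y1 y2] [pts [a [b [usq lt0 out [e1 e10 He1] S]]]].
    exists pts, a1, b1; split=> //.
    - by apply: sub_all lt0 => z zy; exact: lt_trans y2.
    - move=> z zx zs; have [zy|yz] := ltP z y; first exact: out.
      by have [] := Hl z; first by rewrite zx (lt_le_trans y1).
    - by exists e => // z /Hl[].
    - pose z := (Num.max (y - e1) (x - e) + y) / 2.
      have [zy ze1 zx] : [/\ z < y, y - e1 < z & x - e < z].
        have h1 : Num.max (y - e1) (x - e) < y by rewrite gt_max y1 andbT ltrBlDr ltrDl.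
        have h2 : y - e1 <= Num.max (y - e1) (x - e) by rewrite le_max lexx.
        have h3 : x - e <= Num.max (y - e1) (x - e) by rewrite le_max lexx orbT.
        by rewrite /z; split; lra.
      have [ea eb] := He1 z (introT andP (conj ze1 zy)).
      have [_ _ ea1 eb1] := Hl z (introT andP (conj zx (lt_trans zy y2))).
      by rewrite -ea1 -eb1 ea eb.
  move=> /andP[y1 y2] [pts [a [b [usq lt0 out [e1 e10 He1] S]]]].
  have xs : x \notin pts by apply/negP => /(allP lt0); rewrite ltxx.
  have [aE bE] : a = a1 /\ b = b1.
    pose z := (Num.max (x - e1) (x - e) + x) / 2.
    have [zy ze1 zx] : [/\ z < x, x - e1 < z & x - e < z].
      have h1 : Num.max (x - e1) (x - e) < x by rewrite gt_max !ltrBlDr !ltrDl e10.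
      have h2 : x - e1 <= Num.max (x - e1) (x - e) by rewrite le_max lexx.
      have h3 : x - e <= Num.max (x - e1) (x - e) by rewrite le_max lexx orbT.
      by rewrite /z; split; lra.
    have [ea eb] := He1 z (introT andP (conj ze1 zy)).
    have [_ _ ea1 eb1] := Hl z (introT andP (conj zx zy)).
    by rewrite -ea1 -eb1 ea eb.
  exists (x :: pts), a2, b2; split.
  - by rewrite /= xs.
  - by rewrite /= y1; apply: sub_all lt0 => z zy; exact: lt_trans y1.
  - move=> z zy; rewrite inE negb_or => /andP[zx zs].
    have [zx'|xz|zE] := ltgtP z x; [exact: out| |by rewrite zE eqxx in zx].
    by have [] := Hr z; first by rewrite xz (lt_trans zy).
  - exists (y - x); first by rewrite subr_gt0.
    move=> z; rewrite opprB addrC subrK => /andP[xz zy].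
    by have [] := Hr z; first by rewrite xz (lt_trans zy).
  - rewrite !big_cons; move: S Ea Eb; rewrite aE bE.
    move: (\sum_(_ <- _) _)%N (\sum_(_ <- _) _)%N (robin_order _ _) (robin_order _ _) (dirichlet_order _).
    by clear; case: a1 a2 b1 b2 => [] [] [] [] /=; lia.
have [|pts [a [b [usq lt0 out [e e0 He] S]]]] := real_induction _ base step.
  by rewrite oppr_le0.
exists pts; split=> //.
have [e' [a1 [a2 [b1 [b2 [e'0 _ H ab]]]]]] := sign_jumps 0.
pose z := - Num.min e e' / 2.
have m0 : 0 < Num.min e e' by rewrite lt_min e0.
have me : Num.min e e' <= e by rewrite ge_min lexx.
have me' : Num.min e e' <= e' by rewrite ge_min lexx orbT.
have z0 : z < 0 by rewrite /z; lra.
have [|ea eb] := He z; first by apply/andP; split=> //; rewrite /z; lra.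
have [||_ _ ea1 eb1] := H z; first by rewrite lt_eqF.
  by rewrite subr0 ltr0_norm// /z; lra.
by move: S; rewrite -ea -eb ea1 eb1 z0 (ab sqrt_opp0) => /addIn.
Qed.

End Counting.

Lemma kernel_basis (F : fieldType) n (M : 'M[F]_n) :
  exists B : 'M[F]_(n, n - \rank M), [/\ M *m B = 0,
    forall v : 'cV_n, M *m v = 0 -> exists a, v = B *m a &
    forall a : 'cV_(n - \rank M), B *m a = 0 -> a = 0].
Proof.
have : \rank (kermx M^T) = (n - \rank M)%N by rewrite mxrank_ker mxrank_tr.
case: _ / => /=; exists (row_base (kermx M^T))^T; split.
- apply: trmx_inj; rewrite trmx_mul trmxK trmx0; apply/sub_kermxP.
  by rewrite eq_row_base.
- move=> v Mv; have : (v^T <= row_base (kermx M^T))%MS.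
    by rewrite eq_row_base; apply/sub_kermxP; rewrite -trmx_mul Mv trmx0.
  by move=> /submxP[D vD]; exists D^T; rewrite -trmx_mul -vD trmxK.
- move=> a Ba; apply: trmx_inj; rewrite trmx0.
  apply: (row_free_inj (row_base_free (kermx M^T))); rewrite mul0mx.
  by rewrite -[row_base _]trmxK -trmx_mul Ba trmx0.
Qed.

(** * Eigenspaces as kernels of matrices *)
Section EigenspaceOfKernel.
Variables (R : realType) (I : Type) (D : I -> set R).
Local Notation C := R[i].
Variables (L : (I -> R -> C) -> (I -> R -> C) -> Prop) (lam : C) (n : nat) (M : 'M[C]_n)
  (Y : 'cV[C]_n -> I -> R -> C).
Hypothesis Ylin : forall m (a : 'I_m -> C) (b : 'I_m -> 'cV[C]_n) i x,
  Y (\sum_(k < m) a k *: b k) i x = \sum_(k < m) a k * Y (b k) i x.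
Hypothesis Yker : forall v, M *m v = 0 -> eigenfunction L lam (Y v).
Hypothesis Ysurj : forall y, eigenfunction L lam y ->
  exists2 v, M *m v = 0 & eqL2 D y (Y v).
Hypothesis Yinj : forall v, M *m v = 0 -> eqL2 D (Y v) (fun _ _ => 0) -> v = 0.

(** Y is a linear parametrization of solutions which maps the kernel of M bijectively
    onto the eigenspace. *)
Lemma eigenspace_dim_kernel : eigenspace_dim D L lam (n - \rank M).
Proof.
have [B [MB Bs Bi]] := kernel_basis M.
have BE (a : 'I_(n - \rank M) -> C) : B *m \col_k a k = \sum_k a k *: col k B.
  apply/colP => x; rewrite !mxE summxE; apply: eq_bigr => k _; by rewrite !mxE mulrC.
have YE a : lincomb a (fun k => Y (col k B)) = Y (B *m \col_k a k).
  by apply/funext => i; apply/funext => x; rewrite BE Ylin.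
exists (fun k => Y (col k B)); split.
- by move=> k; apply: Yker; rewrite colE mulmxA MB mul0mx.
- move=> a; rewrite YE => /Yinj; rewrite mulmxA MB mul0mx => /(_ erefl)/Bi/colP h k.
  by have := h k; rewrite !mxE.
- move=> y /Ysurj[v /Bs[a ->] yv]; exists (fun k => a k 0); rewrite YE.
  by have -> : \col_k a k 0 = a by apply/colP => k; rewrite mxE.
Qed.

Lemma eigenvalue_kernel : eigenvalue_of D L lam <-> \det M = 0.
Proof.
split=> [[y /Ysurj[v Mv yv] y0]|/det0_vector[v v0 Mv]].
  apply/eqP; apply: contra_notT y0 => dM.
  have v0 : v = 0.
    by rewrite -[v]mul1mx -(@mulVmx _ _ M) ?unitmxE ?unitfE// -mulmxA Mv mulmx0.
  move=> i; apply: ae_eq_trans (yv i) _; apply: nearW => x _.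
  have -> : v = \sum_(k < 0) (fun=> 0) k *: (fun=> 0) k by rewrite big_ord0.
  by rewrite Ylin big_ord0.
exists (Y v); first exact: Yker.
by move=> /(Yinj Mv) v00; rewrite v00 eqxx in v0.
Qed.

End EigenspaceOfKernel.

(** * Solutions on the lead *)
Section Exponentials.
Variable R : realType.
Local Notation C := R[i].
Local Notation mu := (@lebesgue_measure R).

Lemma exp_continuous (c : R) : continuous (fun x => expR (c * x)).
Proof.
move=> x; apply: continuous_comp; last exact: continuous_expR.
by apply: continuousM => //; exact: cst_continuous.
Qed.

Lemma exp_rAC (c l : R) : 0 <= l -> rAC l (fun x => expR (c * x)) (fun x => c * expR (c * x)).
Proof.
move=> l0; have cf : continuous (fun x : R => c * expR (c * x)).
  by move=> x; exact: (continuousM (@cst_continuous _ _ c x) (@exp_continuous c x)).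
split; first by apply: within_intg; exact: continuous_subspaceT.
move=> x /andP[x0 xl]; have [->|xn] := eqVneq x 0; first by rewrite rint0 addr0.
have xp : 0 < x by rewrite lt_def xn.
have dE (y : R) : is_derive y 1 (fun x => expR (c * x)) (c * expR (c * y)).
  have h : is_derive y 1 (fun x => c * x) c.
    by have := @is_deriveZ R R^o R^o id c y 1 1 (is_derive_id _ _); rewrite /GRing.scale/= mulr1.
  have := is_derive1_comp (is_derive_expR (c * y)) h.
  by rewrite mulrC.
rewrite rintE /Rintegral (@continuous_FTC2 _ _ (fun x => expR (c * x)) 0 x)//=.
- by rewrite addrCA subrr addr0.
- exact: continuous_subspaceT.
- split.
  + by move=> y _; exact: (@ex_derive _ _ _ _ _ _ _ (dE y)).
  + by apply: cvg_at_right_filter; exact: exp_continuous.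
  + by apply: cvg_at_left_filter; exact: exp_continuous.
- by move=> y _; rewrite derive1E; exact: (@derive_val _ _ _ _ _ _ _ (dE y)).
Qed.

Definition cexp (c x : R) : C := (expR (c * x))%:C.

(** Stated on [0, l] for every l, so that the lead can be exhausted by edges. *)
Lemma cexp_sol (c l : R) : 0 <= l -> sol l (fun=> 0) (- c ^+ 2)%:C (cexp c) (fun x => c%:C * cexp c x).
Proof.
move=> l0; have h : cAC l (cexp c) (fun x => c%:C * cexp c x).
  split; first by apply: eq_rAC (exp_rAC c l0) => x _ //=; ring.
  apply: eq_rAC (rAC_cst l 0) => x _ //=; ring.
split=> //; apply: eq_cAC (cACZ c%:C l0 h) => x _ //.
by apply: complexP; rewrite !RI /=; ring.
Qed.

Lemma lead_measurable : measurable (@lead R).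
Proof. exact: measurable_itv. Qed.

Lemma L2_exp (t : R) : 0 < t -> L2 (@lead R) (fun x => expR (- t * x)).
Proof.
move=> t0; apply/(L2P _ lead_measurable); split.
  by apply: measurable_funTS; apply: continuous_measurable_fun; exact: exp_continuous.
have t2 : 0 < 2 * t by rewrite mulr_gt0.
have h : mu.-integrable (@lead R) (EFin \o exponential_pdf (2 * t)).
  by apply: integrableS (integrable_exponential_pdf t2) => //; exact: lead_measurable.
have h' := integrableZl (mu := mu) lead_measurable (2 * t)^-1 h.
apply: eq_integrable h' => [|x]; first exact: lead_measurable.
rewrite inE /lead/= in_itv/= andbT => x0; rewrite -EFinM; congr (_%:E).
rewrite exponential_pdfE// mulKf ?gt_eqF// expr2 -expRD; congr expR; ring.
Qed.

Lemma L2_sub (A B : set R) f : measurable A -> measurable B -> A `<=` B -> L2 B f -> L2 A f.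
Proof.
move=> mA mB AB /(L2P _ mB)[mf fi]; apply/(L2P _ mA); split.
  exact: measurable_funS mf.
exact: integrableS fi.
Qed.

(** The lead has infinite measure. *)
Lemma L2_cst_lead (c : R) : L2 (@lead R) (fun=> c) -> c = 0.
Proof.
move=> /(L2P _ lead_measurable)[_ /integrableP[_]].
apply: contraPeq => c0.
have c2 : 0 < `|c ^+ 2| by rewrite normr_gt0 expf_neq0.
have lead_oo : mu (@lead R) = +oo%E by rewrite /lead lebesgue_measure_itv/= ltry.
rewrite /= integral_cst; last exact: lead_measurable.
by rewrite [X in (_ * X)%E](lead_oo : _ = +oo%E) gt0_muley// ltxx.
Qed.

End Exponentials.

(** * Eigenfunctions on the tree *)
Section TreeEigenfunctions.
Variables (R : realType) (g : nat) (hg : (0 < g)%N) (T : rooted_tree g) (l : R)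
  (hl : 0 < l) (q : 'I_g -> R -> R) (hq : forall j, L2 (edge l) (q j)).
Local Notation C := R[i].
Local Notation mu := (@lebesgue_measure R).
Local Notation src := (@src g T).
Local Notation tgt := (@tgt g T).
Local Notation root := (Defs.root T).
Local Notation robin_mx := (robin_mx T l q).
Local Notation root_ord := (root_ord hg).

Let l0 : 0 <= l := ltW hl.

Lemma ae_eq0_sqnorm (y : R -> C) : ccont l y -> ae_eq mu (edge l) y (fun=> 0) -> sqnorm l y = 0.
Proof.
move=> cy y0; rewrite /sqnorm.
rewrite (@rint_ae _ l (fun x => sqabs (y x)) (fun=> 0)).
- by rewrite rint_cst ?mul0r.
- exact: within_measurable (within_sqabs cy).
- exact: measurable_cst.
- by apply: filterS y0 => x h xl; rewrite (h xl) /sqabs /= expr0n addr0.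
Qed.

Lemma initial_data_eq0 lam v :
  eqL2 (fun=> edge l) (fun j => ysol l q lam (initial_data v).1 (initial_data v).2 j) (fun _ _ => 0) -> v = 0.
Proof.
move=> h; apply/eqP; apply: contraT => /(initial_data_neq0 hl hq lam).
rewrite /tree_sqnorm big1 ?ltxx// => j _; apply: ae_eq0_sqnorm; last exact: h.
by have [[yA _] _ _] := ysolP hl hq lam (initial_data v).1 (initial_data v).2 j; exact: cAC_cont yA.
Qed.

Lemma initial_data_lin m (a : 'I_m -> C) (b : 'I_m -> 'cV[C]_(g + g)) :
  let v := \sum_(k < m) a k *: b k in
  (initial_data v).1 = (fun j => \sum_k a k * (initial_data (b k)).1 j) /\
  (initial_data v).2 = (fun j => \sum_k a k * (initial_data (b k)).2 j).
Proof.
by move=> v; split; apply/funext => j; rewrite /initial_data/= /v summxE; apply: eq_bigr => k _; rewrite mxE.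
Qed.

Lemma ysol_lin lam m (a : 'I_m -> C) (b : 'I_m -> 'cV[C]_(g + g)) j x :
  let v := \sum_(k < m) a k *: b k in
  ysol l q lam (initial_data v).1 (initial_data v).2 j x =
  \sum_(k < m) a k * ysol l q lam (initial_data (b k)).1 (initial_data (b k)).2 j x.
Proof.
move=> v; have [-> ->] := initial_data_lin a b.
by rewrite /ysol !mulr_suml -big_split/=; apply: eq_bigr => k _; rewrite mulrDr !mulrA.
Qed.

(** A function in the domain solves the equation, and is determined by its initial
    data on each edge; the vertex conditions then say that the data lie in the
    kernel. *)
Lemma edge_surj lam be al (y dy ddy : 'I_g -> R -> C) (A : C) :
  (forall j, H2 (edge l) (y j) (dy j) (ddy j)) ->
  (forall j, ae_eq mu (edge l) (fun x => lam * y j x) (fun x => - ddy j x + (q j x)%:C * y j x)) ->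
  inner_conditions T l y dy -> (forall k, src k = root -> y k 0 = A) ->
  be * \sum_(k < g | src k == root) dy k 0 + al * A = 0 ->
  exists2 v, robin_mx be al lam *m v = 0 & [/\ (initial_data v).1 root_ord = A &
    eqL2 (fun=> edge l) y (ysol l q lam (initial_data v).1 (initial_data v).2)].
Proof.
move=> yH yE inner yr bc.
have ys j : sol l (q j) lam (y j) (dy j).
  by apply: (H2_sol l0 (hq j) (yH j)); exact: ae_eq_sym.
have ll : 0 <= l <= l by rewrite l0 lexx.
have yb j x xl := sol_basis l0 (hq j) (ys j) (x := x) xl.
have rA : y root_ord 0 = A.
  by apply: yr; apply/eqP; rewrite src_root_lt; exact: root_degree_gt0.
exists (col_mx (\col_j y j 0) (\col_j dy j 0)).
  rewrite (robin_mx_mul hg); apply/(residual0P hg); split.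
  - by move=> j k jk; rewrite -(yb j l ll).1; exact: (inner j).1.
  - by move=> j; rewrite -(yb j l ll).2; exact: (inner j).2.
  - by move=> k kr; rewrite rA yr.
  - by rewrite rA.
have d1 : (initial_data (col_mx (\col_j y j 0) (\col_j dy j 0))).1 = fun j => y j 0.
  by apply/funext => j; rewrite /initial_data/= col_mxEu mxE.
have d2 : (initial_data (col_mx (\col_j y j 0) (\col_j dy j 0))).2 = fun j => dy j 0.
  by apply/funext => j; rewrite /initial_data/= col_mxEd mxE.
rewrite d1 d2; split=> // j; apply: nearW => x /edgeP xl.
by rewrite /ysol; exact: (yb j x xl).1.
Qed.

Lemma edge_ker lam be al v : robin_mx be al lam *m v = 0 ->
  let y := ysol l q lam (initial_data v).1 (initial_data v).2 in
  let dy := dysol l q lam (initial_data v).1 (initial_data v).2 in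
  [/\ forall j, H2 (edge l) (y j) (dy j) (fun x => ((q j x)%:C - lam) * y j x),
    inner_conditions T l y dy, forall k, src k = root -> y k 0 = (initial_data v).1 root_ord,
    be * \sum_(k < g | src k == root) dy k 0 + al * (initial_data v).1 root_ord = 0 &
    forall j, ae_eq mu (edge l) (fun x => lam * y j x)
      (fun x => - (((q j x)%:C - lam) * y j x) + (q j x)%:C * y j x)].
Proof.
move=> /(robin_mx_ker hg hl hq)[[h1 h2 h3] h4] y dy; split=> //.
- by move=> j; apply: sol_H2 => //; have [] := ysolP hl hq lam (initial_data v).1 (initial_data v).2 j.
- by move=> j; split; [exact: h1|exact: h2].
- by move=> j; apply: ae_eq_sym; exact: sol_ae.
Qed.

Lemma L_N_kernel lam : eigenspace_dim (fun=> edge l) (L_N T l q) lam (corank T l q 1 0 lam) /\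
  (eigenvalue_of (fun=> edge l) (L_N T l q) lam <-> \det (robin_mx 1 0 lam) = 0).
Proof.
pose Y v := ysol l q lam (initial_data v).1 (initial_data v).2.
have Yker v : robin_mx 1 0 lam *m v = 0 -> eigenfunction (L_N T l q) lam (Y v).
  move=> /edge_ker[yH inner yr bc yE]; exists (dysol l q lam (initial_data v).1 (initial_data v).2).
  eexists; split; [exact: yH| |exact: yE].
  split=> //; split=> [j k jr kr|]; first by rewrite /Y (yr j jr) (yr k kr).
  by move: bc; rewrite mul1r mul0r addr0.
have Ysurj y : eigenfunction (L_N T l q) lam y ->
    exists2 v, robin_mx 1 0 lam *m v = 0 & eqL2 (fun=> edge l) y (Y v).
  move=> [dy [ddy [yH [inner [yr bc]] yE]]].
  have [] := @edge_surj lam 1 0 y dy ddy (y root_ord 0) yH yE inner.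
  - by move=> k kr; apply: yr => //; apply/eqP; rewrite src_root_lt; exact: root_degree_gt0.
  - by rewrite bc mulr0 mul0r addr0.
  - by move=> v Mv [_ yv]; exists v.
have Yinj v : robin_mx 1 0 lam *m v = 0 -> eqL2 (fun=> edge l) (Y v) (fun _ _ => 0) -> v = 0.
  by move=> _; exact: initial_data_eq0.
by split; [apply: (eigenspace_dim_kernel (Y := Y))|apply: (eigenvalue_kernel (Y := Y))] => //;
  move=> *; exact: ysol_lin.
Qed.

Lemma lead_H2 (t : R) (A : C) : 0 < t ->
  H2 (@lead R) (fun x => A * cexp (- t) x) (fun x => - t%:C * (A * cexp (- t) x))
    (fun x => (t ^+ 2)%:C * (A * cexp (- t) x)).
Proof.
move=> t0.
have EL (B : C) : CL2 (@lead R) (fun x => B * cexp (- t) x).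
  split; (apply: eq_L2; last by apply: (L2Z _ (L2_exp t0)); shelve) => x _; rewrite !RI /=.
    by rewrite mulr0 subr0.
  by rewrite mulr0 add0r.
have pr (y dy : R -> C) : (forall X, 0 <= X -> cAC X y dy) -> primitive (@lead R) y dy.
  move=> h x; rewrite /lead/= in_itv/= andbT => x0.
  by apply: (cAC_primitive (h x x0)); apply/edgeP; rewrite x0 lexx.
split.
- exact: EL.
- have -> : (fun x => - t%:C * (A * cexp (- t) x)) = (fun x => (- t%:C * A) * cexp (- t) x).
    by apply/funext => x; rewrite mulrA.
  exact: EL.
- have -> : (fun x => (t ^+ 2)%:C * (A * cexp (- t) x)) = (fun x => ((t ^+ 2)%:C * A) * cexp (- t) x).
    by apply/funext => x; rewrite mulrA.
  exact: EL.
- apply: pr => X X0; have [h _] := cexp_sol (- t) X0.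
  by apply: eq_cAC (cACZ A X0 h) => x _ //=; rewrite rmorphN; ring.
- apply: pr => X X0; have [_ h] := cexp_sol (- t) X0.
  apply: eq_cAC (cACZ A X0 h) => x _ //=; first by rewrite rmorphN; ring.
  by rewrite sqrrN !rmorphN; ring.
Qed.

(** On every interval [0, X] the solution is A exp (t x) + B exp (- t x), with the same
    A and B. As y and exp (- t x) are square-integrable, so is A exp (t x), and after
    multiplication by the bounded function exp (- t x) the constant A is
    square-integrable too, hence 0. *)
Lemma lead_surj (t : R) (y dy ddy : R -> C) : 0 < t -> H2 (@lead R) y dy ddy ->
  ae_eq mu (@lead R) (fun x => (- t ^+ 2)%:C * y x) (fun x => - ddy x + 0%:C * y x) ->
  (forall x, 0 <= x -> y x = y 0 * cexp (- t) x) /\ dy 0 = - t%:C * y 0.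
Proof.
move=> t0 [yL dyL ddyL yp dyp] yE.
have sub X : edge X `<=` @lead R.
  by move=> x /=; rewrite /edge /lead/= !in_itv/= andbT => /andP[].
have CL2s X f : CL2 (@lead R) f -> CL2 (edge X) f.
  by move=> [h1 h2]; split; (apply: L2_sub; [exact: measurable_edge|exact: lead_measurable|exact: sub|]).
have ys X : 0 <= X -> sol X (fun=> 0) (- t ^+ 2)%:C y dy.
  move=> X0; apply: (H2_sol X0 (ddy := ddy)).
  - by apply: (L2_bounded (M := 0)); [exact: measurable_cst|move=> *; rewrite normr0].
  - by split; try exact: CL2s; move=> x /sub; [exact: yp|exact: dyp].
  - apply: ae_eq_sym; apply: ae_eq_subset yE; exact: sub.
(* the coefficients of the two exponentials, from the initial values *)
pose A := (y 0 + t^-1%:C * dy 0) / 2; pose B := (y 0 - t^-1%:C * dy 0) / 2.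
have t1 : t%:C * t^-1%:C = 1 :> C by rewrite -rmorphM divff// gt_eqF.
have yAB x : 0 <= x -> y x = A * cexp t x + B * cexp (- t) x.
  move=> x0; have qL : L2 (edge x) (fun=> 0 : R).
    by apply: (L2_bounded (M := 0)); [exact: measurable_cst|move=> *; rewrite normr0].
  have e1 := cexp_sol t x0; have e2 := cexp_sol (- t) x0; rewrite sqrrN in e2.
  have c0 s : cexp s 0 = 1 :> C by rewrite /cexp mulr0 expR0.
  have h0 : y 0 = A * cexp t 0 + B * cexp (- t) 0 by rewrite !c0 /A /B; move: (t^-1%:C) => b; field.
  have h1 : dy 0 = A * (t%:C * cexp t 0) + B * ((- t)%:C * cexp (- t) 0).
    have -> : (- t)%:C = - t%:C by exact: rmorphN.
    rewrite !c0 /A /B; move: t1; move: (t%:C) (t^-1%:C) => a b ab.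
    transitivity ((a * b) * dy 0); [by rewrite ab mul1r|by field].
  have xx : 0 <= x <= x by rewrite x0 lexx.
  by have [-> _] := sol_unique x0 qL (ys x x0) (sol_lin x0 A B e1 e2) h0 h1 xx.
have A0 : A = 0.
  have L1 : CL2 (@lead R) (fun x => A * cexp t x).
    have EL (D : C) : CL2 (@lead R) (fun x => D * cexp (- t) x) by have [] := lead_H2 D t0.
    have [h1 h2] := EL (- B); move: yL => [y1 y2].
    have Ax x : lead x -> A * cexp t x = y x + - B * cexp (- t) x.
      by rewrite /lead/= in_itv/= andbT => x0; rewrite (yAB x x0); ring.
    split; [apply: eq_L2 (L2D y1 h1)|apply: eq_L2 (L2D y2 h2)] => x /Ax ->.
      exact: esym (ReD _ _).
    exact: esym (ImD _ _).
  have key (a : R) : L2 (@lead R) (fun x => a * expR (t * x)) -> a = 0.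
    move=> h; apply: L2_cst_lead.
    have mE : measurable_fun (@lead R) (fun x => expR (- t * x)).
      by apply: measurable_funTS; apply: continuous_measurable_fun; exact: exp_continuous.
    have h' := L2M_bounded (M := 1) (@lead_measurable R) h mE.
    apply: eq_L2 (h' _).
      by move=> x _; rewrite -mulrA -expRD mulNr subrr expR0 mulr1.
    move=> x; rewrite /lead/= in_itv/= andbT => x0.
    by rewrite ger0_norm ?expR_ge0// -expR0 ler_expR mulNr oppr_le0 mulr_ge0// ltW.
  move: L1 => [h1 h2]; apply: complexP; apply: key.
    by apply: eq_L2 h1 => x _; rewrite !RI /= mulr0 subr0.
  by apply: eq_L2 h2 => x _; rewrite !RI /= mulr0 add0r.
have e : y 0 + t^-1%:C * dy 0 = 0.
  by move: A0; rewrite /A => /eqP; rewrite mulf_eq0 invr_eq0 pnatr_eq0 orbF => /eqP.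
have dyE : dy 0 = - t%:C * y 0.
  have -> : y 0 = - (t^-1%:C * dy 0) by apply/eqP; rewrite -addr_eq0 e.
  by rewrite mulrNN mulrA t1 mul1r.
split=> // x x0; rewrite (yAB x x0) A0 mul0r add0r /B dyE.
have -> : t^-1%:C * (- t%:C * y 0) = - y 0 by rewrite mulNr mulrN mulrA (mulrC t^-1%:C) t1 mul1r.
by congr (_ * _); field.
Qed.

(** The lead contributes y'(0) = - t y(0) to the sum of the derivatives at the
    root: this is the Robin condition with al = - t. *)
Lemma L_inf_kernel (t : R) : 0 < t -> let lam := (- t ^+ 2)%:C in
  eigenspace_dim (lead_domain l) (L_inf T l q) lam (corank T l q 1 (- t)%:C lam) /\
  (eigenvalue_of (lead_domain l) (L_inf T l q) lam <-> \det (robin_mx 1 (- t)%:C lam) = 0).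
Proof.
move=> t0 lam.
pose Y v (o : option 'I_g) := if o is Some j then ysol l q lam (initial_data v).1 (initial_data v).2 j
  else fun x => (initial_data v).1 root_ord * cexp (- t) x.
have c0 s : cexp s 0 = 1 :> C by rewrite /cexp mulr0 expR0.
have Yker v : robin_mx 1 (- t)%:C lam *m v = 0 -> eigenfunction (L_inf T l q) lam (Y v).
  move=> /edge_ker[yH inner yr bc yE].
  exists (fun o => if o is Some j then dysol l q lam (initial_data v).1 (initial_data v).2 j
    else fun x => - t%:C * ((initial_data v).1 root_ord * cexp (- t) x)).
  exists (fun o => if o is Some j then
      fun x => ((q j x)%:C - lam) * ysol l q lam (initial_data v).1 (initial_data v).2 j x
    else fun x => (t ^+ 2)%:C * ((initial_data v).1 root_ord * cexp (- t) x)).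
  split.
  - by case=> [j|] /=; [exact: yH|exact: lead_H2].
  - split=> //; split=> [k kr|]; rewrite /= c0 mulr1; first by rewrite yr.
    by move: bc; rewrite mul1r addrC rmorphN.
  - case=> [j|] /=; first exact: yE.
    by apply: nearW => x _; rewrite mul0r addr0 /lam rmorphN mulNr.
have Ysurj y : eigenfunction (L_inf T l q) lam y ->
    exists2 v, robin_mx 1 (- t)%:C lam *m v = 0 & eqL2 (lead_domain l) y (Y v).
  move=> [dy [ddy [yH [inner [yr bc]] yE]]].
  have [y0E dy0E] := lead_surj t0 (yH None) (yE None).
  have [] := @edge_surj lam 1 (- t)%:C (fun j => y (Some j)) (fun j => dy (Some j))
    (fun j => ddy (Some j)) (y None 0) (fun j => yH (Some j)) (fun j => yE (Some j)) inner.
  - by move=> k kr; rewrite (yr k kr).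
  - by move: bc; rewrite dy0E mul1r addrC rmorphN.
  - move=> v Mv [va yv]; exists v => // -[j|]; first exact: yv.
    apply: nearW => x; rewrite /lead_domain /lead/= in_itv/= andbT => x0.
    by rewrite -[v (lshift g root_ord) 0]/((initial_data v).1 root_ord) va; exact: y0E.
have Yinj v : robin_mx 1 (- t)%:C lam *m v = 0 -> eqL2 (lead_domain l) (Y v) (fun _ _ => 0) -> v = 0.
  by move=> _ h; apply: (initial_data_eq0 (lam := lam)) => j; exact: (h (Some j)).
have Ylin m (a : 'I_m -> C) (b : 'I_m -> 'cV[C]_(g + g)) i x :
    Y (\sum_(k < m) a k *: b k) i x = \sum_(k < m) a k * Y (b k) i x.
  case: i => [j|]; first exact: ysol_lin.
  by rewrite /Y (initial_data_lin a b).1 mulr_suml; apply: eq_bigr => k _; rewrite mulrA.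
by split; [apply: (eigenspace_dim_kernel (Y := Y))|apply: (eigenvalue_kernel (Y := Y))].
Qed.

End TreeEigenfunctions.

Lemma zero_orderZ (R : realType) (c : R[i]) f (z0 : R[i]) m : c != 0 ->
  zero_order f z0 m -> zero_order (fun z => c * f z) z0 m.
Proof.
move=> c0 [h h0 hn]; exists (fun z => c * h z); first by rewrite mulf_neq0.
apply: filterS hn => z [dz ->]; split; last by rewrite mulrCA.
by move: dz; rewrite -!cdvE => dz; apply: cdvM => //; exact: cdv_cst.
Qed.

(** * The four numbers *)

(** Points where k vanishes are allowed in the list and removed here. *)
Lemma number_of_image (R : realType) (S : set R[i]) mult (f : R -> R[i]) (h : R[i] -> R)
  (k : R -> nat) (pts : seq R) : uniq pts -> {in pts, cancel f h} ->
  (forall z, S z <-> exists2 x, x \in pts & k x != 0%N /\ z = f x) ->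
  (forall x, x \in pts -> mult (f x) (k x)) ->
  number_with_mult S mult (\sum_(x <- pts) k x)%N.
Proof.
move=> usq fK SE kM; pose pts' := [seq x <- pts | k x != 0%N].
have sub x : x \in pts' -> x \in pts by rewrite mem_filter => /andP[].
exists (map f pts'), (fun z => k (h z)); split.
- rewrite map_inj_in_uniq ?filter_uniq// => x y /sub xs /sub ys fxy.
  by rewrite -(fK x xs) fxy fK.
- apply/seteqP; split=> z /=.
    move=> /mapP[x]; rewrite mem_filter => /andP[kx xs] ->.
    by apply/SE; exists x.
  move=> /SE[x xs [kx ->]]; apply/mapP; exists x => //.
  by rewrite mem_filter kx.
- by move=> z /mapP[x /sub xs ->]; rewrite fK//; exact: kM.
- rewrite big_map big_filter [RHS]big_mkcond/=; apply: eq_big_seq => x xs.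
  by rewrite fK//; case: eqP => [->|].
Qed.

Section Zeros.
Variables (R : realType) (g : nat) (hg : (0 < g)%N) (T : rooted_tree g) (l : R)
  (hl : 0 < l) (q : 'I_g -> R -> R) (hq : forall j, L2 (edge l) (q j)) (s : 'S_(g + g)).
Local Notation C := R[i].
Local Notation robin_mx := (robin_mx T l q).
Local Notation robin_order := (robin_order T l q).

Lemma sign_neq0 : (-1) ^+ s != 0 :> C.
Proof. by rewrite signr_eq0. Qed.

Lemma jost_eq0 (z : C) :
  jost T l q s z = 0 <-> \det (robin_mx 1 ((0 +i* 1) * z) (z ^+ 2)) = 0.
Proof.
rewrite (jostE hg); split=> [/eqP|->]; last by rewrite mulr0.
by rewrite mulf_eq0 (negbTE sign_neq0) => /eqP.
Qed.

Lemma jost_imag_eq0 (t : R) : jost T l q s (0 +i* t) = 0 <-> robin_order (- t) (- t ^+ 2) != 0%N.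
Proof.
rewrite jost_eq0 /robin_order; have -> : (0 +i* 1) * (0 +i* t) = (- t)%:C :> C by apply: complexP; rewrite /=; ring.
have -> : (0 +i* t) ^+ 2 = (- t ^+ 2)%:C :> C by apply: complexP; rewrite expr2 /=; ring.
by split=> /corank0P.
Qed.

Lemma phi_N_eq0 (x : R) : phi_N T l q s x%:C = 0 <-> robin_order 0 x != 0%N.
Proof.
rewrite phi_NE /robin_order; split=> [/eqP|/corank0P ->]; last by rewrite mulr0.
by rewrite mulf_eq0 (negbTE sign_neq0) => /eqP h; apply/corank0P.
Qed.

(** Real and imaginary part of the energy identity for al = i * zeta and
    lam = zeta ^ 2: for zeta = a + i * b they are F - (a ^ 2 - b ^ 2) * n = - b * s and
    - 2 * a * b * n = a * s. *)
Lemma jost_zeros : exists2 M : R, 0 < M & forall z : C, jost T l q s z = 0 ->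
  complex.Im z <= 0 \/ exists2 t : R, 0 < t <= M & z = 0 +i* t.
Proof.
have [c c0 h] := singular_energy hg T hl hq; exists (c + 1); first by rewrite ltr_wpDl.
move=> z /jost_eq0 /(h 1 _ _ (or_introl erefl))[n [F [e [n0 e0 Fn E]]]].
have [|] := leP (complex.Im z) 0; first by left.
case: z E => a b E /= b0; right.
have Er : F - (a * a - b * b) * n = - b * e.
  by move/(congr1 (@complex.Re R)): E; rewrite mul1r expr2 !RI /=; lra.
have Ei : - (a * b + b * a) * n = a * e.
  by move/(congr1 (@complex.Im R)): E; rewrite mul1r expr2 !RI /=; lra.
have a0 : a = 0.
  have : a * (e + 2 * (b * n)) = 0 by rewrite mulrDr -Ei; ring.
  move/eqP; rewrite mulf_eq0 => /orP[/eqP//|]; rewrite gt_eqF//.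
  by rewrite ltr_wpDl// !mulr_gt0.
exists b; last by rewrite a0.
rewrite b0 a0 in Er *; have be : 0 <= b * e by rewrite mulr_ge0// ltW.
have : b * b * n <= c * n by move: Er Fn be; rewrite mul0r sub0r !mulNr; lra.
rewrite ler_pM2r// => bc; rewrite leNgt; apply/negP => cb.
have : 1 * b <= b * b by rewrite ler_pM2r//; lra.
lra.
Qed.

Lemma negativeP (z : C) : z < 0 <-> exists2 x : R, x < 0 & z = x%:C.
Proof.
split=> [|[x x0 ->]]; last by rewrite ltcR.
by rewrite ltcE/= => /andP[/eqP i0 r0]; exists (complex.Re z) => //; apply: complexP.
Qed.

Lemma equal_numbers : exists n : nat,
     [/\ number_of_zeros (jost T l q s) (@positive_imaginary_axis R) n,
         number_of_zeros (phi_N T l q s) (@negative_axis R) n,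
         number_of_eigenvalues (fun=> edge l) (L_N T l q)
           (@negative_axis R) n &
         number_of_eigenvalues (lead_domain l) (L_inf T l q)
           (@negative_axis R) n].
Proof.
have [pts [usq neg out S]] := equal_total_orders hg T hl hq.
have neg' x : x \in pts -> x < 0 by move=> /(allP neg).
have inN x : x < 0 -> robin_order 0 x != 0%N -> x \in pts.
  by move=> x0; apply: contraNT => xs; have [-> _] := out x x0 xs.
have inE' x : x < 0 -> robin_order (- sqrt_opp x) x != 0%N -> x \in pts.
  by move=> x0; apply: contraNT => xs; have [_ ->] := out x x0 xs.
have rtnN (t : R) : 0 < t -> sqrt_opp (- t ^+ 2) = t.
  move=> t0; have [|r0 rE] := @sqrt_opp_gt0 R (- t ^+ 2); first by rewrite oppr_lt0 exprn_gt0.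
  by apply/eqP; rewrite -(@eqrXn2 _ 2)// ?ltW//; apply/eqP; apply: oppr_inj.
exists (\sum_(x <- pts) robin_order 0 x)%N; split.
- rewrite S; apply: (number_of_image (f := fun x => 0 +i* sqrt_opp x) (h := fun z => - complex.Im z ^+ 2)) => //.
  + by move=> x /neg' /sqrt_opp_gt0[].
  + move=> z; split=> [[[t t0 ->] /jost_imag_eq0 kt]|[x xs [kx ->]]].
      by exists (- t ^+ 2); rewrite ?rtnN//; apply: inE'; rewrite ?rtnN// oppr_lt0 exprn_gt0.
    have [r0 rE] := sqrt_opp_gt0 (neg' x xs); split; first by exists (sqrt_opp x).
    by apply/jost_imag_eq0; rewrite rE.
  + move=> x xs; have [r0 rE] := sqrt_opp_gt0 (neg' x xs).
    have := zero_orderZ sign_neq0 (jost_order_det hg T hl hq r0); rewrite rE.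
    by have -> // : jost T l q s = fun z => (-1) ^+ s * \det (robin_mx 1 ((0 +i* 1) * z) (z ^+ 2));
      apply/funext => z; rewrite (jostE hg).
- apply: (number_of_image (f := fun x => x%:C) (h := fun z => complex.Re z)) => //.
  + move=> z; split=> [[/negativeP[x x0 ->] /phi_N_eq0 kx]|[x xs [kx ->]]].
      by exists x => //; exact: inN.
    by split; [apply/negativeP; exists x => //; exact: neg'|exact/phi_N_eq0].
  + move=> x xs; have := zero_orderZ sign_neq0 (robin_order_det hg T hl hq 0 x).
    by have -> // : phi_N T l q s = fun z => (-1) ^+ s * \det (robin_mx 1 0%:C z);
      apply/funext => z; rewrite phi_NE.
- apply: (number_of_image (f := fun x => x%:C) (h := fun z => complex.Re z)) => //.
  + move=> z; split=> [[/negativeP[x x0 ->] /(L_N_kernel hg T hl hq _).2 dx]|[x xs [kx ->]]].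
      have kx : robin_order 0 x != 0%N by apply/corank0P.
      by exists x => //; exact: inN.
    split; first by apply/negativeP; exists x => //; exact: neg'.
    by apply/(L_N_kernel hg T hl hq _).2/corank0P.
  + by move=> x xs; exact: (L_N_kernel hg T hl hq _).1.
- rewrite S; apply: (number_of_image (f := fun x => x%:C) (h := fun z => complex.Re z)) => //.
  + move=> z; split=> [[/negativeP[x x0 ->]]|[x xs [kx ->]]].
      have [r0 rE] := sqrt_opp_gt0 x0; have [_] := L_inf_kernel hg T hl hq r0.
      rewrite rE => h /h dx; have kx : robin_order (- sqrt_opp x) x != 0%N by apply/corank0P.
      by exists x => //; exact: inE'.
    split; first by apply/negativeP; exists x => //; exact: neg'.
    have [r0 rE] := sqrt_opp_gt0 (neg' x xs); have [_] := L_inf_kernel hg T hl hq r0.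
    by rewrite rE => h; apply/h/corank0P.
  + move=> x xs; have [r0 rE] := sqrt_opp_gt0 (neg' x xs).
    by have [] := L_inf_kernel hg T hl hq r0; rewrite rE.
Qed.

End Zeros.

Theorem theorem4p9 (R : realType) (g : nat) (hg : (0 < g)%N)
    (T : rooted_tree g) (l : R) (hl : 0 < l)
    (q : 'I_g -> R -> R) (hq : forall j, L2 (edge l) (q j))
    (s : 'S_(g + g))
    (hs : forall i : 'I_(g + g), (i < root_degree T)%N -> s i = i) :
  (exists2 M : R, 0 < M &
     forall z : R[i], jost T l q s z = 0 ->
       complex.Im z <= 0 \/ (exists2 t : R, 0 < t <= M & z = 0 +i* t)) /\
  (exists n : nat,
     [/\ number_of_zeros (jost T l q s) (@positive_imaginary_axis R) n,
         number_of_zeros (phi_N T l q s) (@negative_axis R) n,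
         number_of_eigenvalues (fun=> edge l) (L_N T l q)
           (@negative_axis R) n &
         number_of_eigenvalues (lead_domain l) (L_inf T l q)
           (@negative_axis R) n]).
Proof. by split; [exact: jost_zeros|exact: equal_numbers]. Qed.
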